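(* Let $p$ be a prime, $q$ a prime power with $p\nmid q$, $d$ the multiplicative order of $q$ modulo $p$, and $\lambda_i=v_p(q^{dp^i}-1)$ for $i\ge0$. Let $G=\prod_{j=1}^{r}C_{p^j}^{k_j}$ with $k_j\ge0$, $k_r>0$, $c_i=\sum_{j=1}^{r}\min(i,j)k_j$, $b_i=c_{\lambda_i}-\lambda_i-i$, and let $l$ be the smallest index $i\ge0$ minimizing $p^{-i}\left(b_i-\frac{1}{p-1}\right)$. Then for every $n\ge 0$: if either $p\geq 3$ or $\lambda_0\geq 2$, $$v_p(\#\operatorname{Hom}(G,GL_n(\mathbb{F}_q)))\geq b_l\left\lfloor\frac{n}{dp^l}\right\rfloor+\sum_{i=0}^l\left\lfloor\frac{n}{dp^i}\right\rfloor+(\lambda_0-1)\left\lfloor \frac nd\right\rfloor;$$ and if $p=2$ and $\lambda_0=1$, $$v_p(\#\operatorname{Hom}(G,GL_n(\mathbb{F}_q)))\geq b_l\left\lfloor\frac{n}{2^l}\right\rfloor+\sum_{i=0}^l\left\lfloor\frac{n}{2^i}\right\rfloor+(\lambda_1-2)\left\lfloor \frac n2\right\rfloor.$$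
   Context: $C_m$ is the cyclic group of order $m$; $v_p$ is the $p$-adic valuation; $\#\operatorname{Hom}(G,H)$ is the number of group homomorphisms from $G$ to $H$. *)

(* Defs.v *)
From HB Require Import structures.
From mathcomp Require Import all_boot all_order all_algebra all_fingroup.

Set Implicit Arguments.
Unset Strict Implicit.
Unset Printing Implicit Defensive.

Import Order.TTheory GRing.Theory Num.Theory.

(* The library's {'GL_n[F]} consists of matrices of size n.-1.+1, so at n = 0 *)
(* it is F^*.  The type below is the group of invertible n x n matrices for   *)
(* every n, trivial at n = 0; GLn_isog identifies the two for n > 0.          *)
Section GLn.
Local Open Scope ring_scope.
Variables (F : finFieldType) (n : nat).

Record GLn : predArgType := MkGLn { GLn_val : 'M[F]_n; _ : GLn_val \in unitmx }.

HB.instance Definition _ := [isSub for GLn_val].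
HB.instance Definition _ := [Finite of GLn by <:].

Lemma GLn_valP (A : GLn) : GLn_val A \in unitmx. Proof. exact: valP. Qed.

Definition GLn_one : GLn := MkGLn (unitmx1 F n).

Fact GLn_mul_subproof (A B : GLn) : GLn_val A *m GLn_val B \in unitmx.
Proof. by rewrite unitmx_mul !GLn_valP. Qed.
Definition GLn_mul (A B : GLn) : GLn := MkGLn (GLn_mul_subproof A B).

Fact GLn_inv_subproof (A : GLn) : invmx (GLn_val A) \in unitmx.
Proof. by rewrite unitmx_inv GLn_valP. Qed.
Definition GLn_inv (A : GLn) : GLn := MkGLn (GLn_inv_subproof A).

Fact GLn_mulA : associative GLn_mul.
Proof. by move=> A B C; apply: val_inj; rewrite /= mulmxA. Qed.
Fact GLn_mul1 : left_id GLn_one GLn_mul.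
Proof. by move=> A; apply: val_inj; rewrite /= mul1mx. Qed.
Fact GLn_mulV : left_inverse GLn_one GLn_inv GLn_mul.
Proof. by move=> A; apply: val_inj; rewrite /= mulVmx // GLn_valP. Qed.

HB.instance Definition _ := Finite_isGroup.Build GLn GLn_mulA GLn_mul1 GLn_mulV.

End GLn.

Lemma GLn_isog (F : finFieldType) (n : nat) :
  isog [set: {'GL_n.+1[F]}] [set: GLn F n.+1].
Proof.
pose f (u : {'GL_n.+1[F]}) : GLn F n.+1 := MkGLn (GL_unitmx u).
have fM : {in [set: {'GL_n.+1[F]}] &, {morph f : u v / (u * v)%g}}.
  by move=> u v _ _; apply: val_inj.
apply/isogP; exists (Morphism fM).
  apply/injmP=> u v _ _ /(congr1 val) /= uv; exact: val_inj.
apply/setP=> B; rewrite inE; apply/imsetP.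
exists (FinRing.Unit (GLn_valP B : GLn_val B \is a GRing.unit)).
  by rewrite !inE.
exact: val_inj.
Qed.

Definition nHom (gT hT : finGroupType) : nat :=
  #|[set f : {ffun gT -> hT} | morphic [set: gT] f]|.

(* C_p^(k 1) x C_(p^2)^(k 2) x ... x C_(p^r)^(k r): one cyclic factor for     *)
(* each pair (j, s) with 1 <= j <= r and s < k j, the index j : 'I_r being    *)
(* shifted by one.  For p prime the moduli are at least 2, so that each 'Z_m  *)
(* does have m elements; its group law is addition.                           *)
Definition prod_cyclic (p r : nat) (k : nat -> nat) : finGroupType :=
  {dffun forall i : {j : 'I_r & 'I_(k j.+1)}, 'Z_(p ^ (tag i).+1)}.

Definition is_mult_order (q p d : nat) : Prop :=
  [/\ (0 < d)%N, q ^ d = 1 %[mod p]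
    & forall e : nat, (0 < e)%N -> q ^ e = 1 %[mod p] -> (d <= e)%N].

Definition lambda (p q d i : nat) : nat := logn p (q ^ (d * p ^ i) - 1).

Definition c_ (r : nat) (k : nat -> nat) (i : nat) : nat :=
  \sum_(1 <= j < r.+1) minn i j * k j.

Local Open Scope ring_scope.

Definition b_ (p q d r : nat) (k : nat -> nat) (i : nat) : int :=
  (c_ r k (lambda p q d i))%:Z - (lambda p q d i)%:Z - i%:Z.

Definition objective (p q d r : nat) (k : nat -> nat) (i : nat) : rat :=
  (p%:R ^- i) * ((b_ p q d r k i)%:~R - 1 / (p%:R - 1)).

Definition is_smallest_minimizer (f : nat -> rat) (l : nat) : Prop :=
  (forall i : nat, f l <= f i) /\ (forall i : nat, (i < l)%N -> f l < f i).

(* Main.v *)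
(* Put nu(x) = \sum_n #Hom(G, GL_n(F_q)) / #GL_n(F_q) * x^n.                          *)
(* For trivial G, the functional equation of nu under x -> q * x shows that           *)
(* nu(q * x) = R(x) * nu(x), where R = 1 + x / (1 + t * x / (1 + t^2 * x / ...)) and  *)
(* t = 1 / q.  The N-th coefficient of the plethystic logarithm of R is a polynomial  *)
(* in t with integer coefficients, and it vanishes at the nontrivial N-th roots of    *)
(* unity, because the product of R(x), R(z * x), ..., R(z^(m-1) * x) at t = z, a      *)
(* primitive m-th root of unity, is R(x^m) at t = 1.  Dividing by 1 + ... + t^(N-1)   *)
(* yields integer polynomials Om_n, independent of q, such that                       *)
(*   log nu = \sum_(n, K) Om_n(q^-K) * x^(n * K) / (K * (q^K - 1)).                   *)
(* In general a homomorphism is a commuting family of matrices with A_i^(N_i) = 1;    *)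
(* splitting F_q^n along the irreducible factors of 'X^(N_i) - 1, one index i at a    *)
(* time, replaces F_q by its residue extensions, and induction on the number of       *)
(* cyclic factors multiplies the K-th term by eta(K) = \prod_i gcd(N_i, q^K - 1).     *)
(* Since the Om_n are integral, a bound on the valuations of the coefficients of nu   *)
(* follows from one for the exponential of \sum_K eta(K) * x^K / (K * (q^K - 1)).     *)
(* The terms with d not dividing K have a p-integral exponential by Dwork's           *)
(* criterion.  If d divides K and i = v_p(K), the coefficient of x^K has valuation    *)
(* b_i, and the minimality of l bounds the coefficients of its exponential below by   *)
(* b_l * m - v_p(m!) with m = n %/ (d * p^l); this bound is superadditive in n, and   *)
(* adding v_p(#GL_n(F_q)) gives the theorem.                                          *)

Require Import Defs.
From HB Require Import structures.
From mathcomp Require Import all_boot all_order all_algebra all_fingroup all_solvable all_field.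
From mathcomp Require Import ring zify.
From mathcomp Require boolp.

Set Implicit Arguments.
Unset Strict Implicit.
Unset Printing Implicit Defensive.

Import Order.TTheory GRing.Theory Num.Theory.

(** * Valuations of factorials and of [q ^ K - 1] *)

(** The shape of the objective explains the bound. If [z] has valuation [b i], the term [z ^ t / t!]
    in the exponential of [z * x ^ (d * p ^ i)] has valuation about [t * (b i - 1 / (p - 1))], that
    is [objective i / d] per unit of degree. The minimizer [l] is therefore the worst index, and its
    exponential sets the bound for all the others; [key_ineq] makes this exact, rounding included.
    The identity for the generating series is [nu_exp]. It rests on [exp_gl_card] for the trivial
    group, whose integrality is [plethystic_log_div], and on [nu_coprime] and [nu_irreducible] for
    adding a cyclic factor. [coprime_part_int] disposes of the degrees not divisible by [d],
    [twist_bounded] collects the estimates, and Legendre's recursion turns [logn_nHom_ge] into the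
    two closed formulas. *)

Section Legendre.
Variable p : nat.
Hypothesis p_prime : prime p.
Let p_gt1 := prime_gt1 p_prime.
Let p_gt0 := prime_gt0 p_prime.

(** Legendre's recursion: the multiples of [p] up to [N] are [p] times the numbers up to
    [N %/ p]. *)
Lemma logn_fact_div N : logn p N`! = N %/ p + logn p (N %/ p)`!.
Proof.
have E n m : n <= m -> logn p n`! = \sum_(1 <= k < m.+1) n %/ p ^ k.
  move=> le_nm; rewrite logn_fact // [RHS](big_cat_nat (n := n.+1)) //=.
  rewrite [X in _ = _ + X]big1_seq ?addn0 // => k; rewrite mem_index_iota => /andP[_ /andP[nk _]].
  by rewrite divn_small // (leq_trans _ (ltnW (ltn_expl k p_gt1))).
rewrite (E N N.+1) // big_ltn // expn1 big_add1 /= (E (N %/ p) N) ?leq_div //.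
by congr (_ + _); apply: eq_bigr => k _; rewrite expnS divnMA.
Qed.

Lemma logn_fact_le N : logn p N`! <= (N %/ p).*2.
Proof.
have [m] := ubnP N; elim: m N => // m IH [|N] lt_Nm; first by rewrite div0n logn1.
rewrite logn_fact_div -addnn leq_add2l.
apply: leq_trans (IH _ _) _.
  by rewrite -ltnS; apply: leq_trans lt_Nm; rewrite ltnS ltn_Pdiv.
rewrite -muln2; set x := N.+1 %/ p; apply: leq_trans (leq_divM x p).
by rewrite leq_mul2l p_gt1 orbT.
Qed.

Lemma logn_fact_le_id N : logn p N`! <= N.
Proof.
apply: leq_trans (logn_fact_le N) _; rewrite -muln2.
by apply: leq_trans (leq_divM N p); rewrite leq_mul2l p_gt1 orbT.
Qed.

Lemma logn_fact_lt N : 2 < p -> 0 < N -> logn p N`! < N.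
Proof.
move=> p3 N0; apply: leq_ltn_trans (logn_fact_le N) _; rewrite -muln2.
have := leq_divM N p; case: (N %/ p) => [|x] // le_xN.
by apply: leq_trans le_xN; rewrite ltn_mul2l.
Qed.

(** The valuation of [(p ^ s)!]. It equals [(p ^ s - 1) / (p - 1)], which is how the term
    [1 / (p - 1)] of the objective meets factorials. *)
Definition geo s := \sum_(j < s) p ^ j.

Lemma geoE s : (p.-1 * geo s).+1 = p ^ s.
Proof.
rewrite /geo; elim: s => [|s IH]; first by rewrite big_ord0 muln0.
by rewrite big_ord_recr /= mulnDr -addSn IH expnS -mulSn prednK.
Qed.

(** As [x < p ^ s], the first [s] steps of Legendre's recursion act separately on [p ^ s * M] and on
    the low digits [x]. *)
Lemma logn_fact_split s M x : x < p ^ s ->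
  logn p (p ^ s * M + x)`! = logn p M`! + M * geo s + logn p x`!.
Proof.
elim: s M x => [|s IH] M x.
  by rewrite expn0 ltnS leqn0 => /eqP->; rewrite mul1n addn0 /geo big_ord0 muln0 !addn0 logn1 addn0.
move=> lt_x; have lt_xp : x %/ p < p ^ s by rewrite ltn_divLR // -expnSr.
rewrite logn_fact_div expnS -mulnA mulnC divnMDl // IH //.
rewrite [logn p x`!]logn_fact_div /geo big_ord_recr /=; nia.
Qed.

Lemma logn_factD M N : logn p M`! + logn p N`! <= logn p (M + N)`!.
Proof.
have := bin_fact (leq_addr N M); rewrite addKn => <-.
have b0 : 0 < 'C(M + N, M) by rewrite bin_gt0 leq_addr.
by rewrite lognM ?muln_gt0 ?fact_gt0 // lognM ?fact_gt0 // leq_addl.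
Qed.

Lemma leq_logn_fact M N : M <= N -> logn p M`! <= logn p N`!.
Proof. by move=> le_MN; rewrite -(subnKC le_MN) (leq_trans _ (logn_factD _ _)) // leq_addr. Qed.

Lemma logn_fact_prod n : logn p n`! = \sum_(1 <= t < n.+1) logn p t.
Proof.
elim: n => [|n IH]; first by rewrite logn1 big_geq.
by rewrite factS lognM ?fact_gt0 // big_nat_recr //= -IH addnC.
Qed.

End Legendre.

Section Order.
Variables (p q d : nat).
Hypothesis p_prime : prime p.
Hypothesis q_gt1 : 1 < q.
Hypothesis p_ndvd_q : ~~ (p %| q).
Hypothesis d_order : is_mult_order q p d.
Let p_gt1 := prime_gt1 p_prime.
Let p_gt0 := prime_gt0 p_prime.
Let lam := lambda p q d.

Lemma dvdn_subn1 Q : 0 < Q -> (p %| Q - 1) = (Q == 1 %[mod p]).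
Proof. by move=> Q0; rewrite eqn_mod_dvd. Qed.

Lemma expn_sub1_dvd K : (p %| q ^ K - 1) = (d %| K).
Proof.
have [d0 qd dmin] := d_order; rewrite dvdn_subn1 ?expn_gt0 ?(ltnW q_gt1) //.
have qdm m : q ^ (d * m) = 1 %[mod p] by rewrite expnM -modnXm qd modnXm exp1n.
apply/eqP/idP => [qK|/dvdnP[m ->]]; last by rewrite mulnC qdm.
rewrite /dvdn; apply/negPn/negP; rewrite -lt0n => r0.
have qr : q ^ K = q ^ (K %% d) %[mod p].
  by rewrite {1}(divn_eq K d) expnD (mulnC _ d) -modnMml qdm modnMml mul1n.
have := dmin _ r0; rewrite -qr => /(_ qK).
by rewrite leqNgt ltn_mod d0.
Qed.

Lemma order_dvd_pred : d %| p.-1.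
Proof.
have cop : coprime q p by rewrite coprime_sym prime_coprime.
rewrite -expn_sub1_dvd dvdn_subn1 ?expn_gt0 ?(ltnW q_gt1) //; apply/eqP.
by have := Euler_exp_totient cop; rewrite totient_prime.
Qed.

Lemma order_lt : d < p.
Proof.
have p1 : 0 < p.-1 by rewrite -ltnS prednK.
by rewrite -[ltnRHS](prednK p_gt0) ltnS dvdn_leq // order_dvd_pred.
Qed.

Lemma order_coprime : coprime d p.
Proof.
have [d0 _ _] := d_order.
by rewrite coprime_sym prime_coprime // gtnNdvd // order_lt.
Qed.

Lemma sub1_expn_factor Q m : 0 < Q -> Q ^ m - 1 = (Q - 1) * \sum_(j < m) Q ^ j.
Proof. by move=> Q0; rewrite !subn1 predn_exp. Qed.

(** Lifting the exponent: the cofactor [\sum_(j < u) Q ^ j] is congruent to [u] modulo [p]. *)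
Lemma logn_sub1_coprime Q u : 1 < Q -> p %| Q - 1 -> ~~ (p %| u) ->
  logn p (Q ^ u - 1) = logn p (Q - 1).
Proof.
move=> Q1 pQ pu; have Q0 : 0 < Q by exact: ltnW.
have u0 : 0 < u by case: u pu => //; rewrite dvdn0.
have Su : \sum_(j < u) Q ^ j = u %[mod p].
  rewrite -modn_summ (eq_bigr (fun=> 1 %% p)) => [|j _].
    by rewrite modn_summ sum_nat_const card_ord muln1.
  by move: pQ; rewrite -modnXm dvdn_subn1 // => /eqP->; rewrite modnXm exp1n.
have nS : ~~ (p %| \sum_(j < u) Q ^ j) by rewrite /dvdn Su.
have S0 : 0 < \sum_(j < u) Q ^ j by case: (\sum_(j < u) _) nS => //; rewrite dvdn0.
by rewrite sub1_expn_factor // lognM ?subn_gt0 // (lognE p (\sum_(j < u) _)) (negbTE nS) !andbF addn0.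
Qed.

(** The cofactor [\sum_(j < p) Q ^ j] is divisible by [p]. For odd [p] it is [p] modulo [p ^ 2], by
    expanding [Q = 1 + p * m] to first order; for [p = 2] and [Q = 1] modulo 4 it is 2 modulo 4. For
    [Q = 3] modulo 4 the jump is larger, hence the separate case of the theorem. *)
Lemma logn_sub1_prime Q : 1 < Q -> p %| Q - 1 ->
  logn p (Q - 1) < logn p (Q ^ p - 1) /\
  ((2 < p) || (2 <= logn p (Q - 1)) -> logn p (Q ^ p - 1) = (logn p (Q - 1)).+1).
Proof.
move=> Q1 pQ; have Q0 : 0 < Q by exact: ltnW.
have Qm j : Q ^ j = 1 %[mod p].
  by move: pQ; rewrite -modnXm dvdn_subn1 // => /eqP->; rewrite modnXm exp1n.
have pS : p %| \sum_(j < p) Q ^ j.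
  rewrite /dvdn -modn_summ (eq_bigr (fun=> 1)) => [|j _]; last by rewrite Qm modn_small.
  by rewrite sum_nat_const card_ord muln1 modnn.
have S0 : 0 < \sum_(j < p) Q ^ j.
  by rewrite -(prednK p_gt0) big_ord_recl expn0.
rewrite sub1_expn_factor // lognM ?subn_gt0 //.
have v1 : 0 < logn p (\sum_(j < p) Q ^ j) by rewrite -pfactor_dvdn // expn1.
split=> [|pQ2]; first by rewrite -addn1 leq_add2l.
suff -> : logn p (\sum_(j < p) Q ^ j) = 1 by rewrite addn1.
apply/eqP; rewrite eqn_leq v1 andbT leqNgt -pfactor_dvdn //.
have [m QE] : exists m, Q = p * m + 1.
  by case/dvdnP: pQ => m mE; exists m; rewrite mulnC -mE subnK.
have [p3|p2] := ltnP 2 p.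
  have Sj j : Q ^ j = 1 + j * (p * m) %[mod p ^ 2].
    elim: j => [|j IH]; first by rewrite expn0 mul0n addn0.
    rewrite expnS -modnMmr IH modnMmr QE.
    have -> : (p * m + 1) * (1 + j * (p * m)) = j * m * m * p ^ 2 + (1 + j.+1 * (p * m)) by ring.
    by rewrite modnMDl.
  rewrite /dvdn -modn_summ (eq_bigr (fun j : 'I_p => (1 + j * (p * m)) %% p ^ 2)) => [|j _]; last exact: Sj.
  rewrite modn_summ big_split /= sum_nat_const card_ord muln1 -big_distrl /=.
  rewrite -(big_mkord xpredT (fun i => i)) bin2_sum.
  have p_odd : odd p by case: (even_prime p_prime) p3 => [->|].
  have -> : 'C(p, 2) = p * p.-1./2.
    exact: bin2odd.
  rewrite (_ : p * p.-1./2 * (p * m) = p.-1./2 * m * p ^ 2); last by ring.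
  rewrite addnC modnMDl modn_small ?gtn_eqF //.
  by rewrite -{1}(expn1 p) ltn_exp2l.
have pE : p = 2 by apply/eqP; rewrite eqn_leq p2 p_gt1.
move: pQ2; rewrite pE /= -pfactor_dvdn ?subn_gt0 // => Q4.
rewrite !big_ord_recl big_ord0 /= expn0 addn0 /bump /= expn1.
case/dvdnP: Q4 => w wE; have -> : Q = w * 4 + 1 by rewrite -[4]/(2 ^ 2) -wE subnK.
by rewrite addnC -addnA /dvdn modnMDl.
Qed.

Lemma lambda0_gt0 : 0 < lam 0.
Proof.
have [d0 _ _] := d_order.
have q0 : 0 < q ^ d - 1 by rewrite subn_gt0 -{1}(expn0 q) ltn_exp2l.
by rewrite /lam /lambda muln1 -pfactor_dvdn // expn1 expn_sub1_dvd.
Qed.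

Let Qi i := q ^ (d * p ^ i).

Let Qi_gt1 i : 1 < Qi i.
Proof.
have [d0 _ _] := d_order.
by rewrite -(expn0 q) ltn_exp2l // muln_gt0 d0 expn_gt0 p_gt0.
Qed.

Let Qi_p i : p %| Qi i - 1. Proof. by rewrite expn_sub1_dvd dvdn_mulr. Qed.

Let QiS i : Qi i.+1 = Qi i ^ p. Proof. by rewrite /Qi expnSr mulnA expnM. Qed.

Lemma lambda_ltS i : lam i < lam i.+1.
Proof.
rewrite /lam /lambda -/(Qi i) -/(Qi i.+1) QiS.
by case: (logn_sub1_prime (Qi_gt1 i) (Qi_p i)).
Qed.

Lemma lambda_ltn i j : i < j -> lam i < lam j.
Proof.
elim: j => // j IH; rewrite ltnS leq_eqVlt => /orP[/eqP->|/IH lt_ij].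
  exact: lambda_ltS.
exact: ltn_trans (lambda_ltS j).
Qed.

Lemma lambda_gt i : i < lam i.
Proof.
elim: i => [|i IH]; first exact: lambda0_gt0.
exact: leq_ltn_trans IH (lambda_ltS i).
Qed.

(** An irregular jump is possible only at [i = 0]: from [i = 1] on, [lambda_gt] gives
    [lam i >= 2]. *)
Lemma lambdaS i : (2 < p) || (2 <= lam 0) || (0 < i) -> lam i.+1 = (lam i).+1.
Proof.
move=> hi; rewrite /lam /lambda -/(Qi i) -/(Qi i.+1) QiS.
have [_ ->] // := logn_sub1_prime (Qi_gt1 i) (Qi_p i).
case/orP: hi => [/orP[->//|l0]|i0]; apply/orP; right; rewrite -/(lam i).
  by case: i => // i; apply: leq_trans l0 _; apply: ltnW; exact: lambda_ltn.
by case: i i0 => // i _; apply: leq_ltn_trans (lambda_gt i.+1).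
Qed.

(** Write [K = d * p ^ v * u] with [u] prime to [p]; as [d < p], the exponent [v] is the valuation
    of [K]. *)
Lemma logn_expn_sub1 K : 0 < K ->
  logn p (q ^ K - 1) = if d %| K then lam (logn p K) else 0.
Proof.
move=> K0; case: ifP => [|nd]; last first.
  by rewrite lognE expn_sub1_dvd nd !andbF.
move=> /dvdnP[m mE]; have m0 : 0 < m by case: m mE K0 => // ->.
have [d0 _ _] := d_order.
have -> : logn p K = logn p m.
  by rewrite mE lognM // (lognE p d) p_prime d0 gtnNdvd ?order_lt // addn0.
have [u pu uE] := pfactor_coprime p_prime m0.
set v := logn p m in uE *.
have -> : K = d * p ^ v * u by rewrite mE uE; ring.
have pu' : ~~ (p %| u) by rewrite -prime_coprime.
by rewrite expnM /lam /lambda -/(Qi v) (logn_sub1_coprime (Qi_gt1 v) (Qi_p v) pu').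
Qed.

End Order.

Local Open Scope ring_scope.

(** * Formal power series and exponentials *)

(** A wrapper around coefficient functions, so that they can carry the convolution product. Equality
    and choice are classical, and [eq_series] is functional extensionality. *)
Record series (A : Type) := Series { scoef :> nat -> A }.

HB.instance Definition _ (A : Type) := boolp.gen_eqMixin (series A).
HB.instance Definition _ (A : Type) := boolp.gen_choiceMixin (series A).

Lemma eq_series (A : Type) (f g : series A) : (forall n, f n = g n) -> f = g.
Proof. by case: f g => [f] [g] /= fg; congr Series; apply: boolp.funext. Qed.

Section SeriesRing.
Variable A : comNzRingType.
Implicit Types a b f g h : series A.

Definition sadd f g := Series (fun n => f n + g n).
Definition sopp f := Series (fun n => - f n).
Definition smul f g := Series (fun n => \sum_(j < n.+1) f j * g (n - j)%N).

Fact saddA : associative sadd.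
Proof. by move=> f g h; apply: eq_series => n /=; rewrite addrA. Qed.
Fact saddC : commutative sadd.
Proof. by move=> f g; apply: eq_series => n /=; rewrite addrC. Qed.
Fact sadd0 : left_id (Series (fun=> 0)) sadd.
Proof. by move=> f; apply: eq_series => n /=; rewrite add0r. Qed.
Fact saddN : left_inverse (Series (fun=> 0)) sopp sadd.
Proof. by move=> f; apply: eq_series => n /=; rewrite addNr. Qed.

HB.instance Definition _ := GRing.isZmodule.Build (series A) saddA saddC sadd0 saddN.

(** A coefficient of a product depends only on truncations, so the ring laws are inherited from
    polynomials. *)
Lemma smul_polyE f g (p q : {poly A}) n :
  (forall i, (i <= n)%N -> p`_i = f i) -> (forall i, (i <= n)%N -> q`_i = g i) ->
  smul f g n = (p * q)`_n.
Proof.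
move=> pf qg; rewrite coefM; apply: eq_bigr => j _.
by rewrite pf ?qg ?leq_subr // -ltnS.
Qed.

Definition spoly n f : {poly A} := \poly_(i < n.+1) f i.

Lemma coef_spoly n f i : (i <= n)%N -> (spoly n f)`_i = f i.
Proof. by move=> le_in; rewrite coef_poly ltnS le_in. Qed.

Fact smulC : commutative smul.
Proof.
move=> f g; apply: eq_series => n.
by rewrite !(smul_polyE (@coef_spoly n _) (@coef_spoly n _)) mulrC.
Qed.

Fact smulA : associative smul.
Proof.
move=> f g h; apply: eq_series => n.
have PM u v i : (i <= n)%N -> (spoly n u * spoly n v)`_i = smul u v i.
  by move=> le_in; apply/esym/smul_polyE => j /leq_trans le_j;
     rewrite coef_spoly // le_j.
rewrite (smul_polyE (@coef_spoly n _) (PM g h)) mulrA.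
by rewrite (smul_polyE (PM f g) (@coef_spoly n _)).
Qed.

Fact smul1 : left_id (Series (fun n => (n == 0)%:R)) smul.
Proof.
move=> f; apply: eq_series => n; rewrite /= big_ord_recl /= mul1r subn0.
by rewrite big1 ?addr0 // => i _; rewrite mul0r.
Qed.

Fact smulDl : left_distributive smul +%R.
Proof.
move=> f g h; apply: eq_series => n; rewrite /= -big_split /=.
by apply: eq_bigr => j _; rewrite mulrDl.
Qed.

Fact sone_neq0 : Series (fun n => (n == 0)%:R) != 0 :> series A.
Proof. by apply/eqP => /(congr1 (fun f : series A => f 0)) /eqP; rewrite oner_eq0. Qed.

HB.instance Definition _ :=
  GRing.Zmodule_isComNzRing.Build (series A) smulA smulC smul1 smulDl sone_neq0.

Lemma scoefD f g n : (f + g) n = f n + g n. Proof. by []. Qed.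
Lemma scoefN f n : (- f) n = - f n. Proof. by []. Qed.
Lemma scoef0 n : (0 : series A) n = 0. Proof. by []. Qed.
Lemma scoef1 n : (1 : series A) n = (n == 0)%:R. Proof. by []. Qed.
Lemma scoefM f g n : (f * g) n = \sum_(j < n.+1) f j * g (n - j)%N.
Proof. by []. Qed.
Lemma scoefM0 f g : (f * g) 0 = f 0 * g 0.
Proof. by rewrite scoefM big_ord1. Qed.

Lemma scoef_sum (I : Type) (r : seq I) (P : pred I) (F : I -> series A) n :
  (\sum_(i <- r | P i) F i) n = \sum_(i <- r | P i) F i n.
Proof. by elim/big_rec2: _ => // i y x _ <-. Qed.

Lemma eq_scoefM f f' g g' n : (forall i, (i <= n)%N -> f i = f' i) ->
  (forall i, (i <= n)%N -> g i = g' i) -> (f * g) n = (f' * g') n.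
Proof.
move=> ff' gg'; apply: eq_bigr => j _.
by rewrite ff' ?gg' ?leq_subr // -ltnS.
Qed.

Definition smon (c : A) (m : nat) : series A := Series (fun n => if n == m then c else 0).

Lemma scoef_smonM c m f n :
  (smon c m * f) n = if (m <= n)%N then c * f (n - m)%N else 0.
Proof.
rewrite scoefM; case: leqP => [le_mn|lt_nm]; last first.
  rewrite big1 // => j _ /=; case: eqP => [jm|]; last by rewrite mul0r.
  by move: (ltn_ord j); rewrite jm ltnS leqNgt lt_nm.
have lt_m : (m < n.+1)%N by [].
rewrite (bigD1 (Ordinal lt_m)) //= eqxx big1 ?addr0 // => j.
by rewrite -val_eqE /= => /negbTE->; rewrite mul0r.
Qed.

(* The Euler operator x d/dx; unlike d/dx it preserves degrees. *)
Definition theta f : series A := Series (fun n => n%:R * f n).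

Lemma thetaM f g : theta (f * g) = theta f * g + f * theta g.
Proof.
apply: eq_series => n; rewrite scoefD !scoefM /= mulr_sumr -big_split /=.
apply: eq_bigr => j _; have -> : (n%:R : A) = j%:R + (n - j)%N%:R.
  by rewrite -natrD subnKC // -ltnS.
by ring.
Qed.

Lemma thetaD f g : theta (f + g) = theta f + theta g.
Proof. by apply: eq_series => n /=; rewrite mulrDr. Qed.

(* [f] is the exponential of [a - a 0], characterised by its logarithmic derivative. *)
Definition isexp a f : Prop := f 0 = 1 /\ theta f = theta a * f.

Lemma isexpD a b f g : isexp a f -> isexp b g -> isexp (a + b) (f * g).
Proof.
move=> [f0 af] [g0 bg]; split; first by rewrite scoefM0 f0 g0 mulr1.
by rewrite thetaM thetaD af bg; ring.
Qed.

Lemma isexp0 : isexp 0 1.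
Proof.
split=> //; apply: eq_series => n /=.
rewrite big1 => [|j _]; last by rewrite mulr0 mul0r.
by case: n => [|n]; rewrite ?mul0r ?mulr0.
Qed.

Lemma isexp_sum (I : Type) (r : seq I) (P : pred I) (a f : I -> series A) :
  (forall i, P i -> isexp (a i) (f i)) ->
  isexp (\sum_(i <- r | P i) a i) (\prod_(i <- r | P i) f i).
Proof.
by move=> af; elim/big_rec2: _ => [|i g b Pi bg]; [exact: isexp0|apply: isexpD => //; exact: af].
Qed.

Lemma eq_isexp a b f :
  (forall j, (0 < j)%N -> a j = b j) -> isexp a f -> isexp b f.
Proof.
move=> ab [f0 fE]; split=> //; rewrite fE; congr (_ * _); apply: eq_series => -[|n] /=.
  by rewrite !mul0r.
by rewrite ab.
Qed.

Lemma isexp_rec a f n : isexp a f ->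
  n.+1%:R * f n.+1 = \sum_(j < n.+1) j.+1%:R * a j.+1 * f (n - j)%N.
Proof.
case=> _ /(congr1 (fun g : series A => g n.+1)); rewrite scoefM /= => ->.
by rewrite big_ord_recl mul0r mul0r add0r; apply: eq_bigr.
Qed.

(** Substitution of [x ^ e] for [x]. *)
Definition dilate (e : nat) f : series A :=
  Series (fun n => if (e %| n)%N then f (n %/ e)%N else 0).

Lemma dilateM e f g : (0 < e)%N -> dilate e (f * g) = dilate e f * dilate e g.
Proof.
move=> e0; apply: eq_series => n; rewrite scoefM [LHS]/=.
have [/dvdnP[m ->]|ndv] := boolP (e %| n)%N; last first.
  rewrite big1 // => j _ /=; case: ifP => [dj|]; last by rewrite mul0r.
  case: ifP => [dnj|]; last by rewrite mulr0.
  by case/negP: ndv; rewrite -(subnKC (_ : j <= n)%N) ?dvdn_add // -ltnS.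
rewrite mulnK //.
rewrite -(big_mkord xpredT (fun j => dilate e f j * dilate e g (m * e - j)%N)).
rewrite -(big_mkord xpredT (fun j => f j * g (m - j)%N)).
have H K (u : nat -> A) : \sum_(0 <= i < (K * e).+1)
     (if (e %| i)%N then u (i %/ e)%N else 0) = \sum_(0 <= i < K.+1) u i.
  elim: K => [|K IHK]; first by rewrite mul0n !big_nat1 dvdn0 div0n.
  rewrite [RHS]big_nat_recr //= -IHK (big_cat_nat (n := (K * e).+1)) //=; last first.
    by rewrite ltnS leq_mul2r leqnSn orbT.
  congr (_ + _); rewrite big_nat_recr /=; last by rewrite ltn_pmul2r.
  rewrite dvdn_mull // mulnK // big_nat_cond big1 ?add0r // => i.
  rewrite andbT => /andP[lo hi]; case: ifP => // /dvdnP[t it]; move: lo hi.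
  by rewrite it !ltn_pmul2r // ltnS => lo; rewrite leqNgt lo.
rewrite -(H m (fun i => f i * g (m - i)%N)) !big_nat; apply: eq_bigr => i.
rewrite ltnS => /andP[_ le_i] /=; case: ifP => [/dvdnP[t it]|]; last by rewrite mul0r.
by rewrite it -mulnBl dvdn_mull // !mulnK.
Qed.

Lemma theta_dilate e f : theta (dilate e f) = smon e%:R 0 * dilate e (theta f).
Proof.
apply: eq_series => n; rewrite scoef_smonM leq0n subn0 /=.
case: ifP => [/dvdnP[m ->]|_]; last by rewrite !mulr0.
case: e => [|e]; first by rewrite muln0 !mul0r.
by rewrite mulnK // natrM mulrCA mulrA.
Qed.

Lemma isexp_dilate e a f : (0 < e)%N -> isexp a f -> isexp (dilate e a) (dilate e f).
Proof.
move=> e0 [f0 fE]; split; first by rewrite /= dvdn0 div0n.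
by rewrite !theta_dilate fE dilateM // mulrA.
Qed.

Lemma dilateD e f g : dilate e (f + g) = dilate e f + dilate e g.
Proof. by apply: eq_series => n; rewrite scoefD /=; case: ifP; rewrite ?addr0. Qed.

Lemma dilate_smon e c m : (0 < e)%N -> dilate e (smon c m) = smon c (e * m).
Proof.
move=> e0; apply: eq_series => n /=; case: (boolP (e %| n)%N) => [/dvdnP[t ->]|ndv].
  by rewrite mulnK // mulnC eqn_pmul2l.
by case: eqP => // nm; rewrite nm dvdn_mulr in ndv.
Qed.

Lemma scoef_sum_dilate (g : nat -> series A) K M : (0 < M)%N ->
  (\sum_(1 <= n < K) dilate n (g n)) M =
  \sum_(n < M.+1 | (n %| M)%N && (n < K)%N) g n (M %/ n)%N.
Proof.
move=> M0; rewrite scoef_sum /= -big_mkcond /=.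
rewrite -(big_mkord (fun n => (n %| M)%N && (n < K)%N) (fun n => g n (M %/ n)%N)).
rewrite [RHS]big_ltn_cond // dvd0n (gtn_eqF M0) /=.
rewrite (big_nat_widen _ _ _ _ _ (leq_maxl K M.+1)).
rewrite [RHS](big_nat_widen _ _ _ _ _ (leq_maxr K M.+1)).
apply: eq_bigl => n; rewrite -andbA; case: (boolP (n %| M)%N) => //= nM.
by rewrite ltnS (dvdn_leq M0 nM) andbT.
Qed.

(** Substitution of [c * x] for [x]. *)
Definition sscale (c : A) f : series A := Series (fun n => c ^+ n * f n).

Lemma sscaleM c f g : sscale c (f * g) = sscale c f * sscale c g.
Proof.
apply: eq_series => n; rewrite scoefM /= mulr_sumr; apply: eq_bigr => j _.
have {1}-> : n = (j + (n - j))%N by rewrite subnKC // -ltnS.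
by rewrite exprD; ring.
Qed.

Lemma sscale_sscale c e f : sscale c (sscale e f) = sscale (c * e) f.
Proof. by apply: eq_series => n /=; rewrite exprMn mulrA. Qed.

Lemma theta_sscale c f : theta (sscale c f) = sscale c (theta f).
Proof. by apply: eq_series => n /=; rewrite mulrCA. Qed.

Lemma isexp_sscale c a f : isexp a f -> isexp (sscale c a) (sscale c f).
Proof.
move=> [f0 fE]; split; first by rewrite /= expr0 mul1r.
by rewrite !theta_sscale fE sscaleM.
Qed.

End SeriesRing.

Section SeriesMap.
Variables (A B : comNzRingType) (phi : {rmorphism A -> B}).

Definition smap (f : series A) : series B := Series (fun n => phi (f n)).

Lemma smapM f g : smap (f * g) = smap f * smap g.
Proof.
by apply: eq_series => n; rewrite scoefM /= rmorph_sum; apply: eq_bigr => j _; rewrite rmorphM.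
Qed.

Lemma isexp_smap a f : isexp a f -> isexp (smap a) (smap f).
Proof.
move=> [f0 fE]; have thE u : theta (smap u) = smap (theta u).
  by apply: eq_series => n /=; rewrite rmorphM rmorph_nat.
by split; [rewrite /= f0 rmorph1|rewrite !thE fE smapM].
Qed.

End SeriesMap.

(** Recursion on the list of all earlier values; it provides exponentials, logarithms, the continued
    fraction and plethystic logarithms. *)
Lemma course_of_values (T : Type) (step : seq T -> T) :
  exists f : nat -> T, forall n, f n = step [seq f i | i <- iota 0 n].
Proof.
pose fix s n := if n is n'.+1 then rcons (s n') (step (s n')) else [::].
exists (fun n => step (s n)) => n; congr (step _).
elim: n => [//|n IH]; rewrite -[in RHS]addn1 iotaD map_cat -IH add0n.
by rewrite [map _ (iota n 1)]/= cats1.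
Qed.

Section Exponential.
Variable A : comUnitRingType.
Hypothesis charA : forall n, (n.+1%:R : A) \is a GRing.unit.
Implicit Types (f g a b : series A) (c : A).

Lemma isexp_eq_le a b f g n : isexp a f -> isexp b g ->
  (forall j, (0 < j <= n)%N -> a j = b j) -> f n = g n.
Proof.
move=> af bg ab; have [m] := ubnP n; elim: m n ab => // m IH [|n] ab lt_nm.
  by case: af bg => [-> _] [-> _].
apply: (mulrI (charA n)).
rewrite (isexp_rec _ af) (isexp_rec _ bg); apply: eq_bigr => j _.
rewrite ab /= ?ltn_ord // (IH (n - j)%N) //.
  by move=> i /andP[i0 le_i]; rewrite ab // i0 (leq_trans le_i) // leqW // leq_subr.
by rewrite -ltnS; apply: leq_ltn_trans lt_nm; rewrite ltnS leq_subr.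
Qed.

Lemma isexp_uniq a f g : isexp a f -> isexp a g -> f = g.
Proof. by move=> af ag; apply: eq_series => n; exact: isexp_eq_le af ag _. Qed.

Lemma exp_exists a : exists f, isexp a f.
Proof.
have [f fE] := course_of_values (fun s : seq A => if size s is n.+1 then
  n.+1%:R^-1 * \sum_(j < n.+1) j.+1%:R * a j.+1 * s`_(n - j) else 1).
exists (Series f); split=> /=; first by rewrite fE.
apply: eq_series => -[|n]; rewrite scoefM /=; first by rewrite big_ord1 !mul0r.
rewrite big_ord_recl !mul0r add0r fE size_map size_iota mulVKr //.
apply: eq_bigr => j _; rewrite (nth_map 0%N) ?size_iota ?ltnS ?leq_subr //.
by rewrite nth_iota ?ltnS ?leq_subr.
Qed.

Lemma log_exists f : f 0 = 1 -> exists a, isexp a f.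
Proof.
move=> f0.
have [a aE] := course_of_values (fun s : seq A => let n := size s in
  f n - n%:R^-1 * \sum_(j < n) j%:R * s`_j * f (n - j)%N).
exists (Series a); split=> //.
apply: eq_series => -[|n]; rewrite scoefM /=; first by rewrite big_ord1 !mul0r.
rewrite big_ord_recr /= subnn f0 mulr1 (aE n.+1) size_map size_iota.
rewrite mulrBr mulVKr // [X in _ - X](_ : _ = \sum_(j < n.+1) j%:R * a j * f (n.+1 - j)%N).
  by rewrite addrC subrK.
apply: eq_bigr => j _; rewrite (nth_map 0%N) ?size_iota ?ltn_ord //.
by rewrite nth_iota ?ltn_ord.
Qed.

Lemma log_uniq a b f n : isexp a f -> isexp b f -> (0 < n)%N -> a n = b n.
Proof.
move=> af bf; have [m] := ubnP n; elim: m n => // m IH [//|n] lt_nm _.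
have := isexp_rec n af; rewrite (isexp_rec n bf) !big_ord_recr /= subnn.
case: af => -> _; rewrite !mulr1 => E.
apply: (mulrI (charA n)); apply: (@addrI _ (\sum_(j < n) j.+1%:R * a j.+1 * f (n - j)%N)).
rewrite -{}E; congr (_ + _); apply: eq_bigr => j _; rewrite IH //.
exact: leq_ltn_trans (ltn_ord j : (j.+1 <= n)%N) (lt_nm : (n < m)%N).
Qed.

(** The logarithm is [- log (1 - c * x)]; its coefficient at 0 contains the default inverse of 0,
    which [theta] discards. *)
Lemma isexp_geometric c :
  isexp (Series (fun n => c ^+ n * n%:R^-1)) (Series (fun n => c ^+ n)).
Proof.
split; first by rewrite /= expr0.
apply: eq_series => n; rewrite scoefM /= big_ord_recl /= mul0r mul0r add0r.
transitivity (\sum_(j < n) c ^+ n); first by rewrite sumr_const card_ord mulr_natl.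
apply: eq_bigr => j _; rewrite mulrCA divrr ?mulr1 //.
by rewrite -exprD subnKC.
Qed.

Lemma isexp_monomial c m : (0 < m)%N ->
  isexp (smon c m)
    (Series (fun n => if (m %| n)%N then c ^+ (n %/ m) / (n %/ m)`!%:R else 0)).
Proof.
move=> m0.
have E1 : isexp (smon c 1) (Series (fun n => c ^+ n / n`!%:R)).
  split; first by rewrite /= expr0 fact0 divr1.
  apply: eq_series => -[|n]; rewrite scoefM /=.
    by rewrite big_ord1 !mul0r.
  rewrite big_ord_recl !mul0r add0r big_ord_recl /= mul1r subn1 /=.
  rewrite big1 ?addr0 => [|i _]; last by rewrite !mulr0 mul0r.
  have fU k : (k`!%:R : A) \is a GRing.unit.
    by case: k`! (fact_gt0 k) => // k' _; exact: charA.
  by rewrite exprS factS natrM invrM // mulrC -!mulrA mulVr // mulr1.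
by have := isexp_dilate m0 E1; rewrite dilate_smon // muln1.
Qed.

(* A multiplicative filtration by additive subgroups (for instance by lower *)
(* bounds on valuations) is inherited by exponentials.                      *)
Variable S : nat -> A -> Prop.
Hypothesis S0 : forall n, S n 0.
Hypothesis SB : forall n x y, S n x -> S n y -> S n (x - y).
Hypothesis SM : forall m n x y, S m x -> S n y -> S (m + n) (x * y).
Hypothesis S1 : S 0 1.

Definition exp_in a : Prop := exists2 f, isexp a f & forall n, S n (f n).

Lemma filterN n x : S n x -> S n (- x).
Proof. by rewrite -sub0r; exact: SB. Qed.

Lemma filter_sum n (I : Type) (r : seq I) (P : pred I) (F : I -> A) :
  (forall i, P i -> S n (F i)) -> S n (\sum_(i <- r | P i) F i).
Proof.
move=> SF; elim/big_ind: _ => // x y Sx Sy.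
by rewrite -[y]opprK; apply: SB => //; exact: filterN.
Qed.

Lemma filter_smul f g : (forall n, S n (f n)) -> (forall n, S n (g n)) ->
  forall n, S n ((f * g) n).
Proof.
move=> Sf Sg n; rewrite scoefM; apply: filter_sum => j _.
have le_jn : (j <= n)%N by rewrite -ltnS.
by rewrite -{1}(subnKC le_jn); apply: SM.
Qed.

Lemma exp_inD a b : exp_in a -> exp_in b -> exp_in (a + b).
Proof.
move=> [f af Sf] [g bg Sg]; exists (f * g); first exact: isexpD.
exact: filter_smul.
Qed.

Lemma exp_in0 : exp_in 0.
Proof. by exists 1; [exact: isexp0|case]. Qed.

(** The inverse of a series with constant term 1 is computed recursively from sums and products of
    coefficients, so it stays in the filtration. *)
Lemma exp_inN a : exp_in a -> exp_in (- a).
Proof.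
move=> [f af Sf]; have [g bg] := exp_exists (- a); exists g => // n.
have gf : f * g = 1.
  by apply: (isexp_uniq (isexpD af bg)); rewrite subrr; exact: isexp0.
have [m] := ubnP n; elim: m n => // m IH [|n] lt_nm; first by case: bg => ->.
have := congr1 (fun h : series A => h n.+1) gf.
rewrite scoefM big_ord_recl scoef1 /= subn0; case: (af) => -> _; rewrite mul1r.
move/eqP; rewrite addr_eq0 => /eqP->; apply/filterN/filter_sum => j _.
have le_jn : (bump 0 j <= n.+1)%N by exact: ltn_ord.
rewrite -{1}(subnKC le_jn); apply: SM => //.
apply: IH; rewrite /bump /= add1n subSS.
by rewrite -ltnS; apply: leq_ltn_trans lt_nm; rewrite ltnS leq_subr.
Qed.

Lemma exp_inMz a (z : int) : exp_in a -> exp_in (a *~ z).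
Proof.
move=> Sa; have H n : exp_in (a *+ n).
  by elim: n => [|n IH]; [rewrite mulr0n; exact: exp_in0|rewrite mulrS; exact: exp_inD].
by case: z => n; [exact: H|rewrite NegzE mulrNz; apply: exp_inN; exact: H].
Qed.

Lemma exp_in_sum (I : Type) (r : seq I) (P : pred I) (a : I -> series A) :
  (forall i, P i -> exp_in (a i)) -> exp_in (\sum_(i <- r | P i) a i).
Proof.
by move=> Sa; elim/big_ind: _ => //; [exact: exp_in0|exact: exp_inD].
Qed.

End Exponential.

(** * A q-continued fraction *)

Section ContinuedFraction.
Variable A : comNzRingType.
Implicit Types (t : A) (f g : series A).

(* The continued fraction [1 + x / (1 + t x / (1 + t ^ 2 x / ...))]. *)
Definition is_cfrac t f : Prop :=
  f 0 = 1 /\ f * sscale t f = sscale t f + smon 1 1.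

(** In degree [n.+1] the terms [t ^+ n.+1 * f n.+1] cancel and [f n.+1] is isolated without any
    division. The fraction thus exists over every ring, and over [{poly int}] this yields integral
    coefficients. *)
Lemma cfrac_rec t f : is_cfrac t f <-> f 0 = 1 /\ forall n,
  f n.+1 = (n == 0)%:R - \sum_(j < n) f j.+1 * (t ^+ (n - j) * f (n - j)%N).
Proof.
have E n : f 0 = 1 -> (f * sscale t f) n.+1 = t ^+ n.+1 * f n.+1 +
    (\sum_(j < n) f j.+1 * (t ^+ (n - j) * f (n - j)%N) + f n.+1).
  move=> f0; rewrite scoefM big_ord_recl /= f0 mul1r subn0; congr (_ + _).
  by rewrite big_ord_recr /= subnn f0 expr0 !mulr1.
split=> -[f0 fE]; split=> //.
  move=> n; have := congr1 (fun h : series A => h n.+1) fE.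
  rewrite E // scoefD /= eqSS => /addrI H; apply/eqP.
  by rewrite eq_sym subr_eq addrC H; case: (n == 0%N).
apply: eq_series => -[|n]; first by rewrite scoefM0 scoefD /= expr0 f0 !mul1r addr0.
rewrite E // scoefD /= eqSS; congr (_ + _); rewrite fE addrC subrK.
by case: (n == 0%N).
Qed.

Lemma cfrac_exists t : exists f, is_cfrac t f.
Proof.
have [f fE] := course_of_values (fun s : seq A => if size s is n.+1 then
  (n == 0)%:R - \sum_(j < n) s`_j.+1 * (t ^+ (n - j) * s`_(n - j)) else 1).
exists (Series f); apply/cfrac_rec; split=> /=; first by rewrite fE.
move=> n; rewrite fE size_map size_iota; congr (_ - _); apply: eq_bigr => j _.
have fnth i : (i < n.+1)%N -> [seq f i | i <- iota 0 n.+1]`_i = f i.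
  by move=> lt_in; rewrite (nth_map 0%N) ?size_iota // nth_iota.
by rewrite !fnth ?ltnS ?leq_subr ?ltn_ord.
Qed.

Lemma series_cancel f g : g 0 = 1 -> f * g = 0 -> f = 0.
Proof.
move=> g0 fg; apply: eq_series => n; have [m] := ubnP n.
elim: m n => // m IH n lt_nm; rewrite scoef0.
have := congr1 (fun h : series A => h n) fg; rewrite scoefM scoef0 big_ord_recr /=.
rewrite subnn g0 mulr1 big1 ?add0r // => j _.
by rewrite IH ?scoef0 ?mul0r // (leq_trans (ltn_ord j)).
Qed.

Lemma sscale_mon c d m : sscale c (smon d m) = smon (c ^+ m * d) m :> series A.
Proof. by apply: eq_series => n /=; case: eqP => [->|_]; rewrite ?mulr0. Qed.

Lemma sscaleD c f g : sscale c (f + g) = sscale c f + sscale c g.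
Proof. by apply: eq_series => n; rewrite scoefD /= mulrDr. Qed.

Section Period.
(** The hypotheses on [z] are what is used of a primitive [m]-th root of unity in a field. *)
Variables (z : A) (m : nat) (f : series A).
Hypotheses (m_gt0 : (0 < m)%N) (zm : z ^+ m = 1) (f_cfrac : is_cfrac z f).
Hypothesis z_reg : forall n (c : A), (0 < n < m)%N -> z ^+ n * c = c -> c = 0.
Hypothesis prod_z : \prod_(i < m) (- z ^+ i) = -1.

Let y i := sscale (z ^+ i) f.
Let w i := smon (z ^+ i) 1 : series A.
Let T := \prod_(i < m) y i.

Let y0 i : y i 0 = 1. Proof. by rewrite /= expr0 mul1r; case: f_cfrac. Qed.

Let yE i : y i * y i.+1 = y i.+1 + w i.
Proof.
have := congr1 (sscale (z ^+ i)) (proj2 f_cfrac).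
rewrite sscaleM sscale_sscale -exprSr => ->; apply: eq_series => n /=.
rewrite mulrDr mulrA -exprMn -exprSr; congr (_ + _).
by case: eqP => [->|]; rewrite ?mulr0 ?expr1 ?mulr1.
Qed.

Let ym : y m = y 0. Proof. by rewrite /y zm expr0. Qed.

Let T0 : T 0 = 1.
Proof.
rewrite /T; elim/big_rec: _ => // i h _ h0.
by rewrite scoefM0 h0 y0 mulr1.
Qed.

Let TS : \prod_(i < m) y i.+1 = T.
Proof.
rewrite /T; case: m m_gt0 ym => // n _ yn.
by rewrite big_ord_recr big_ord_recl /= yn mulrC.
Qed.

(* The rows of the product of the matrices [[1, w i], [1, 0]], i < k. *)
Let row := fix row k (u : series A * series A) : series A * series A :=
  if k is k'.+1 then let v := row k' u in (v.1 + v.2, w k' * v.1) else u.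

Let rowS1 k u : (row k.+1 u).1 = (row k u).1 + (row k u).2. Proof. by []. Qed.
Let rowS2 k u : (row k.+1 u).2 = w k * (row k u).1. Proof. by []. Qed.

(** By [yE], the matrix of index [i] sends the column [(y i.+1, 1)] to [y i.+1] times the column
    [(y i, 1)]. *)
Let row_eigen k u :
  (row k u).1 * y k + (row k u).2 = \prod_(i < k) y i.+1 * (u.1 * y 0 + u.2).
Proof.
elim: k => [|k IH]; first by rewrite big_ord0 mul1r.
rewrite big_ord_recr /= -[RHS]mulrA [y k.+1 * _]mulrC mulrA -IH.
have -> : ((row k u).1 + (row k u).2) * y k.+1 + w k * (row k u).1 =
   (row k u).1 * (y k.+1 + w k) + (row k u).2 * y k.+1 by ring.
by rewrite -yE; ring.
Qed.

Let u1 : series A * series A := (1, 0).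
Let u2 : series A * series A := (0, 1).

Let det_row k : (row k u1).1 * (row k u2).2 - (row k u1).2 * (row k u2).1 =
  \prod_(i < k) (- w i).
Proof.
elim: k => [|k IH]; first by rewrite big_ord0 /=; ring.
by rewrite big_ord_recr -IH /=; ring.
Qed.

Let prod_w k : \prod_(i < k) (- w i) = smon (\prod_(i < k) (- z ^+ i)) k :> series A.
Proof.
elim: k => [|k IH].
  by rewrite !big_ord0; apply: eq_series => n /=; case: eqP.
rewrite !big_ord_recr /= IH; apply: eq_series => n.
rewrite scoef_smonM; case: leqP => [le_kn|lt_nk] /=.
  rewrite -[(n - k)%N == 1%N](eqn_add2r k) subnK // add1n.
  by case: (n == k.+1); rewrite ?oppr0 ?mulr0.
by case: eqP => // nk; rewrite nk ltnNge leqnSn in lt_nk.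
Qed.

(** The entries are continuants: two consecutive steps are needed to raise the degree of the first
    entry by one. *)
Let row1_supp k : (forall n, (k < n.*2)%N -> (row k u1).1 n = 0) /\
                  (forall n, (k.+1 < n.*2)%N -> (row k u1).2 n = 0).
Proof.
elim: k => [|k [IH1 IH2]]; first by split=> // -[].
split=> n lt_kn; first by rewrite rowS1 scoefD IH1 ?IH2 ?addr0 // ltnW.
rewrite rowS2 /w scoef_smonM; case: n lt_kn => // n; rewrite doubleS => lt_kn.
by rewrite /= subn1 IH1 ?mulr0.
Qed.

Let row2_supp k : (forall n, (k < n.*2.+1)%N -> (row k u2).1 n = 0) /\
                  (forall n, (k < n.*2)%N -> (row k u2).2 n = 0).
Proof.
elim: k => [|k [IH1 IH2]]; first by split=> // -[].
split=> n lt_kn; first by rewrite rowS1 scoefD IH1 ?IH2 ?addr0 // ltnW.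
rewrite rowS2 /w scoef_smonM; case: n lt_kn => // n; rewrite doubleS => lt_kn.
by rewrite /= subn1 IH1 ?mulr0.
Qed.

(* By [row_eigen], [T] is an eigenvalue of the product of the matrices over a period. Its *)
(* trace is a series in [x ^ m] with terms of degree at most [m / 2], so it equals 1.     *)
Lemma prod_cfrac : T * T = T + smon 1 m.
Proof.
set tr := (row m u1).1 + (row m u2).2.
(* The characteristic equation of the matrix product, whose determinant is [- x ^ m] by [prod_z]. *)
have E : T * T = tr * T + smon 1 m.
  have := row_eigen m u1; have := row_eigen m u2; have := det_row m.
  rewrite prod_w prod_z TS ym /u1 /u2 /= !mul1r !mul0r add0r addr0 mulr1.
  rewrite -/u1 -/u2 /tr.
  set a := (row m u1).1; set b := (row m u1).2.
  set c := (row m u2).1; set d := (row m u2).2 => dE cE aE.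
  have -> : smon 1 m = b * c - a * d.
    rewrite -[RHS]opprK opprB dE; apply: eq_series => n /=.
    by case: eqP; rewrite ?opprK ?oppr0.
  have cdE : c * y 0 = T - d by rewrite -cE addrK.
  have : (T - d) * (T - a) = b * c.
    have bE : b = T * y 0 - a * y 0 by rewrite -aE; ring.
    by rewrite -cdE bE; ring.
  by move=> H; rewrite -H; ring.
suff tr1 : tr = 1 by rewrite E tr1 mul1r.
(* Replacing [x] by [z * x] permutes the factors of [T] cyclically and fixes [x ^ m]. Cancelling
   [T], of constant term 1, in [E] shows that the trace is fixed as well. *)
have trz : sscale z tr = tr.
  apply/eqP; rewrite -subr_eq0; apply/eqP/(series_cancel T0).
  have zT : sscale z T = T.
    rewrite -[RHS]TS /T; elim/big_rec2: _ => [|i g h _ <-].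
      by apply: eq_series => n /=; case: eqP => [->|]; rewrite ?expr0 ?mul1r ?mulr0.
    by rewrite sscaleM sscale_sscale -exprS.
  have := congr1 (sscale z) E; rewrite sscaleM zT E.
  rewrite sscaleD sscaleM zT sscale_mon zm mul1r.
  by move/addIr => H; rewrite mulrBl -H subrr.
apply: eq_series => -[|n].
  have := congr1 (fun h : series A => h 0) E.
  rewrite scoefD !scoefM0 T0 !mulr1 /= => ->.
  by case: m m_gt0 => // m' _; rewrite addr0.
change (tr n.+1 = 0); case: (ltnP n.+1 m) => [lt_nm|le_mn].
  apply: (z_reg (n := n.+1)) => //.
  by have := congr1 (fun h : series A => h n.+1) trz.
have lt_m : (m < n.+1.*2)%N.
  by rewrite (leq_ltn_trans le_mn) // -addnn -addn1 leq_add2l.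
by rewrite /tr scoefD (proj1 (row1_supp m)) // (proj2 (row2_supp m)) // addr0.
Qed.

End Period.

Lemma cfrac_uniq t f g : is_cfrac t f -> is_cfrac t g -> f = g.
Proof.
move=> /cfrac_rec[f0 fE] /cfrac_rec[g0 gE]; apply: eq_series => n.
have [k] := ubnP n; elim: k n => // k IH [|n] lt_nk; first by rewrite f0 g0.
rewrite fE gE; congr (_ - _); apply: eq_bigr => j _.
have lt_n : (n < k)%N by [].
congr (_ * (_ * _)); apply: IH; last exact: leq_ltn_trans (leq_subr _ _) lt_n.
exact: leq_ltn_trans (ltn_ord j) lt_n.
Qed.

(** Both sides are roots of [Y ^ 2 = Y + x ^ m]. Their difference is killed by their sum minus 1, a
    series with constant term 1. *)
Lemma prod_cfrac_dilate (z : A) m f g : (0 < m)%N -> z ^+ m = 1 ->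
  (forall n (c : A), (0 < n < m)%N -> z ^+ n * c = c -> c = 0) ->
  \prod_(i < m) (- z ^+ i) = -1 ->
  is_cfrac z f -> is_cfrac 1 g -> \prod_(i < m) sscale (z ^+ i) f = dilate m g.
Proof.
move=> m0 zm z_reg prod_z fz [g0 g1].
have E := prod_cfrac m0 zm fz z_reg prod_z.
have gs : sscale 1 g = g by apply: eq_series => n /=; rewrite expr1n mul1r.
rewrite gs in g1.
have := congr1 (dilate m) g1; rewrite dilateM //.
have -> : dilate m (g + smon 1 1) = dilate m g + smon 1 m.
  by rewrite dilateD dilate_smon // muln1.
move: E; set T := \prod_(i < m) _; set G := dilate m g => TE GE.
apply/eqP; rewrite -subr_eq0; apply/eqP.
apply: (@series_cancel _ (T + G - 1)).
  have T0 : T 0 = 1.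
    rewrite /T; elim/big_rec: _ => // i h _ h0.
    by rewrite scoefM0 h0 /= expr0 mul1r mulr1; case: fz.
  by rewrite !scoefD !scoefN T0 /= dvdn0 div0n g0 addrK.
have -> : (T - G) * (T + G - 1) = (T * T - T) - (G * G - G) by ring.
by rewrite TE GE; ring.
Qed.

End ContinuedFraction.

(** * Integrality of the plethystic logarithm *)

Lemma natS_unit (K : numFieldType) n : (n.+1%:R : K) \is a GRing.unit.
Proof. by rewrite unitfE pnatr_eq0. Qed.

Lemma natS_unit_poly n : (n.+1%:R : {poly rat}) \is a GRing.unit.
Proof. by rewrite -(rmorph_nat polyC) rmorph_unit ?natS_unit. Qed.

Lemma cfrac_smap (A B : comNzRingType) (phi : {rmorphism A -> B}) t f :
  is_cfrac t f -> is_cfrac (phi t) (smap phi f).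
Proof.
move=> [f0 fE]; split; first by rewrite /= f0 rmorph1.
have := congr1 (smap phi) fE; rewrite smapM.
have -> : smap phi (sscale t f) = sscale (phi t) (smap phi f).
  by apply: eq_series => n /=; rewrite rmorphM rmorphXn.
move=> ->; apply: eq_series => n; rewrite scoefD /= rmorphD rmorphM rmorphXn.
by congr (_ + _); case: eqP; rewrite ?rmorph1 ?rmorph0.
Qed.

(** The logarithm of the plethystic exponential: a term [t ^ b] of [u] contributes
    [- log (1 - t ^ b * x)]. *)
Definition adams (u : {poly rat}) : series {poly rat} :=
  Series (fun k => (u \Po 'X^k) * k%:R^-1).

(* Plethystic logarithm: the exponential of [rho] is the product over [n > 0] and over *)
(* the terms [c * t ^ b] of [r n] of the powers [(1 - t ^ b * x ^ n) ^- c].            *)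
Lemma plethystic_log (rho : series {poly rat}) :
  exists r : nat -> {poly rat}, forall N, (0 < N)%N ->
    rho N = \sum_(n < N.+1 | (n %| N)%N) (r n \Po 'X^(N %/ n)) * (N %/ n)%:R^-1.
Proof.
have [r rE] := course_of_values (fun s : seq {poly rat} => let N := size s in
  rho N - \sum_(n < N | (n %| N)%N) (s`_n \Po 'X^(N %/ n)) * (N %/ n)%:R^-1).
exists r => N N0; rewrite big_mkcond big_ord_recr /= dvdnn divnn N0 expr1.
rewrite comp_polyXr invr1 mulr1 rE size_map size_iota addrC -big_mkcond /=.
rewrite (eq_bigr (fun n : 'I_N => (r n \Po 'X^(N %/ n)) * (N %/ n)%:R^-1)).
  by rewrite subrK.
by move=> n _; rewrite (nth_map 0%N) ?size_iota ?nth_iota.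
Qed.

Notation pZQ := (map_poly (intr : int -> rat)).

(** The degree [n] is a dummy, giving a constant filtration in the format of [exp_in]. *)
Definition int_poly (n : nat) (u : {poly rat}) : Prop := exists z, u = pZQ z.

Lemma int_poly0 n : int_poly n 0. Proof. by exists 0; rewrite rmorph0. Qed.
Lemma int_poly1 n : int_poly n 1. Proof. by exists 1; rewrite rmorph1. Qed.
Lemma int_polyB n u v : int_poly n u -> int_poly n v -> int_poly n (u - v).
Proof. by move=> [x ->] [y ->]; exists (x - y); rewrite rmorphB. Qed.
Lemma int_polyM m n u v : int_poly m u -> int_poly n v -> int_poly (m + n) (u * v).
Proof. by move=> [x ->] [y ->]; exists (x * y); rewrite rmorphM. Qed.

Lemma scoefMz (A : comNzRingType) (f : series A) (z : int) m : (f *~ z) m = f m *~ z.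
Proof.
have H j : (f *+ j) m = f m *+ j.
  by elim: j => [|j IH]; rewrite ?mulr0n // !mulrS scoefD IH.
by case: z => j; rewrite ?NegzE ?mulrNz ?scoefN -!pmulrn H.
Qed.

(** By linearity this reduces to monomials ['X^b], whose exponential is a geometric series, and to
    integer powers. *)
Lemma exp_in_adams (n : nat) (z : {poly int}) : (0 < n)%N ->
  exp_in int_poly (dilate n (adams (pZQ z))).
Proof.
move=> n0.
have G b : exp_in int_poly (dilate n (adams 'X^b)).
  have H := isexp_dilate n0 (isexp_geometric natS_unit_poly ('X^b)).
  exists (dilate n (Series (fun k => 'X^b ^+ k : {poly rat}))).
    have -> // : adams 'X^b = Series (fun k => 'X^b ^+ k * k%:R^-1).
    apply: eq_series => k /=; congr (_ * _).
    by rewrite comp_Xn_poly -!exprM mulnC.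
  move=> k /=; case: ifP => _; last exact: int_poly0.
  by exists ('X^b ^+ (k %/ n)); rewrite -!exprM map_polyXn.
have -> : dilate n (adams (pZQ z)) =
    \sum_(b < size z) dilate n (adams 'X^b) *~ z`_b.
  apply: eq_series => k; rewrite scoef_sum.
  rewrite (eq_bigr (fun b : 'I_(size z) => dilate n (adams 'X^b) k *~ z`_b)).
    rewrite /=; case: ifP => _; last by rewrite big1 // => b _; rewrite mul0rz.
    rewrite -[X in pZQ X]coefK poly_def rmorph_sum /= linear_sum mulr_suml.
    apply: eq_bigr => b _.
    rewrite map_polyZ map_polyXn linearZ /= scaler_int mulrzAl //.
  by move=> b _; exact: scoefMz.
apply: (exp_in_sum int_poly0 int_polyB int_polyM (int_poly1 0)) => b _.
exact: (exp_inMz natS_unit_poly int_poly0 int_polyB int_polyM (int_poly1 0)).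
Qed.

Section Integrality.
Variables (R : series {poly rat}) (rho : series {poly rat}) (r : nat -> {poly rat}).
Hypothesis R_cfrac : is_cfrac 'X R.
Hypothesis rhoE : isexp rho R.
Hypothesis rE : forall N, (0 < N)%N ->
  rho N = \sum_(n < N.+1 | (n %| N)%N) (r n \Po 'X^(N %/ n)) * (N %/ n)%:R^-1.

(** The product of the plethystic factors of index at most [N] is integral by induction. It agrees
    with [R] up to degree [N], and in degree [N.+1] it differs from the integral series [R] by
    exactly [r N.+1]. *)
Lemma plethystic_log_int N : (0 < N)%N -> int_poly N (r N).
Proof.
have [m] := ubnP N; elim: m N => // m IH [//|N] lt_Nm _.
have Rint : int_poly N.+1 (R N.+1).
  have [f fE] := cfrac_exists ('X : {poly int}); exists (f N.+1).
  have := cfrac_smap pZQ fE; rewrite /= map_polyX => gE.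
  by rewrite (cfrac_uniq R_cfrac gE).
pose a := \sum_(1 <= n < N.+1) dilate n (adams (r n)).
have [E aE Eint] : exp_in int_poly a.
  rewrite /a big_nat_cond.
  apply: (exp_in_sum int_poly0 int_polyB int_polyM (int_poly1 0)) => n.
  rewrite andbT ltnS => /andP[n0 le_nN].
  have [|z ->] := IH n _ n0; last exact: exp_in_adams.
  by rewrite -ltnS (leq_ltn_trans _ lt_Nm).
have aN M : (0 < M)%N -> a M = \sum_(n < M.+1 | (n %| M)%N && (n < N.+1)%N)
     (r n \Po 'X^(M %/ n)) * (M %/ n)%:R^-1.
  by move=> M0; rewrite /a scoef_sum_dilate.
have aNE M : (0 < M <= N)%N -> rho M = a M.
  move=> /andP[M0 le_MN]; rewrite aN // rE //; apply: eq_bigl => n.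
  by rewrite (leq_trans (ltn_ord n)) ?andbT.
have aN1 : rho N.+1 - a N.+1 = r N.+1.
  apply/eqP; rewrite subr_eq addrC; apply/eqP.
  rewrite rE // big_mkcond big_ord_recr /= dvdnn divnn expr1 comp_polyXr invr1 mulr1.
  congr (_ + _); rewrite aN // [RHS]big_mkcond [RHS]big_ord_recr /= ltnn andbF addr0.
  by apply: eq_bigr => n _; rewrite ltn_ord andbT.
suff <- : R N.+1 - E N.+1 = r N.+1 by exact: int_polyB.
apply: (mulrI (natS_unit_poly N)); rewrite -aN1 !mulrBr.
rewrite (isexp_rec N rhoE) (isexp_rec N aE) !big_ord_recr /= subnn.
rewrite (proj1 rhoE) (proj1 aE) !mulr1.
rewrite (eq_bigr (fun j : 'I_N => j.+1%:R * a j.+1 * E (N - j)%N)).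
  by rewrite opprD addrACA subrr add0r.
move=> j _; rewrite aNE ?ltn_ord //; congr (_ * _).
by apply: (isexp_eq_le natS_unit_poly rhoE aE) => i /andP[i0 le_i];
   apply: aNE; rewrite i0 (leq_trans le_i) // leq_subr.
Qed.

End Integrality.

Section RootsOfUnity.
Variables (R : series {poly rat}) (rho : series {poly rat}) (r : nat -> {poly rat}).
Hypothesis R_cfrac : is_cfrac 'X R.
Hypothesis rhoE : isexp rho R.
Hypothesis rE : forall N, (0 < N)%N ->
  rho N = \sum_(n < N.+1 | (n %| N)%N) (r n \Po 'X^(N %/ n)) * (N %/ n)%:R^-1.

Let phi (z : algC) : {rmorphism {poly rat} -> algC} :=
  horner_eval z \o map_poly (ratr : rat -> algC).

Let phiX z : phi z 'X = z.
Proof. by rewrite /= map_polyX /horner_eval hornerX. Qed.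

Let phi_comp z u k : phi z (u \Po 'X^k) = phi (z ^+ k) u.
Proof.
by rewrite /= map_comp_poly map_polyXn /horner_eval horner_comp hornerXn.
Qed.

Let phi_natV z k : phi z (k%:R^-1) = k%:R^-1.
Proof.
case: k => [|k]; first by rewrite !invr0 rmorph0.
by rewrite rmorphV ?natS_unit_poly // rmorph_nat.
Qed.

(** Take logarithms in [prod_cfrac_dilate]: in a degree [N] divisible by [m], each of the [m]
    factors contributes [rho N] evaluated at [z]. *)
Lemma log_root (m N : nat) (z : algC) : m.-primitive_root z -> (0 < N)%N ->
  (m %| N)%N -> m%:R * phi z (rho N) = phi 1 (rho (N %/ m)%N).
Proof.
move=> zm N0 mN; have m0 := prim_order_gt0 zm.
have Rz t : is_cfrac t (smap (phi t) R) by rewrite -{1}(phiX t); exact: cfrac_smap.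
have z_reg n (c : algC) : (0 < n < m)%N -> z ^+ n * c = c -> c = 0.
  move=> /andP[n0 lt_nm] /eqP; rewrite -subr_eq0 -{2}[c]mul1r -mulrBl mulf_eq0.
  rewrite subr_eq0 -(prim_order_dvd zm) => /orP[/(dvdn_leq n0)|/eqP //].
  by rewrite leqNgt lt_nm.
have prod_z : \prod_(i < m) (- z ^+ i) = -1.
  have := congr1 (horner^~ 0) (factor_Xn_sub_1 zm).
  rewrite horner_prod hornerD hornerN hornerXn hornerC expr0n (gtn_eqF m0) sub0r.
  rewrite big_mkord => <-; apply: eq_bigr => i _.
  by rewrite hornerD hornerN hornerX hornerC sub0r.
have := prod_cfrac_dilate m0 (prim_expr_order zm) z_reg prod_z (Rz z) (Rz 1).
have rz t := isexp_smap (phi t) rhoE.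
move=> TE; have := isexp_dilate m0 (rz 1); rewrite -TE => E1.
have E2 := isexp_sum (index_enum 'I_m) (P := xpredT)
  (fun (i : 'I_m) _ => isexp_sscale (z ^+ i) (rz z)).
have := log_uniq (@natS_unit _) E2 E1 N0; rewrite scoef_sum /= mN => <-.
rewrite (eq_bigr (fun=> phi z (rho N))) ?sumr_const ?card_ord ?mulr_natl //.
by move=> i _; rewrite exprAC (eqP (_ : z ^+ N == 1)) ?expr1n ?mul1r // -(prim_order_dvd zm).
Qed.

(** Expand both sides of [log_root]. If [m] does not divide [N %/ n], then [z ^+ (N %/ n)] is a
    nontrivial root of unity of order dividing [n], and for [n < N] its term vanishes by induction.
    If [m] divides [N %/ n], the evaluation is at 1 and the term matches one on the right. Only
    [n = N] is left. *)
Lemma plethystic_log_root (m N : nat) (z : algC) : m.-primitive_root z ->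
  (1 < m)%N -> (0 < N)%N -> (m %| N)%N -> phi z (r N) = 0.
Proof.
have [k] := ubnP N; elim: k N m z => // k IH N m z lt_Nk zm m1 N0 mN.
have m0 : (0 < m)%N by exact: ltnW.
have := log_root zm N0 mN; rewrite !rE ?divn_gt0 // ?(dvdn_leq N0) // !rmorph_sum /=.
rewrite big_mkcond big_ord_recr /= dvdnn divnn N0 -big_mkcond /=.
have termE n t M : phi t ((r n \Po 'X^(M %/ n)) / (M %/ n)%:R) =
    phi (t ^+ (M %/ n)) (r n) / (M %/ n)%:R.
  by rewrite rmorphM phi_comp phi_natV.
have -> : \sum_(n < N | (n %| N)%N) phi z ((r n \Po 'X^(N %/ n)) / (N %/ n)%:R) =
  m%:R^-1 * \sum_(n < (N %/ m).+1 | (n %| N %/ m)%N)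
     phi 1 ((r n \Po 'X^(N %/ m %/ n)) / (N %/ m %/ n)%:R).
  transitivity (\sum_(0 <= n < N | (n %| N)%N && (m %| N %/ n)%N)
     phi 1 (r n) / (N %/ n)%:R).
    rewrite big_mkord [RHS]big_mkcondr; apply: eq_bigr => n nN; rewrite termE.
    have n0 : (0 < n)%N by exact: dvdn_gt0 nN.
    have [mNn|nmNn] := boolP (m %| N %/ n)%N.
      by rewrite (eqP (_ : z ^+ (N %/ n) == 1)) // -(prim_order_dvd zm).
    have g0 : (0 < gcdn (N %/ n) m)%N by rewrite gcdn_gt0 m0 orbT.
    rewrite (IH n (m %/ gcdn (N %/ n) m)%N) ?mul0r //.
    - exact: leq_ltn_trans (ltn_ord n) (lt_Nk : (N <= k)%N).
    - exact: exp_prim_root.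
    - rewrite ltn_neqAle divn_gt0 // dvdn_leq ?dvdn_gcdr // andbT eq_sym.
      apply: contra nmNn => /eqP E.
      by rewrite -[X in (X %| _)%N](divnK (dvdn_gcdr (N %/ n) m)) E mul1n dvdn_gcdl.
    - rewrite -(@Gauss_dvdr _ (N %/ n %/ gcdn (N %/ n) m)).
        rewrite -(@dvdn_pmul2r (gcdn (N %/ n) m)) // divnK ?dvdn_gcdr //.
        by rewrite mulnAC divnK ?dvdn_gcdl // divnK.
      rewrite /coprime -(eqn_pmul2r g0) mul1n muln_gcdl.
      by rewrite !divnK ?dvdn_gcdl ?dvdn_gcdr // gcdnC.
  rewrite -(big_mkord (fun n => (n %| N %/ m)%N)
    (fun n => phi 1 ((r n \Po 'X^(N %/ m %/ n)) / (N %/ m %/ n)%:R))).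
  have lt_NmN : ((N %/ m).+1 <= N)%N by rewrite ltn_Pdiv.
  rewrite (big_nat_widen _ _ _ _ _ lt_NmN) mulr_sumr; apply: congr_big => // n.
    rewrite ltnS; apply/andP/andP => [[nN /dvdnP[c cE]]|[nNm le_n]].
      have -> : (N %/ m = n * c)%N by rewrite -(divnK nN) cE -mulnAC mulnK // mulnC.
      rewrite dvdn_mulr // leq_pmulr //.
      by case: c cE => // /eqP; rewrite -leqn0 leqNgt divn_gt0 ?(dvdn_gt0 N0 nN) // dvdn_leq.
    have n0 : (0 < n)%N by apply: dvdn_gt0 nNm; rewrite divn_gt0 // dvdn_leq.
    case/dvdnP: nNm => c cE; have NE : N = (c * m * n)%N.
      by rewrite -[LHS](divnK mN) cE mulnAC.
    by rewrite NE dvdn_mull // mulnK // dvdn_mull.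
  move=> /andP[nN /dvdnP[c cE]]; rewrite termE expr1n mulrCA -invfM -natrM.
  congr (_ / _%:R); rewrite cE.
  have n0 : (0 < n)%N by exact: dvdn_gt0 nN.
  have -> : (N %/ m = c * n)%N by rewrite -(divnK nN) cE mulnAC mulnK.
  by rewrite mulnK // mulnC.
rewrite mulrDr mulVKf ?pnatr_eq0 ?gtn_eqF // -[RHS]addr0 => /addrI /eqP.
rewrite mulf_eq0 pnatr_eq0 gtn_eqF //= => /eqP.
by rewrite expr1 comp_polyXr invr1 mulr1.
Qed.

End RootsOfUnity.

(** * The generating series of the orders of general linear groups *)

(** Division by a monic polynomial takes place over the integers, and its remainder is the rational
    one. *)
Lemma int_poly_dvdp (n : nat) (u : {poly rat}) (d : {poly int}) :
  int_poly n u -> d \is monic -> pZQ d %| u -> exists v, u = pZQ (v * d).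
Proof.
move=> [z ->] d_mon dz; exists (Pdiv.CommonRing.rdivp z d).
have zE := Pdiv.RingMonic.rdivp_eq d_mon z.
suff mod0 : Pdiv.CommonRing.rmodp z d = 0 by rewrite {1}zE mod0 addr0.
apply: (map_inj_poly (intr_inj : injective (intr : int -> rat))) => //.
rewrite rmorph0; apply/eqP; move: dz; rewrite {1}zE rmorphD rmorphM /= dvdp_addr ?dvdp_mulIr //.
move=> /dvdp_leq; case: eqP => // _ /(_ isT).
rewrite !size_map_inj_poly //; try exact: intr_inj.
by rewrite leqNgt Pdiv.CommonRing.ltn_rmodp monic_neq0.
Qed.

Section Quotient.
Variables (R : series {poly rat}) (rho : series {poly rat}) (r : nat -> {poly rat}).
Hypothesis R_cfrac : is_cfrac 'X R.
Hypothesis rhoE : isexp rho R.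
Hypothesis rE : forall N, (0 < N)%N ->
  rho N = \sum_(n < N.+1 | (n %| N)%N) (r n \Po 'X^(N %/ n)) * (N %/ n)%:R^-1.

Lemma plethystic_log_div (N : nat) : (0 < N)%N ->
  exists v : {poly int}, r N = pZQ (v * \sum_(i < N) 'X^i).
Proof.
move=> N0.
have XE (K : nzRingType) : ('X - 1) * (\sum_(i < N) 'X^i) = 'X^N - 1 :> {poly K}.
  by rewrite subrX1.
apply: (int_poly_dvdp (plethystic_log_int R_cfrac rhoE rE N0)).
  have X1m : ('X - 1 : {poly int}) \is monic by rewrite -polyC1 monicXsubC.
  by have := monicXnsubC (1 : int) N0; rewrite -XE monicMl.
pose g : {rmorphism rat -> algC} := ratr.
rewrite -(dvdp_map g) -map_poly_comp.
rewrite (eq_map_poly (g := intr)) => [|x]; last by rewrite /= rmorph_int.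
have [z zN] := C_prim_root_exists N0.
rewrite rmorph_sum /= (eq_bigr (fun i : 'I_N => 'X^i)) => [|i _]; last by rewrite map_polyXn.
have X1 : 'X - 1 != 0 :> {poly algC} by rewrite -polyC1 polyXsubC_eq0.
(* A factor ['X - 1] completes the divisor to ['X^N - 1], whose roots are the distinct powers of
   [z]. *)
rewrite -(dvdp_mul2l _ _ X1) XE -(factor_Xn_sub_1 zN).
rewrite -(big_map (fun i => z ^+ i) xpredT (fun x => 'X - x%:P)).
apply: uniq_roots_dvdp.
  apply/allP => x /mapP[i]; rewrite mem_index_iota => /andP[_ lt_iN] ->.
  rewrite rootM; case: i lt_iN => [|i] lt_iN.
    by rewrite expr0 root_XsubC eqxx.
  have [g0 gN] : (0 < gcdn i.+1 N)%N /\ (gcdn i.+1 N < N)%N.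
    by rewrite gcdn_gt0 /=; split=> //; apply: leq_ltn_trans lt_iN; rewrite dvdn_leq ?dvdn_gcdl.
  apply/orP; right; apply/rootP.
  apply: (plethystic_log_root R_cfrac rhoE rE (exp_prim_root zN i.+1)) => //.
    by rewrite ltn_divRL ?dvdn_gcdr // mul1n.
  by apply/dvdnP; exists (gcdn i.+1 N); rewrite mulnC divnK ?dvdn_gcdr.
rewrite uniq_rootsE map_inj_in_uniq ?iota_uniq // => i j.
rewrite !mem_index_iota => /= lt_i lt_j /eqP.
by rewrite (eq_prim_root_expr zN) !modn_small // => /eqP.
Qed.

End Quotient.

Definition gl_card (q n : nat) : nat :=
  (q ^ 'C(n, 2) * \prod_(1 <= i < n.+1) (q ^ i - 1))%N.

Lemma expq_sub1_neq0 (q n : nat) : (1 < q)%N -> (0 < n)%N -> (q%:R ^+ n - 1 : rat) != 0.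
Proof.
move=> q1 n0; rewrite -natrX subr_eq0 pnatr_eq1 neq_ltn -(expn0 q).
by rewrite !ltn_exp2l // n0 orbT.
Qed.

Lemma gl_card_gt0 q n : (1 < q)%N -> (0 < gl_card q n)%N.
Proof.
move=> q1; rewrite muln_gt0 expn_gt0 (ltnW q1) /= big_nat.
apply: prodn_cond_gt0 => i /andP[i0 _].
by rewrite subn_gt0 -{1}(expn0 q) ltn_exp2l.
Qed.

Lemma gl_cardS (q n : nat) : (1 < q)%N ->
  (gl_card q n.+1)%:R * (q%:R ^+ n)^-1 = (q%:R ^+ n.+1 - 1) * (gl_card q n)%:R :> rat.
Proof.
move=> q1; rewrite /gl_card big_nat_recr //= binS bin1 expnD.
have q0 : (q%:R : rat) != 0 by rewrite pnatr_eq0 -lt0n ltnW.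
rewrite !natrM natrB ?expn_gt0 ?(ltnW q1) // !natrX.
by field; rewrite expf_neq0.
Qed.

(* With [Om n] and [eta K] as below, the exponential of the twist is the product over [n], *)
(* over the terms [c * t ^ b] of [Om n] and over [j > 0] of the factors                    *)
(* [exp (\sum_K eta K * (q ^- (b + j) * x ^ n) ^ K / K) ^ c].                              *)
Definition twist (Om : nat -> {poly int}) (q : nat) (eta : nat -> rat) : series rat :=
  Series (fun M => \sum_(n < M.+1 | (n %| M)%N)
    (pZQ (Om n)).[q%:R ^- (M %/ n)] * eta (M %/ n)%N /
      ((M %/ n)%:R * (q%:R ^+ (M %/ n) - 1))).

Definition gl_exponents (Om : nat -> {poly int}) : Prop := forall q, (1 < q)%N ->
  isexp (twist Om q (fun=> 1)) (Series (fun n => (gl_card q n)%:R^-1)).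

(** The exponential [f] of the twist satisfies [f (q * x) = R (x) * f (x)]. The equation of the
    continued fraction turns this into [f (q * x) = f (x) + x * f (x / q)], a recursion on
    coefficients that the inverses of the group orders satisfy by [gl_cardS]. *)
Theorem exp_gl_card : exists Om, gl_exponents Om.
Proof.
have [R R_cfrac] := cfrac_exists ('X : {poly rat}).
have [rho rhoE] := log_exists natS_unit_poly (proj1 R_cfrac).
have [r rE] := plethystic_log rho.
have om_ex N : exists v : {poly int}, (0 < N)%N -> r N = pZQ (v * \sum_(i < N) 'X^i).
  case: (posnP N) => [->|N0]; first by exists 0.
  by have [v vE] := plethystic_log_div R_cfrac rhoE rE N0; exists v.
have [om omE] := boolp.choice om_ex.
(* For [N = k * n] and [s = q ^- k], the factor [1 + s + ... + s ^ (n - 1)] of [r n] equals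
   [s ^ (n - 1) * (q ^ N - 1) / (q ^ k - 1)]. This is the origin of the power of ['X] and of the
   denominator in [twist]. *)
exists (fun n => om n * 'X^(n.-1)) => q q1; set t := q%:R^-1 : rat; set a := twist _ _ _.
have aE N : a N = \sum_(n < N.+1 | (n %| N)%N)
    (pZQ (om n * 'X^(n.-1))).[q%:R ^- (N %/ n)] / ((N %/ n)%:R * (q%:R ^+ (N %/ n) - 1)).
  by apply: eq_bigr => n _; rewrite mulr1.
move: a aE => a aE.
have q0 : (q%:R : rat) != 0 by rewrite pnatr_eq0 -lt0n ltnW.
pose phi : {rmorphism {poly rat} -> rat} := horner_eval t.
have phiX : phi 'X = t by rewrite /phi /= /horner_eval hornerX.
have Rt := cfrac_smap phi R_cfrac; rewrite phiX in Rt.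
have rt := isexp_smap phi rhoE.
have rhot N : (0 < N)%N -> phi (rho N) = (q%:R ^+ N - 1) * a N.
  move=> N0; rewrite rE // aE // rmorph_sum mulr_sumr; apply: eq_bigr => n nN.
  have n0 : (0 < n)%N by exact: dvdn_gt0 nN.
  have [k kE] : exists k, (N %/ n = k.+1)%N.
    by exists (N %/ n).-1; rewrite prednK // divn_gt0 // dvdn_leq.
  rewrite kE rmorphM rmorphV ?natS_unit_poly // rmorph_nat.
  have NE : N = (k.+1 * n)%N by rewrite -kE divnK.
  rewrite /phi /= /horner_eval horner_comp hornerXn -exprVn -/t omE // !rmorphM /= !hornerM.
  rewrite [in LHS]rmorph_sum /= horner_sum map_polyXn hornerXn.
  rewrite (eq_bigr (fun i : 'I_n => t ^+ k.+1 ^+ i)) => [|i _]; last by rewrite map_polyXn hornerXn.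
  have Q0 := expq_sub1_neq0 q1 (ltn0Sn k).
  have -> : (q%:R : rat) ^+ N = (q%:R ^+ k.+1) ^+ n by rewrite -exprM -NE.
  have QI : q%:R ^+ k.+1 = (t ^+ k.+1)^-1 by rewrite /t exprVn invrK.
  have T0 : t ^+ k.+1 != 0 by rewrite expf_neq0 // invr_eq0.
  move: Q0; rewrite QI; move: (t ^+ k.+1) T0 => s s0 s1.
  have k0 : (k.+1%:R : rat) != 0 by rewrite pnatr_eq0.
  have E : (s^-1 ^+ n - 1) * s ^+ n.-1 = (s^-1 - 1) * \sum_(i < n) s ^+ i.
    apply: (mulfI s0); rewrite mulrCA -exprS prednK // mulrBl exprVn mulVf ?expf_neq0 //.
    by rewrite mulrA mulrBr divff // mulr1 mul1r -[RHS]opprK -mulNr opprB -subrX1 opprB.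
  have -> : \sum_(i < n) s ^+ i = (s^-1 ^+ n - 1) * s ^+ n.-1 / (s^-1 - 1).
    by rewrite E mulrC mulKf.
  move: (s^-1) s1 E => s' s1 _.
  move: (s' ^+ n) (s ^+ n.-1) (_.[s]) (k.+1%:R) k0 => u v w k' k0.
  by field; rewrite k0 s1.
have [f fE] := exp_exists (@natS_unit _) a.
have fq : sscale q%:R f = smap phi R * f.
  apply: (isexp_uniq (@natS_unit _) (isexp_sscale _ fE)).
  apply: eq_isexp (isexpD rt fE) => N N0.
  by rewrite scoefD /= rhot //; ring.
have fqt : sscale q%:R f = f + smon 1 1 * sscale t f.
  have fs : sscale t (sscale q%:R f) = f.
    rewrite sscale_sscale mulVf //; apply: eq_series => n /=.
    by rewrite expr1n mul1r.
  have := congr1 (fun u => u * sscale t f) (proj2 Rt) => /=.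
  by rewrite mulrDl -mulrA -!sscaleM -fq fs => <-.
suff -> : Series (fun n => (gl_card q n)%:R^-1) = f by [].
apply: eq_series; elim=> [|n IH] /=.
  by rewrite /gl_card big_geq // muln1 invr1; case: fE.
have := congr1 (fun u : series rat => u n.+1) fqt.
rewrite scoefD scoef_smonM /= subn1 mul1r => /eqP; rewrite addrC -subr_eq => /eqP.
have Q0 := expq_sub1_neq0 q1 (ltn0Sn n); rewrite -IH /= => E.
apply: (mulfI Q0); rewrite [RHS]mulrBl mul1r E.
have g0 m : ((gl_card q m)%:R : rat) != 0 by rewrite pnatr_eq0 -lt0n gl_card_gt0.
apply: (mulIf (g0 n.+1)); apply: (mulIf (g0 n)); rewrite mulfVK // -gl_cardS //.
rewrite exprVn; move: (g0 n) (expf_neq0 n q0) => gn0 qn0.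
move: (_%:R) gn0 (_ ^+ n) qn0 (_%:R) => u u0 v v0 w.
by field; rewrite u0 v0.
Qed.

(** * Commuting families of matrices killed by polynomials *)

Section HornerMx.
Variable F : fieldType.

(* [horner_mx] is only defined in positive dimension. *)
Definition hmx n : 'M[F]_n -> {poly F} -> 'M[F]_n :=
  if n is n'.+1 then fun A p => horner_mx A p else fun _ _ => 0.

Lemma kermx_hmx n (A : 'M[F]_n) p : kermx (hmx A p) = kermxpoly A p.
Proof. by case: n A. Qed.

Lemma hmxM n (A : 'M[F]_n) p r : hmx A (p * r) = hmx A p *m hmx A r.
Proof. by case: n A => [|n] A; rewrite /= ?mul0mx // rmorphM. Qed.
Lemma hmxD n (A : 'M[F]_n) p r : hmx A (p + r) = hmx A p + hmx A r.
Proof. by case: n A => [|n] A; rewrite /= ?addr0 // rmorphD. Qed.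
Lemma hmxB n (A : 'M[F]_n) p r : hmx A (p - r) = hmx A p - hmx A r.
Proof. by case: n A => [|n] A; rewrite /= ?subr0 // rmorphB. Qed.
Lemma hmxC n (A : 'M[F]_n) c : hmx A c%:P = c%:M.
Proof. by case: n A => [|n] A; rewrite /= ?horner_mx_C // [RHS]flatmx0. Qed.
Lemma hmx0 n (A : 'M[F]_n) : hmx A 0 = 0.
Proof. by case: n A => [|n] A; rewrite /= ?rmorph0. Qed.
Lemma hmx1 n (A : 'M[F]_n) : hmx A 1 = 1%:M.
Proof. by rewrite -polyC1 hmxC. Qed.
Lemma hmxX n (A : 'M[F]_n) : hmx A 'X = A.
Proof. by case: n A => [|n] A; rewrite /= ?horner_mx_X // [RHS]flatmx0. Qed.
Lemma hmxXn n (A : 'M[F]_n) k : hmx A 'X^k = A ^+ k.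
Proof.
elim: k => [|k IH]; first by rewrite !expr0 hmx1.
by rewrite !exprS hmxM IH hmxX.
Qed.

Lemma hmx_intertwine m n (P : 'M[F]_(m, n)) (A : 'M[F]_n) (B : 'M[F]_m) p :
  P *m A = B *m P -> P *m hmx A p = hmx B p *m P.
Proof.
move=> PA; elim/poly_ind: p => [|p c IH]; first by rewrite !hmx0 mulmx0 mul0mx.
rewrite !hmxD !hmxM !hmxX !hmxC mulmxDr mulmxDl mulmxA IH -!mulmxA PA.
by rewrite scalar_mxC.
Qed.

Lemma hmx_block m k (B : 'M[F]_m) (C : 'M[F]_k) p :
  hmx (block_mx B 0 0 C) p = block_mx (hmx B p) 0 0 (hmx C p).
Proof.
elim/poly_ind: p => [|p c IH]; first by rewrite !hmx0 block_mx0.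
rewrite !hmxD !hmxM !hmxX !hmxC IH mulmx_block.
by rewrite !mulmx0 !mul0mx !addr0 !add0r scalar_mx_block add_block_mx !addr0.
Qed.

Lemma lin_mx_exists (a b : nat) (g : 'rV[F]_a -> 'rV[F]_b) :
  (forall u v, g (u + v) = g u + g v) -> (forall c u, g (c *: u) = c *: g u) ->
  exists M : 'M[F]_(a, b), forall u, u *m M = g u.
Proof.
move=> gD gZ; exists (\matrix_i g (delta_mx 0 i)) => u.
have g0 : g 0 = 0 by rewrite -(scale0r 0) gZ scale0r.
rewrite mulmx_sum_row [in RHS](row_sum_delta u).
elim/big_rec2: _ => [|i w v _ ->]; first by rewrite g0.
by rewrite gD gZ rowK.
Qed.

Lemma rank_row_basis m n (V : 'M[F]_n) : \rank V = m ->
  exists2 U : 'M[F]_(m, n), (U :=: V)%MS & row_free U.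
Proof. by move=> <-; exists (row_base V); rewrite ?row_base_free //; exact: eq_row_base. Qed.

End HornerMx.

Section HomSets.
Variables (F : finFieldType) (I : finType).
Implicit Types Q : I -> {poly F}.

Notation fam n := {ffun I -> 'M[F]_n}.

Definition hs n Q : {set fam n} :=
  [set A : fam n | [forall i, hmx (A i) (Q i) == 0]
    && [forall i, forall j, A i *m A j == A j *m A i]].

Lemma hsP n Q (A : fam n) : reflect ((forall i, hmx (A i) (Q i) = 0) /\
   forall i j, A i *m A j = A j *m A i) (A \in hs n Q).
Proof.
rewrite inE; apply: (iffP andP) => [[/forallP h /forallP c]|[h c]]; split.
- by move=> i; exact/eqP.
- by move=> i j; apply/eqP; move/forallP: (c i); apply.
- by apply/forallP => i; apply/eqP.
- by apply/forallP => i; apply/forallP => j; apply/eqP.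
Qed.

Definition gls n : {set 'M[F]_n} := [set P | P \in unitmx].

Definition cj n (P : 'M[F]_n) (A : fam n) : fam n :=
  [ffun i => P *m A i *m invmx P].

Lemma cjP n (P : 'M[F]_n) A B : P \in unitmx ->
  cj P A = B <-> forall i, P *m A i = B i *m P.
Proof.
move=> Pu; split=> [<- i|PA]; first by rewrite ffunE mulmxKV.
by apply/ffunP => i; rewrite ffunE PA mulmxK.
Qed.

Lemma cjM n (P R : 'M[F]_n) A : P \in unitmx -> R \in unitmx ->
  cj (P *m R) A = cj P (cj R A).
Proof.
move=> Pu Ru; apply/cjP => [|i]; first by rewrite unitmx_mul Pu.
by rewrite !ffunE !mulmxA mulmxKV // mulmxKV.
Qed.

Lemma cj1 n (A : fam n) : cj 1%:M A = A.
Proof. by apply/ffunP => i; rewrite ffunE invmx1 mul1mx mulmx1. Qed.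

Lemma hmx_conj n (P : 'M[F]_n) (A : 'M[F]_n) p : P \in unitmx ->
  hmx (P *m A *m invmx P) p = P *m hmx A p *m invmx P.
Proof.
move=> Pu; have := @hmx_intertwine _ _ _ P A (P *m A *m invmx P) p.
by rewrite mulmxKV // => -> //; rewrite mulmxK.
Qed.

Lemma hs_cj n Q (P : 'M[F]_n) A : P \in unitmx -> A \in hs n Q -> cj P A \in hs n Q.
Proof.
move=> Pu /hsP[h c]; apply/hsP; split=> [i|i j]; rewrite !ffunE.
  by rewrite hmx_conj // h mulmx0 mul0mx.
by rewrite !mulmxA !mulmxKV // -!(mulmxA P) c.
Qed.

(** Count the pairs [(P, A)] with [cj P A] in [Y]: for fixed [A] the matrices [P] form a coset of
    [K], for fixed [P] the families [A] are a conjugate of [Y]. *)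
Lemma double_count n (X Y : {set fam n}) (K : {set 'M[F]_n}) :
  Y \subset X -> K \subset gls n ->
  (forall P A, P \in gls n -> A \in X -> cj P A \in X) ->
  (forall A, A \in X -> exists2 P, P \in gls n & cj P A \in Y) ->
  (forall P A, P \in gls n -> A \in Y -> (cj P A \in Y) = (P \in K)) ->
  (#|X| * #|K| = #|gls n| * #|Y|)%N.
Proof.
move=> YX KG Xcj Xex YK.
have invG P : P \in gls n -> invmx P \in gls n by rewrite !inE unitmx_inv.
have inP P : (P \in gls n) = (P \in unitmx) by rewrite inE.
have KC P : P \in K -> P \in unitmx by move=> /(subsetP KG); rewrite inE.
have cjK P A : P \in gls n -> cj (invmx P) (cj P A) = A.
  by move=> PG; rewrite -cjM -?inP ?invG // mulVmx -?inP // cj1.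
have cjVK P A : P \in gls n -> cj P (cj (invmx P) A) = A.
  by move=> PG; rewrite -cjM -?inP ?invG // mulmxV -?inP // cj1.
transitivity (\sum_(A in X) #|[set P in gls n | cj P A \in Y]|)%N.
  rewrite -sum_nat_const; apply: eq_bigr => A AX.
  have [P0 P0G P0A] := Xex A AX; have P0u := P0G; rewrite inP in P0u.
  rewrite -[LHS](card_imset _ (can_inj (mulmxK P0u))); apply: eq_card => P.
  rewrite inE; apply/imsetP/andP=> [[k kK ->]|[PG PY]].
    have ku := KC k kK; rewrite inP unitmx_mul ku P0u cjM //.
    by rewrite (YK k) // inP.
  have PU := PG; rewrite inP in PU.
  exists (P *m invmx P0); last by rewrite mulmxKV.
  have RG : P *m invmx P0 \in gls n by rewrite inP unitmx_mul PU unitmx_inv.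
  rewrite -(YK _ _ RG P0A).
  by rewrite cjM ?unitmx_inv // cjK.
transitivity (\sum_(P in gls n) #|[set A in X | cj P A \in Y]|)%N.
  have E (T1 T2 : finType) (D1 : {set T1}) (D2 : {set T2}) (r : T1 -> T2 -> bool) :
     (\sum_(a in D1) #|[set b in D2 | r a b]| =
      \sum_(b in D2) #|[set a in D1 | r a b]|)%N.
    transitivity (\sum_(a in D1) \sum_(b in D2) r a b)%N.
      apply: eq_bigr => x _; rewrite -sum1_card big_mkcond [RHS]big_mkcond /=.
      by apply: eq_bigr => y _; rewrite inE; case: (y \in D2); case: (r x y).
    rewrite exchange_big; apply: eq_bigr => y _; rewrite -sum1_card big_mkcond [RHS]big_mkcond /=.
    by apply: eq_bigr => x _; rewrite inE; case: (x \in D1); case: (r x y).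
  exact: E.
rewrite -sum_nat_const; apply: eq_bigr => P PG.
have cj_inj : injective (cj (invmx P)) by apply: can_inj (cj P) _ => A; exact: cjVK.
rewrite -[RHS](card_imset _ cj_inj); apply: eq_card => A; rewrite inE.
apply/andP/imsetP=> [[AX PA]|[B BY ->]]; first by exists (cj P A); rewrite ?cjK.
by rewrite cjVK // BY Xcj ?invG // (subsetP YX).
Qed.

End HomSets.

Section Coprime.
Variables (F : finFieldType) (I : finType) (i0 : I) (Q : I -> {poly F}).
Variables (f g : {poly F}).
Hypothesis fg : coprimep f g.

Notation fam n := {ffun I -> 'M[F]_n}.
Definition upd (h : {poly F}) (i : I) := if i == i0 then h else Q i.

Lemma upd_id h : upd h i0 = h. Proof. by rewrite /upd eqxx. Qed.

(** By a Bezout relation, there is no nonzero intertwiner between modules killed by coprime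
    polynomials. *)
Lemma hmx_coprime0 m k (B : 'M[F]_m) (C : 'M[F]_k) (P : 'M[F]_(m, k)) (u v : {poly F}) :
  coprimep u v -> hmx B u = 0 -> hmx C v = 0 -> P *m C = B *m P -> P = 0.
Proof.
move=> /Bezout_eq1_coprimepP[[a b] /= uv] Bu Cv PC.
have := congr1 (fun p => P *m hmx C p) uv; rewrite hmxD !hmxM Cv mulmx0 addr0 hmx1 mulmx1 => <-.
by rewrite mulmxA (hmx_intertwine a PC) -mulmxA (hmx_intertwine u PC) Bu mul0mx mulmx0.
Qed.

Lemma rank_coprime n (A : 'M[F]_n) : hmx A (f * g) = 0 ->
  (\rank (kermx (hmx A f)) + \rank (kermx (hmx A g)) = n)%N /\
  (kermx (hmx A f) + kermx (hmx A g) :=: 1%:M)%MS.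
Proof.
move=> Afg; have E : (kermx (hmx A f) + kermx (hmx A g) :=: 1%:M)%MS.
  rewrite !kermx_hmx; apply: eqmx_trans (eqmx_sym (kermxpolyM A fg)) _.
  by rewrite -kermx_hmx Afg; apply/eqmxP; rewrite submx1 kermx0 submx_refl.
split=> //; rewrite -mxrank_sum_cap E mxrank1 !kermx_hmx mxdirect_kermxpoly //.
by rewrite mxrank0 addn0.
Qed.

Definition bd m k (B : fam m) (C : fam k) : fam (m + k) :=
  [ffun i => block_mx (B i) 0 0 (C i)].

Lemma bd_hs m k (B : fam m) (C : fam k) :
  B \in hs m (upd f) -> C \in hs k (upd g) -> bd B C \in hs (m + k) (upd (f * g)).
Proof.
move=> /hsP[Bh Bc] /hsP[Ch Cc]; apply/hsP; split=> [i|i j]; rewrite !ffunE.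
  rewrite hmx_block; have := Bh i; have := Ch i; rewrite /upd.
  case: eqP => [_|_] Ci Bi; last by rewrite Ci Bi block_mx0.
  by rewrite !hmxM Ci mulmx0 Bi mul0mx block_mx0.
by rewrite !mulmx_block !mulmx0 !mul0mx !addr0 !add0r Bc Cc.
Qed.

Lemma bd_inj m k (B B' : fam m) (C C' : fam k) : bd B C = bd B' C' -> B = B' /\ C = C'.
Proof.
move=> E; have Ei i : B i = B' i /\ C i = C' i.
  by have := congr1 (fun A : fam (m + k) => A i) E; rewrite !ffunE => /eq_block_mx[-> _ _ ->].
by split; apply/ffunP => i; case: (Ei i).
Qed.

Lemma block_diag_unit m k (P1 : 'M[F]_m) (P2 : 'M[F]_k) :
  (block_mx P1 0 0 P2 \in unitmx) = (P1 \in unitmx) && (P2 \in unitmx).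
Proof. by rewrite !unitmxE det_ublock unitrM. Qed.

Definition hs_rank n m : {set fam n} :=
  [set A in hs n (upd (f * g)) | \rank (kermx (hmx (A i0) f)) == m].

Lemma rank_bd m k (B : fam m) (C : fam k) :
  B \in hs m (upd f) -> C \in hs k (upd g) ->
  \rank (kermx (hmx (bd B C i0) f)) = m.
Proof.
move=> /hsP[/(_ i0) Bf _] /hsP[/(_ i0) Cg _]; rewrite !upd_id in Bf Cg.
rewrite ffunE hmx_block Bf mxrank_ker.
have -> : block_mx (0 : 'M_m) 0 0 (hmx (C i0) f) = col_mx 0 (row_mx 0 (hmx (C i0) f)).
  by rewrite block_mxEv row_mx0.
rewrite rank_col_0mx rank_row_0mx.
have -> : \rank (hmx (C i0) f) = k; last by rewrite addnK.
apply/eqP; rewrite -[_ == _]/(row_free _) -kermx_eq0; apply/eqP.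
have [// rk _] : (\rank (kermx (hmx (C i0) f)) + \rank (kermx (hmx (C i0) g)) = k)%N /\
  (kermx (hmx (C i0) f) + kermx (hmx (C i0) g) :=: 1%:M)%MS.
  by apply: rank_coprime; rewrite mulrC hmxM Cg mul0mx.
apply/eqP; rewrite -mxrank_eq0; move/eqP: rk.
by rewrite Cg kermx0 mxrank1 -[X in _ == X]add0n eqn_add2r.
Qed.

(** The space is the sum of the kernels of [f] and [g] at [A i0], and all [A i] preserve both by
    commutation. Up to conjugation the family is block diagonal, and by [hmx_coprime0] only block
    diagonal matrices carry one such family to another. *)
Lemma card_hs_rank m k :
  (#|hs_rank (m + k) m| * (#|gls F m| * #|gls F k|) =
   #|gls F (m + k)| * (#|hs m (upd f)| * #|hs k (upd g)|))%N.
Proof.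
pose Y : {set fam (m + k)} :=
  [set bd BC.1 BC.2 | BC in setX (hs m (upd f)) (hs k (upd g))].
pose K : {set 'M[F]_(m + k)} :=
  [set block_mx P.1 0 0 P.2 | P in setX (gls F m) (gls F k)].
have -> : (#|hs m (upd f)| * #|hs k (upd g)| = #|Y|)%N.
  rewrite -cardsX card_imset // => -[B C] [B' C'] /= /bd_inj[-> ->] //.
have -> : (#|gls F m| * #|gls F k| = #|K|)%N.
  by rewrite -cardsX card_imset // => -[B C] [B' C'] /= /eq_block_mx[-> _ _ ->].
apply: double_count.
- apply/subsetP => A /imsetP[[B C]]; rewrite inE /= => /andP[Bh Ch] ->.
  by rewrite inE bd_hs //= rank_bd.
- apply/subsetP => P /imsetP[[P1 P2]]; rewrite !inE /= => /andP[u1 u2] ->.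
  by rewrite block_diag_unit u1.
- move=> P A; rewrite inE => Pu; rewrite inE => /andP[Ah rA]; rewrite inE.
  rewrite (hs_cj Pu Ah) /=.
  rewrite ffunE hmx_conj //; suff -> : \rank (kermx (P *m hmx (A i0) f *m invmx P)) =
    \rank (kermx (hmx (A i0) f)) by [].
  rewrite !mxrank_ker.
  by rewrite mxrankMfree ?row_free_unit ?unitmx_inv // eqmxMfull ?row_full_unit.
- move=> A; rewrite inE => /andP[Ah /eqP rA].
  have [Ah1 Ac] := hsP _ _ Ah.
  have Afg : hmx (A i0) (f * g) = 0 by have := Ah1 i0; rewrite upd_id.
  have [rfg sumfg] := rank_coprime Afg.
  have rg : \rank (kermx (hmx (A i0) g)) = k.
    by move/eqP: rfg; rewrite rA eqn_add2l => /eqP.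
  have [U UE Ufree] := rank_row_basis rA.
  have [W WE Wfree] := rank_row_basis rg.
  have Uf : U *m hmx (A i0) f = 0 by apply/sub_kermxP; rewrite UE.
  have Wg : W *m hmx (A i0) g = 0 by apply/sub_kermxP; rewrite WE.
  have stab l (V : 'M_(l, m + k)) p : (V :=: kermx (hmx (A i0) p))%MS ->
      exists B : fam l, forall i, V *m A i = B i *m V.
    move=> VE; exists [ffun i => V *m A i *m pinvmx V] => i; rewrite ffunE mulmxKpV //.
    rewrite VE sub_kermx -mulmxA (hmx_intertwine p (Ac i i0)) mulmxA.
    suff -> : V *m hmx (A i0) p = 0 by rewrite mul0mx.
    by apply/sub_kermxP; rewrite VE.
  have [B BE] := stab _ _ _ UE; have [C CE] := stab _ _ _ WE.
  pose P := col_mx U W.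
  have Pu : P \in unitmx.
    by rewrite -row_full_unit -sub1mx -addsmxE (adds_eqmx UE WE) sumfg.
  have PA i : P *m A i = bd B C i *m P.
    by rewrite ffunE mul_col_mx mul_block_col BE CE !mul0mx addr0 add0r.
  have cjA : cj P A = bd B C by apply/cjP.
  exists P; first by rewrite inE.
  have bdh : bd B C \in hs (m + k) (upd (f * g)) by rewrite -cjA hs_cj.
  rewrite cjA; apply/imsetP; exists (B, C) => //; rewrite inE /=.
  have [bh bc] := hsP _ _ bdh.
  have comm i j : B i *m B j = B j *m B i /\ C i *m C j = C j *m C i.
    have := bc i j; rewrite !ffunE !mulmx_block !mulmx0 !mul0mx !addr0 !add0r.
    by case/eq_block_mx.
  apply/andP; split; apply/hsP; split=> [i|i j]; try by case: (comm i j).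
    rewrite /upd; case: eqP => [->|ne].
      apply: (row_free_inj Ufree).
      by rewrite mul0mx -(hmx_intertwine f (BE i0)).
    have := bh i; rewrite ffunE hmx_block /upd; move/eqP: ne => /negbTE->.
    by move=> E; have /eq_block_mx[] := etrans E (esym (block_mx0 _ _ _ _ _)).
  rewrite /upd; case: eqP => [->|ne].
    apply: (row_free_inj Wfree).
    by rewrite mul0mx -(hmx_intertwine g (CE i0)).
  have := bh i; rewrite ffunE hmx_block /upd; move/eqP: ne => /negbTE->.
  by move=> E; have /eq_block_mx[] := etrans E (esym (block_mx0 _ _ _ _ _)).
move=> P A; rewrite inE => Pu /imsetP[[B C]]; rewrite inE /= => /andP[Bh Ch] AE.
apply/imsetP/imsetP=> [[[B' C']]|[[P1 P2]]]; rewrite in_setX /=; last rewrite !inE.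
  move=> /andP[Bh' Ch'] /(cjP _ _ Pu) PA.
  have E := PA i0; rewrite AE !ffunE -[P]submxK !mulmx_block in E.
  rewrite !mulmx0 !mul0mx !addr0 !add0r in E; case/eq_block_mx: E => _ E12 E21 _.
  have [/hsP[/(_ i0) Bf _] /hsP[/(_ i0) Cg _]] := (Bh, Ch).
  have [/hsP[/(_ i0) Bf' _] /hsP[/(_ i0) Cg' _]] := (Bh', Ch').
  rewrite !upd_id in Bf Cg Bf' Cg'.
  have P12 := hmx_coprime0 fg Bf' Cg E12.
  have P21 : dlsubmx P = 0 by apply: (hmx_coprime0 _ Cg' Bf E21); rewrite coprimep_sym.
  have PE : P = block_mx (ulsubmx P) 0 0 (drsubmx P) by rewrite -[LHS]submxK P12 P21.
  exists (ulsubmx P, drsubmx P); last exact: PE.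
  by rewrite in_setX !inE /= -block_diag_unit -PE.
move=> /andP[P1u P2u] PE; exists (cj P1 B, cj P2 C) => /=.
  by rewrite in_setX /= !hs_cj.
apply/cjP => // i; rewrite AE PE !ffunE !mulmx_block !mulmx0 !mul0mx !addr0 !add0r.
by rewrite !mulmxKV.
Qed.

End Coprime.

Definition nu (F : finFieldType) (I : finType) (Q : I -> {poly F}) : series rat :=
  Series (fun n => #|hs n Q|%:R / #|gls F n|%:R).

Lemma gls_gt0 (F : finFieldType) n : (0 < #|gls F n|)%N.
Proof. by apply/card_gt0P; exists 1%:M; rewrite inE unitmx1. Qed.

Lemma card_gls (F : finFieldType) n : #|gls F n| = gl_card #|F| n.
Proof.
case: n => [|n].
  rewrite /gl_card big_geq // muln1 expn0 -(card1 (1%:M : 'M[F]_0)).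
  by apply: eq_card => A; rewrite inE [A]thinmx0 unitmxE det_mx00 unitr1 inE [1%:M]thinmx0 eqxx.
rewrite /gl_card -card_GL // cardsT /= card_sub; apply: eq_card => A.
by rewrite !inE.
Qed.

(** Division by the order of the linear group turns the sum over the dimension [m] of the first
    kernel into a convolution. *)
Lemma nu_coprime (F : finFieldType) (I : finType) (i0 : I) (Q : I -> {poly F})
    (f g : {poly F}) : coprimep f g ->
  nu (upd i0 Q (f * g)) = nu (upd i0 Q f) * nu (upd i0 Q g).
Proof.
move=> fg; apply: eq_series => n; rewrite scoefM /=.
have rk (A : {ffun I -> 'M[F]_n}) : (\rank (kermx (hmx (A i0) f)) < n.+1)%N.
  by rewrite ltnS rank_leq_col.
have -> : #|hs n (upd i0 Q (f * g))| = (\sum_(m < n.+1) #|hs_rank i0 Q f g n m|)%N.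
  rewrite -sum1_card (partition_big (fun A => Ordinal (rk A)) xpredT) //=.
  apply: eq_bigr => m _; rewrite -sum1_card; apply: eq_bigl => A.
  by rewrite [in RHS]inE -val_eqE.
rewrite natr_sum mulr_suml; apply: eq_bigr => m _.
have nE : n = (m + (n - m))%N by rewrite subnKC // -ltnS.
have E := card_hs_rank i0 Q fg m (n - m).
rewrite -nE in E.
have g0 k : (#|gls F k|%:R : rat) != 0 by rewrite pnatr_eq0 -lt0n gls_gt0.
apply: (mulIf (g0 n)); rewrite divfK //.
apply: (mulIf (mulf_neq0 (g0 m) (g0 (n - m)%N))).
rewrite -!natrM E !natrM; move: (g0 m) (g0 (n - m)%N).
move: (_%:R) (_%:R) (_%:R) (_%:R) (_%:R) => a b c e h a0 b0.
by field; rewrite ?a0 ?b0.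
Qed.

(** * Matrices over the residue field of an irreducible polynomial *)

(* [pr] is the reduction map onto the residue field of [phi], with section [sec]. *)
Section Residue.
Variables (F L : finFieldType) (phi : {poly F}) (pr : {rmorphism {poly F} -> L}).
Variable sec : L -> {poly F}.
Hypothesis secK : forall l, pr (sec l) = l.
Hypothesis pr_ker : forall p, pr p = 0 -> phi %| p.
Hypothesis pr_phi : pr phi = 0.
Let e := (size phi).-1.
Hypothesis phi_monic : phi \is monic.
Hypothesis cardL : #|L| = (#|F| ^ e)%N.

Lemma hmx_pr n (A : 'M[F]_n) p p' : hmx A phi = 0 -> pr p = pr p' -> hmx A p = hmx A p'.
Proof.
move=> A0 pp; apply/eqP; rewrite -subr_eq0 -hmxB.
have /dvdpP[c ->] : phi %| p - p' by apply: pr_ker; rewrite rmorphB pp subrr.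
by rewrite hmxM A0 mulmx0.
Qed.

(* Linearity over [L], where the class of [p] acts on ['rV[F]_n] by [hmx A p]. *)
Definition llinear m n (A : 'M[F]_n) (tau : 'rV[L]_m -> 'rV[F]_n) : Prop :=
  (forall u v, tau (u + v) = tau u + tau v) /\
  (forall p u, tau (pr p *: u) = tau u *m hmx A p).

(** The new coordinate is placed along [v0]. A vector of the kernel with nonzero new coordinate
    would, after division by it, exhibit [v0] in the image of [tau]. *)
Lemma llinear_extend m n (A : 'M[F]_n) (tau : 'rV[L]_m -> 'rV[F]_n) (v0 : 'rV[F]_n) :
  hmx A phi = 0 -> llinear A tau -> injective tau -> (forall u, tau u != v0) ->
  exists2 tau' : 'rV[L]_(1 + m) -> 'rV[F]_n, llinear A tau' & injective tau'.
Proof.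
move=> A0 [tD tZ] tinj v0P.
pose tau' (w : 'rV[L]_(1 + m)) := v0 *m hmx A (sec (lsubmx w 0 0)) + tau (rsubmx w).
have t0 : tau 0 = 0 by apply: (@addrI _ (tau 0)); rewrite -tD !addr0.
have tN u : tau (- u) = - tau u by apply: (@addrI _ (tau u)); rewrite -tD !subrr t0.
have hpr p l : pr p = l -> hmx A (sec l) = hmx A p.
  by move=> pl; apply: hmx_pr; rewrite ?secK.
have tD' u v : tau' (u + v) = tau' u + tau' v.
  rewrite /tau' !linearD mxE tD (@hpr (sec (lsubmx u 0 0) + sec (lsubmx v 0 0))).
    by rewrite hmxD mulmxDr addrACA.
  by rewrite rmorphD !secK.
have tZ' p u : tau' (pr p *: u) = tau' u *m hmx A p.
  rewrite /tau' !linearZ mxE tZ (@hpr (sec (lsubmx u 0 0) * p)).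
    by rewrite hmxM mulmxDl mulmxA.
  by rewrite rmorphM secK mulrC.
exists tau' => // u v uv; apply/eqP; rewrite -subr_eq0; apply/eqP.
have : tau' (u - v) = 0.
  have tN' w : tau' (- w) = - tau' w.
    apply: (@addrI _ (tau' w)); rewrite -tD' !subrr /tau' !linear0 t0 mxE addr0.
    by rewrite (@hpr 0) ?rmorph0 // hmx0 mulmx0.
  by rewrite tD' tN' uv subrr.
move: (u - v) => w w0.
have [l0|l0] := eqVneq (lsubmx w 0 0) 0.
  have := w0; rewrite /tau' l0 (@hpr 0) ?rmorph0 // hmx0 mulmx0 add0r -t0 => /tinj r0.
  rewrite -[w]hsubmxK r0; apply/rowP => i; rewrite mxE; case: splitP => j _; last by rewrite !mxE.
  by rewrite ord1 l0 mxE.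
case/eqP: (v0P (- ((lsubmx w 0 0)^-1 *: rsubmx w))).
have := congr1 (fun x => x *m hmx A (sec (lsubmx w 0 0)^-1)) w0.
rewrite mul0mx /tau' mulmxDl -mulmxA -hmxM.
rewrite (@hmx_pr _ _ _ 1) ?hmx1 ?mulmx1 //; last first.
  by rewrite rmorphM !secK mulfV // rmorph1.
move/eqP; rewrite addr_eq0 => /eqP->.
by rewrite -tZ secK tN.
Qed.

(** A basis over [L] grown one vector at a time; finiteness of ['rV[F]_n] stops the process. *)
Lemma llinear_basis n (A : 'M[F]_n) : hmx A phi = 0 ->
  exists m (tau : 'rV[L]_m -> 'rV[F]_n),
    [/\ llinear A tau, injective tau & forall w, exists u, tau u = w].
Proof.
move=> A0; set B := #|{: 'rV[F]_n}|.
have lt_mB m (tau : 'rV[L]_m -> 'rV[F]_n) : injective tau -> (m < B)%N.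
  move=> tinj; have := leq_card tau tinj; rewrite -/B card_mx mul1n.
  by apply: leq_trans; apply: ltn_expl; exact: finNzRing_gt1.
suff H k m (tau : 'rV[L]_m -> 'rV[F]_n) : (B <= m + k)%N -> llinear A tau ->
    injective tau -> exists m' (tau' : 'rV[L]_m' -> 'rV[F]_n),
    [/\ llinear A tau', injective tau' & forall w, exists u, tau' u = w].
  apply: (H B 0 (fun=> 0)); rewrite ?add0n //.
    by split=> *; rewrite ?addr0 ?mul0mx.
  by move=> u v _; rewrite [u]thinmx0 [v]thinmx0.
elim: k m tau => [|k IH] m tau.
  by rewrite addn0 leqNgt => ltBm _ /lt_mB; rewrite (negbTE ltBm).
move=> Bmk tl tinj.
have [/forallP surj|] := boolP [forall w, [exists u, tau u == w]].
  exists m, tau; split=> // w; have /existsP[u /eqP uw] := surj w; by exists u.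
rewrite negb_forall => /existsP[v0]; rewrite negb_exists => /forallP v0P.
have [tau' tl' tinj'] := llinear_extend A0 tl tinj v0P.
by apply: (IH _ tau') => //; rewrite add1n addSn -addnS.
Qed.

Lemma llinear_dim m n (tau : 'rV[L]_m -> 'rV[F]_n) :
  injective tau -> (forall w, exists u, tau u = w) -> n = (e * m)%N.
Proof.
move=> tinj tsurj; apply/eqP.
rewrite -(@eqn_exp2l #|F|) ?finNzRing_gt1 // expnM -cardL.
have := card_mx L 1 m; have := card_mx F 1 n; rewrite !mul1n => <- <-.
rewrite -(card_codom tinj) eq_sym; apply/eqP/eq_card => w.
by have [u <-] := tsurj w; rewrite codom_f inE.
Qed.

Lemma root_mx_exists m : exists A : 'M[F]_(m * e), hmx A phi = 0.
Proof.
elim: m => [|m [A A0]]; first by exists 0; rewrite [LHS]thinmx0.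
have [C C0] : exists C : 'M[F]_e, hmx C phi = 0.
  have H d (C : 'M[F]_d) : char_poly C = phi -> hmx C phi = 0.
    by case: d C => [|d] C <-; [rewrite [LHS]thinmx0|exact: Cayley_Hamilton].
  by exists (companionmx phi); apply: H; apply: companionmxK.
by exists (block_mx C 0 0 A); rewrite (hmx_block C A phi) C0 A0 block_mx0.
Qed.

End Residue.

Section Centralizer.
Variables (F L : finFieldType) (phi : {poly F}) (pr : {rmorphism {poly F} -> L}).
Variable sec : L -> {poly F}.
Hypothesis secK : forall l, pr (sec l) = l.
Variables (m n : nat) (A0 : 'M[F]_n) (tau : 'rV[L]_m -> 'rV[F]_n).
Hypothesis tau_lin : llinear pr A0 tau.
Hypothesis tau_inj : injective tau.
Hypothesis tau_surj : forall w, exists u, tau u = w.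

(** The polynomials in [A0] act as the scalars of [L], so commuting with [A0] means being linear
    over [L]. *)
Lemma centralizer_iso : exists Th : 'M[L]_m -> 'M[F]_n,
  [/\ forall M M', Th (M *m M') = Th M *m Th M', Th 1%:M = 1%:M,
      injective Th, forall M, Th M *m A0 = A0 *m Th M &
      forall B, B *m A0 = A0 *m B -> exists M, Th M = B].
Proof.
have [sg tauK] := boolp.choice tau_surj.
have sgK u : sg (tau u) = u by apply: tau_inj; rewrite tauK.
have [tD tZ] := tau_lin.
have sD u v : sg (u + v) = sg u + sg v by apply: tau_inj; rewrite tD !tauK.
have sZ p u : sg (u *m hmx A0 p) = pr p *: sg u by apply: tau_inj; rewrite tZ !tauK.
have sZF (c : F) u : sg (c *: u) = pr c%:P *: sg u.
  by rewrite -sZ hmxC mul_mx_scalar.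
have tZF (c : F) u : tau (pr c%:P *: u) = c *: tau u.
  by rewrite tZ hmxC mul_mx_scalar.
have Th_ex M : exists T : 'M[F]_n, forall u, u *m T = tau (sg u *m M).
  apply: lin_mx_exists => [u v|c u]; first by rewrite sD mulmxDl tD.
  by rewrite sZF -scalemxAl tZF.
have [Th ThE] := boolp.choice Th_ex.
have eqT (B C : 'M[F]_n) : (forall u : 'rV_n, u *m B = u *m C) -> B = C.
  by move=> BC; apply/row_matrixP => i; rewrite !rowE BC.
exists Th; split.
- by move=> M M'; apply: eqT => u; rewrite mulmxA !ThE sgK mulmxA.
- by apply: eqT => u; rewrite ThE !mulmx1 tauK.
- move=> M M' E; apply/row_matrixP => i; rewrite !rowE; apply: tau_inj.
  by have := ThE M (tau (delta_mx 0 i)); rewrite E ThE !sgK.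
- move=> M; apply: eqT => u; rewrite !mulmxA ThE -{1}(hmxX A0) -tZ.
  by rewrite scalemxAl -sZ hmxX ThE.
move=> B BA.
have gZ p u : sg (tau (pr p *: u) *m B) = pr p *: sg (tau u *m B).
  by rewrite tZ -mulmxA -(hmx_intertwine p BA) mulmxA sZ.
have [M ME] : exists M : 'M[L]_m, forall u, u *m M = sg (tau u *m B).
  apply: lin_mx_exists => [u v|c u]; first by rewrite tD mulmxDl sD.
  by rewrite -(secK c) gZ.
by exists M; apply: eqT => u; rewrite ThE ME !tauK.
Qed.

End Centralizer.

(** Spaces of equal dimension over [L] are isomorphic, so all the matrices killed by [phi] are
    conjugate. *)
Lemma llinear_conj (F L : finFieldType) (pr : {rmorphism {poly F} -> L}) m n
    (A A' : 'M[F]_n) (tau tau' : 'rV[L]_m -> 'rV[F]_n) :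
  llinear pr A tau -> injective tau -> (forall w, exists u, tau u = w) ->
  llinear pr A' tau' -> injective tau' -> (forall w, exists u, tau' u = w) ->
  exists2 P, P \in unitmx & P *m A' = A *m P.
Proof.
have transition B B' (t t' : 'rV[L]_m -> 'rV[F]_n) : llinear pr B t -> injective t ->
    (forall w, exists u, t u = w) -> llinear pr B' t' ->
    exists P : 'M[F]_n, forall u, t u *m P = t' u.
  move=> [tD tZ] tinj tsurj [tD' tZ'].
  have [sg tK] := boolp.choice tsurj.
  have [P PE] : exists P : 'M[F]_n, forall w, w *m P = t' (sg w).
    apply: lin_mx_exists => [u v|c u].
      by rewrite -tD'; congr t'; apply: tinj; rewrite tD !tK.
    have -> : sg (c *: u) = pr c%:P *: sg u.
      by apply: tinj; rewrite tZ !tK hmxC mul_mx_scalar.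
    by rewrite tZ' hmxC mul_mx_scalar.
  by exists P => u; rewrite PE; congr t'; apply: tinj; rewrite tK.
move=> tl tinj tsurj tl' tinj' tsurj'.
have [P PE] := transition _ _ _ _ tl tinj tsurj tl'.
have [R RE] := transition _ _ _ _ tl' tinj' tsurj' tl.
have eqT (B C : 'M[F]_n) : (forall u, tau u *m B = tau u *m C) -> B = C.
  move=> BC; apply/row_matrixP => i; rewrite !rowE.
  by have [u <-] := tsurj (delta_mx 0 i).
have PR : P *m R = 1%:M by apply: eqT => u; rewrite mulmxA PE RE mulmx1.
exists P; first by case/mulmx1_unit: PR.
have [_ tZ] := tl; have [_ tZ'] := tl'.
apply: eqT => u; rewrite !mulmxA PE -(hmxX A') -tZ' -{1}(hmxX A) -tZ.
by rewrite PE.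
Qed.

Definition cyc (K : nzRingType) (I : Type) (N : I -> nat) (i : I) : {poly K} := 'X^(N i) - 1.

Lemma hmx_cyc (K : fieldType) (I : Type) (N : I -> nat) n (A : 'M[K]_n) i :
  (hmx A (cyc K N i) = 0) <-> A ^+ N i = 1.
Proof.
rewrite /cyc hmxB hmxXn hmx1; split=> [/eqP|->]; first by rewrite subr_eq0 => /eqP.
by rewrite subrr.
Qed.

Section Irreducible.
Variables (F L : finFieldType) (phi : {poly F}) (pr : {rmorphism {poly F} -> L}).
Variable sec : L -> {poly F}.
Hypothesis secK : forall l, pr (sec l) = l.
Hypothesis pr_ker : forall p, pr p = 0 -> phi %| p.
Hypothesis pr_phi : pr phi = 0.
Let e := (size phi).-1.
Hypothesis phi_monic : phi \is monic.
Hypothesis e_gt0 : (0 < e)%N.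
Hypothesis cardL : #|L| = (#|F| ^ e)%N.
Variables (I : finType) (i0 : I) (N : I -> nat).

Let QF := upd i0 (cyc F N) phi.
Let QL := upd i0 (cyc L N) ('X - 1).

(** Conjugate [A i0] to the fixed [A0]. The matrices commuting with [A0] are those over [L], so its
    centralizer in the linear group is that of [L], and the other members of the family become
    matrices over [L]. On that side slot [i0] holds the identity, whence the polynomial ['X - 1]. *)
Lemma card_hs_residue m :
  (#|hs (m * e) QF| * #|gls L m| = #|gls F (m * e)| * #|hs m QL|)%N.
Proof.
set n := (m * e)%N.
have dimE n' m' (tau : 'rV[L]_m' -> 'rV[F]_n') :
    injective tau -> (forall w, exists u, tau u = w) -> n' = (e * m')%N.
  exact: (llinear_dim cardL).
have [A0 A00] := root_mx_exists phi_monic m; rewrite -/n in A0 A00.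
have basis (A : 'M[F]_n) : hmx A phi = 0 -> exists tau : 'rV[L]_m -> 'rV[F]_n,
    [/\ llinear pr A tau, injective tau & forall w, exists u, tau u = w].
  move=> Aphi; have [m' [tau [tl tinj tsurj]]] := llinear_basis secK pr_ker Aphi.
  have mm : m' = m.
    have := dimE _ _ _ tinj tsurj; rewrite /n mulnC => /eqP.
    by rewrite eqn_pmul2l // => /eqP.
  by move: tau tl tinj tsurj; rewrite mm => tau tl tinj tsurj; exists tau.
have [tau [tl tinj tsurj]] := basis A0 A00.
have [Th [ThM Th1 Thinj ThC Thsurj]] := centralizer_iso secK tl tinj tsurj.
pose Y : {set {ffun I -> 'M[F]_n}} := [set A in hs n QF | A i0 == A0].
pose K : {set 'M[F]_n} := [set P in gls F n | P *m A0 == A0 *m P].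
have ThX M k : Th (M ^+ k) = Th M ^+ k.
  by elim: k => [|k IH]; [exact: Th1|rewrite !exprS -IH; exact: ThM].
have cardK : #|K| = #|gls L m|.
  rewrite -(card_imset _ Thinj); apply: eq_card => P; rewrite inE.
  apply/andP/imsetP => [[]|[M]]; rewrite !inE.
    move=> Pu /eqP PA0; have [M ME] := Thsurj P PA0; exists M => //; rewrite inE.
    have [M' ME'] : exists M', Th M' = invmx P.
      apply: Thsurj; rewrite -[RHS]mul1mx -(mulVmx Pu) -!mulmxA (mulmxA P) PA0.
      by rewrite mulmxK.
    have : M *m M' = 1%:M by apply: Thinj; rewrite ThM ME ME' Th1 mulmxV.
    by move=> /mulmx1_unit[].
  move=> Mu ->; rewrite ThC eqxx; split=> //.
  have : Th M *m Th (invmx M) = 1%:M by rewrite -ThM mulmxV.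
  by move=> /mulmx1_unit[].
have cardY : #|Y| = #|hs m QL|.
  pose G (M : {ffun I -> 'M[L]_m}) : {ffun I -> 'M[F]_n} :=
    [ffun i => if i == i0 then A0 else Th (M i)].
  have QLi0 M : M \in hs m QL -> M i0 = 1%:M.
    move=> /hsP[/(_ i0) + _]; rewrite /QL upd_id hmxB hmxX hmx1 => /eqP.
    by rewrite subr_eq0 => /eqP.
  rewrite -(card_in_imset (f := G)); last first.
    move=> M M' Mh Mh' E; apply/ffunP => i; have [->|ii0] := eqVneq i i0.
      by rewrite !QLi0.
    apply: Thinj; have := congr1 (fun f : {ffun I -> 'M[F]_n} => f i) E.
    by rewrite !ffunE (negbTE ii0).
  apply: eq_card => A; rewrite inE; apply/andP/imsetP => [[/hsP[Ah Ac] /eqP Ai0]|[M Mh ->]].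
    have A_ex i : exists M, if i == i0 then M = 1%:M else Th M = A i.
      case: eqP => [_|_]; first by exists 1%:M.
      by apply: Thsurj; rewrite -Ai0 Ac.
    have [M ME] := boolp.choice A_ex; exists (finfun M).
      apply/hsP; split=> [i|i j]; rewrite !ffunE.
        have := Ah i; have := ME i; rewrite /QL /QF /upd.
        case: eqP => [_ ->|_ Mi /hmx_cyc Ai]; first by rewrite hmxB hmxX hmx1 subrr.
        by apply/hmx_cyc/Thinj; rewrite ThX Mi Ai Th1.
      have := ME i; have := ME j.
      case: eqP => [_ ->|_ Mj]; first by rewrite mulmx1 mul1mx.
      case: eqP => [_ ->|_ Mi]; first by rewrite mulmx1 mul1mx.
      by apply: Thinj; rewrite !ThM Mi Mj Ac.
    apply/ffunP => i; rewrite !ffunE; have := ME i.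
    by case: eqP => [->|].
  rewrite ffunE eqxx; split=> //; have [Mr Mc] := hsP _ _ Mh.
  apply/hsP; split=> [i|i j]; rewrite !ffunE.
    have := Mr i; rewrite /QL /QF /upd; case: eqP => // _ /hmx_cyc Mi.
    by apply/hmx_cyc; rewrite -ThX Mi Th1.
  case: eqP => _; case: eqP => _ //; rewrite ?ThC //.
  by rewrite -!ThM Mc.
rewrite -cardK -cardY; apply: double_count.
- by apply/subsetP => A; rewrite inE => /andP[].
- by apply/subsetP => A; rewrite inE => /andP[].
- by move=> P A; rewrite inE => Pu; exact: hs_cj.
- move=> A Ah; have [Ar _] := hsP _ _ Ah.
  have Aphi : hmx (A i0) phi = 0 by have := Ar i0; rewrite /QF upd_id.
  have [tA [tAl tAinj tAsurj]] := basis _ Aphi.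
  have [P Pu PA] := llinear_conj tl tinj tsurj tAl tAinj tAsurj.
  exists P; first by rewrite inE.
  by rewrite inE hs_cj //= ffunE PA mulmxK.
move=> P A; rewrite inE => Pu; rewrite inE => /andP[Ah /eqP Ai0].
rewrite inE hs_cj // inE inE Pu /= ffunE Ai0.
apply/eqP/eqP => [{2}<-|->]; first by rewrite mulmxKV.
by rewrite mulmxK.
Qed.

Lemma nu_irreducible : nu QF = dilate e (nu QL).
Proof.
apply: eq_series => n /=; case: ifP => [/dvdnP[m ->]|ndv].
  rewrite mulnK //.
  have g0 (K : finFieldType) k : (#|gls K k|%:R : rat) != 0 by rewrite pnatr_eq0 -lt0n gls_gt0.
  apply: (mulIf (g0 F (m * e)%N)); apply: (mulIf (g0 L m)).
  by rewrite divfK // -natrM card_hs_residue natrM mulrAC divfK // mulrC.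
suff -> : #|hs n QF| = 0%N by rewrite mul0r.
apply: eq_card0 => A; apply/negP => /hsP[/(_ i0) + _]; rewrite /QF upd_id => Aphi.
have [m [tau [tl tinj tsurj]]] := llinear_basis secK pr_ker Aphi.
by move/negP: ndv; apply; rewrite (llinear_dim cardL tinj tsurj) dvdn_mulr.
Qed.

End Irreducible.

Section FixedFrobenius.
Variables (F L : finFieldType) (phi : {poly F}) (pr : {rmorphism {poly F} -> L}).
Variable sec : L -> {poly F}.
Hypothesis secK : forall l, pr (sec l) = l.
Hypothesis pr_ker : forall p, pr p = 0 -> phi %| p.
Hypothesis pr_phi : pr phi = 0.
Let e := (size phi).-1.
Hypothesis e_gt0 : (0 < e)%N.
Hypothesis cardL : #|L| = (#|F| ^ e)%N.

Lemma expf_cardX (l : L) c : l ^+ (#|F| ^ (e * c)) = l.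
Proof.
elim: c => [|c IH]; first by rewrite muln0 expn0 expr1.
by rewrite mulnS expnD exprM -cardL expf_card IH.
Qed.

(** If the [K]-th power of Frobenius fixes the class of ['X], it fixes all of [L], and so does the
    power with exponent [K %% e]. Were that exponent positive, a polynomial of degree
    [q ^ (K %% e) < #|L|] would have too many roots. *)
Lemma dvdp_genpoly K : (phi %| 'X^(#|F| ^ K) - 'X) = (e %| K)%N.
Proof.
set q := #|F|; have q1 : (1 < q)%N by exact: finNzRing_gt1.
have prE : pr ('X^(q ^ K) - 'X) = pr 'X ^+ (q ^ K) - pr 'X.
  by rewrite rmorphB rmorphXn.
apply/idP/idP => [/dvdpP[h hE]|/dvdnP[c ->]]; last first.
  by apply: pr_ker; rewrite rmorphB rmorphXn mulnC expf_cardX subrr.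
have xK : pr 'X ^+ (q ^ K) = pr 'X.
  by apply/eqP; rewrite -subr_eq0 -prE hE rmorphM pr_phi mulr0.
have [p _ pF] := finPcharP F.
have pL : p \in [pchar L] by rewrite (fmorph_pchar (pr \o polyC)).
have pqK : [pchar L].-nat (q ^ K)%N.
  rewrite pnatX; apply/orP; left; rewrite (eq_pnat _ (pcharf_eq pL)).
  by have /abelem_pgroup := fin_ring_pchar_abelem pF; rewrite /pgroup cardsT.
have cF (c : F) j : c ^+ (q ^ j) = c.
  by elim: j => [|j IHj]; rewrite ?expr1 // expnS exprM expf_card.
have lK (l : L) : l ^+ (q ^ K) = l.
  rewrite -[l]secK; elim/poly_ind: (sec l) => [|u c IH].
    by rewrite rmorph0 expr0n expn_eq0 gtn_eqF // ltnW.
  rewrite rmorphD rmorphM exprDn_pchar // exprMn IH xK; congr (_ + _).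
  rewrite -rmorphXn -polyC_exp; congr (pr _%:P).
  exact: cF.
have r0 (l : L) : l ^+ (q ^ (K %% e)) = l.
  by rewrite -{2}[l]lK {2}(divn_eq K e) mulnC expnD exprM expf_cardX.
apply/negPn/negP; rewrite /dvdn -lt0n => Ke0.
have lt_qr : (q ^ (K %% e) < #|L|)%N by rewrite cardL ltn_exp2l // ltn_mod.
have gt1 : (1 < q ^ (K %% e))%N by rewrite -(expn0 q) ltn_exp2l.
have sz : size ('X^(q ^ (K %% e)) - 'X : {poly L}) = (q ^ (K %% e)).+1.
  by rewrite size_polyDl size_polyXn // size_polyN size_polyX.
have := @max_poly_roots _ ('X^(q ^ (K %% e)) - 'X : {poly L}) (enum L).
rewrite -size_poly_eq0 sz /= enum_uniq -cardE ltnS leqNgt lt_qr.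
move=> H; suff : false by []; apply: H => //.
by apply/allP => l _; rewrite rootE !hornerE r0 subrr.
Qed.

End FixedFrobenius.

(** * Degrees of gcds, counting roots in finite extensions *)

Lemma irreducible_factor (K : fieldType) (f : {poly K}) : (1 < size f)%N ->
  exists2 phi : {poly K}, irreducible_poly phi /\ phi \is monic & phi %| f.
Proof.
move=> f1; pose P n := boolp.asbool (exists d : {poly K}, [/\ size d = n, (1 < n)%N & d %| f]).
have exP : exists n, P n by exists (size f); apply/boolp.asboolP; exists f.
case: (ex_minnP exP) => n /boolp.asboolP[d [dn n1 df]] n_min.
have d0 : d != 0 by rewrite -size_poly_gt0 dn ltnW.
have lc0 : lead_coef d != 0 by rewrite lead_coef_eq0.
have dirr : irreducible_poly d.
  split=> [|u u1 ud]; first by rewrite dn.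
  rewrite -dvdp_size_eqp // eqn_leq dvdp_leq //= dn; apply: n_min.
  apply/boolp.asboolP; exists u; split=> //; last exact: dvdp_trans df.
  have u0 : (0 < size u)%N by rewrite size_poly_gt0; apply: contraNneq d0 => u0; rewrite -dvd0p -u0.
  by rewrite ltn_neqAle eq_sym u1.
exists ((lead_coef d)^-1 *: d); last by rewrite dvdpZl ?invr_eq0.
split; last by rewrite monicE lead_coefZ mulVf.
split=> [|u u1]; first by rewrite size_scale ?invr_eq0 // dn.
rewrite dvdpZr ?invr_eq0 // => ud; apply: eqp_trans (dirr.2 u u1 ud) _.
by rewrite eqp_sym eqp_scale ?invr_eq0.
Qed.

(** For [h = 'X^(q ^ K) - 'X] and separable [f], this is the number of roots of [f] in the field
    with [q ^ K] elements. *)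
Definition gcd_degree (K : fieldType) (f h : {poly K}) : nat := (size (gcdp f h)).-1.

Lemma gcd_degree_irreducible (K : fieldType) (phi h : {poly K}) : irreducible_poly phi ->
  gcd_degree phi h = if phi %| h then (size phi).-1 else 0%N.
Proof.
move=> irr; rewrite /gcd_degree; case: ifP => [phih|nphih].
  by have /eqp_size-> : gcdp phi h %= phi by exact: dvdp_gcd_idl.
have : coprimep phi h by rewrite irreducible_poly_coprime // nphih.
by rewrite /coprimep => /eqP->.
Qed.

Lemma gcd_degreeM (K : fieldType) (phi g h : {poly K}) : irreducible_poly phi ->
  coprimep phi g -> g != 0 -> gcd_degree (phi * g) h = (gcd_degree phi h + gcd_degree g h)%N.
Proof.
move=> irr cop g0; rewrite (gcd_degree_irreducible h irr) /gcd_degree.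
have phi0 := irredp_neq0 irr.
have [/dvdpP[h' ->]|nphih] := boolP (phi %| h).
  have /eqp_size-> : gcdp (phi * g) (h' * phi) %= phi * gcdp g h'.
    by rewrite (mulrC h') gcdp_mul2l.
  have -> : size (gcdp g (h' * phi)) = size (gcdp g h').
    rewrite (mulrC h').
    by apply/eqp_size/Gauss_gcdpr; rewrite coprimep_sym.
  have G0 : gcdp g h' != 0 by rewrite gcdp_eq0 negb_and g0.
  rewrite size_mul //; case: (size phi) (irr.1) => // k _.
  by case: (size (gcdp g h')) (size_poly_gt0 (gcdp g h')) => [|j]; rewrite ?G0 //= addnS.
rewrite add0n; congr _.-1; apply: eqp_size.
have cop' : coprimep h phi by rewrite coprimep_sym irreducible_poly_coprime.
apply: eqp_trans (gcdpC _ _) (eqp_trans (Gauss_gcdpr _ cop') (gcdpC _ _)).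
Qed.

(** ['X] is prime to ['X^a - 1], and Euclid's algorithm on exponents computes the gcd with
    ['X^b - 1]. *)
Lemma gcd_degree_Xn (K : fieldType) (a b : nat) : (0 < a)%N ->
  gcd_degree ('X^a - 1 : {poly K}) ('X^(b.+1) - 'X) = gcdn a b.
Proof.
move=> a0; rewrite /gcd_degree.
have XE n : 'X^n - 1 = 'X^n - 1%:P :> {poly K} by [].
have -> : size (gcdp ('X^a - 1 : {poly K}) ('X^(b.+1) - 'X)) =
    size (gcdp ('X^a - 1 : {poly K}) ('X^b - 1)).
  apply: eqp_size; have -> : 'X^(b.+1) - 'X = 'X * ('X^b - 1) :> {poly K}.
    by rewrite mulrBr mulr1 exprS.
  apply: Gauss_gcdpr; rewrite coprimep_sym; apply/Bezout_eq1_coprimepP.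
  exists ('X^(a.-1), -1) => /=; rewrite mulN1r opprB -exprSr prednK // addrC subrK //.
have g0 : (0 < gcdn a b)%N by rewrite gcdn_gt0 a0.
suff /eqp_size-> : gcdp ('X^a - 1 : {poly K}) ('X^b - 1) %= 'X^(gcdn a b) - 1.
  by rewrite XE size_XnsubC.
have dv c n : (c %| n)%N -> ('X^c - 1 : {poly K}) %| 'X^n - 1.
  move=> /dvdnP[m ->]; rewrite mulnC exprM [X in _ %| X]subrX1; exact: dvdp_mulr.
apply/andP; split; last by rewrite dvdp_gcd !dv ?dvdn_gcdl ?dvdn_gcdr.
case: (egcdnP b a0) => u v E _.
have : gcdp ('X^a - 1 : {poly K}) ('X^b - 1) %| 'X^(u * a) - 1.
  by apply: dvdp_trans (dvdp_gcdl _ _) (dv _ _ _); rewrite dvdn_mull.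
rewrite E exprD; have -> : 'X^(v * b) * 'X^(gcdn a b) - 1 =
   ('X^(v * b) - 1) * 'X^(gcdn a b) + ('X^(gcdn a b) - 1) :> {poly K} by ring.
rewrite dvdp_addr // dvdp_mulr //.
by apply: dvdp_trans (dvdp_gcdr _ _) (dv _ _ _); rewrite dvdn_mull.
Qed.

(** * The twisted product formula *)

Section Twist.
Variable Om : nat -> {poly int}.

Lemma eq_twist q eta eta' : (forall K, (0 < K)%N -> eta K = eta' K) ->
  forall M, (0 < M)%N -> twist Om q eta M = twist Om q eta' M.
Proof.
move=> E M M0; apply: eq_bigr => n nM; congr (_ * _ / _); apply: E.
by rewrite divn_gt0 ?(dvdn_gt0 M0 nM) // dvdn_leq.
Qed.

Lemma twistD q eta eta' : twist Om q (fun K => eta K + eta' K) = twist Om q eta + twist Om q eta'.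
Proof.
apply: eq_series => M; rewrite scoefD /= -big_split; apply: eq_bigr => n _ /=.
by rewrite mulrDr mulrDl.
Qed.

(** The term [K] over the field with [q ^ e] elements becomes the term [e * K] over the one with
    [q]; the factor [e] compensates for the denominator [K]. *)
Lemma dilate_twist q e eta M : (0 < e)%N -> (0 < M)%N ->
  dilate e (twist Om (q ^ e) eta) M =
  twist Om q (fun K => if (e %| K)%N then e%:R * eta (K %/ e)%N else 0) M.
Proof.
move=> e0 M0 /=; case: ifP => [/dvdnP[M' ME]|ndv]; last first.
  rewrite big1 // => n nM; case: ifP => [eMn|]; last by rewrite mulr0 mul0r.
  by move/negP: ndv; case; apply: dvdn_trans eMn (dvdn_div nM).
rewrite ME mulnK //.
have M'0 : (0 < M')%N by case: M' ME M0 => // ->.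
rewrite -(big_mkord (fun n => n %| M')%N (fun n => (pZQ (Om n)).[(q ^ e)%:R ^- (M' %/ n)]
  * eta (M' %/ n)%N / ((M' %/ n)%:R * ((q ^ e)%:R ^+ (M' %/ n) - 1)))).
have le_M : (M'.+1 <= (M' * e).+1)%N by rewrite ltnS leq_pmulr.
rewrite (big_nat_widen _ _ _ _ _ le_M) big_mkord.
rewrite big_mkcond [RHS]big_mkcond /=; apply: eq_bigr => n _.
have [nM'|nnM'] := boolP (n %| M')%N; last first.
  rewrite /=; case: ifP => // nM'e; case: ifP => [|_]; last by rewrite mulr0 mul0r.
  move=> /dvdnP[c cE]; case/negP: nnM'; apply/dvdnP; exists c; apply/eqP.
  by rewrite -(eqn_pmul2r e0) -[X in X == _](divnK nM'e) cE mulnAC.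
rewrite /= ltnS dvdn_leq // dvdn_mulr //.
have n0 := dvdn_gt0 M'0 nM'.
have mulE a b c : (b %| a)%N -> ((a * c) %/ b = c * (a %/ b))%N.
  by move=> ba; rewrite muln_divA // mulnC.
rewrite mulE //.
rewrite dvdn_mulr // mulKn // natrX -!exprM natrM.
have e1 : (e%:R : rat) != 0 by rewrite pnatr_eq0 -lt0n.
rewrite -!mulrA; congr (_ * _); rewrite [in RHS]mulrCA; congr (_ * _).
by rewrite [X in _ = _ * X]invfM mulVKf.
Qed.

End Twist.

Section MainIdentity.
Variable Om : nat -> {poly int}.
Hypothesis OmE : gl_exponents Om.

(** For positive [N i], the number of homomorphisms from the product of the cyclic groups of orders
    [N i] to the multiplicative group of the field with [q ^ K] elements. *)
Definition eta_cyc (I : finType) (N : I -> nat) (q K : nat) : rat :=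
  (\prod_i gcdn (N i) (q ^ K - 1))%:R.

Lemma eq_nu (F : finFieldType) (I : finType) (Q Q' : I -> {poly F}) :
  Q =1 Q' -> nu Q = nu Q'.
Proof.
move=> QQ; apply: eq_series => n /=; congr (_%:R / _); apply: eq_card => A.
by apply/hsP/hsP => -[h c]; split=> // i; rewrite ?QQ // -QQ.
Qed.

Lemma nu_exp1 (F : finFieldType) (I : finType) (N : I -> nat) : (forall i, N i = 1%N) ->
  isexp (twist Om #|F| (eta_cyc N #|F|)) (nu (cyc F N)).
Proof.
move=> N1; have q1 := finNzRing_gt1 F.
have -> : nu (cyc F N) = Series (fun n => (gl_card #|F| n)%:R^-1).
  apply: eq_series => n /=; rewrite card_gls -[RHS]mul1r; congr (_ / _).
  suff -> : hs n (cyc F N) = [set [ffun=> 1%:M]] by rewrite cards1.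
  apply/setP => A; rewrite [RHS]inE; apply/hsP/eqP => [[h _]|->].
    by apply/ffunP => i; rewrite ffunE; have /hmx_cyc := h i; rewrite N1 expr1.
  split=> [i|i j]; last by rewrite !ffunE.
  by apply/hmx_cyc; rewrite ffunE; exact: expr1n.
apply: eq_isexp (OmE q1) => M M0; apply: eq_twist => // K _.
by rewrite /eta_cyc big1 // => i _; rewrite N1; exact: gcd1n.
Qed.

Lemma residue_field (F : finFieldType) (phi : {poly F}) :
  irreducible_poly phi -> phi \is monic ->
  exists (L : finFieldType) (pr : {rmorphism {poly F} -> L}) (sec : L -> {poly F}),
   [/\ forall l, pr (sec l) = l, forall p, pr p = 0 -> phi %| p, pr phi = 0 &
     #|L| = (#|F| ^ (size phi).-1)%N].
Proof.
move=> irr mon; have mi : monic_irreducible_poly phi by [].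
exists {poly %/ phi with mi}, (in_qpoly phi), (fun l : {poly %/ phi with mi} => val l).
have mkE := mk_monicE mi.
split.
- move=> l; apply/val_inj => /=; rewrite Pdiv.CommonRing.rmodp_small // size_mk_monic //.
- move=> p /(congr1 val) /=; rewrite mkE => mod0.
  by rewrite Pdiv.Field.dvdpE; exact/Pdiv.CommonRing.rmodp_eq0P.
- apply/val_inj => /=; rewrite mkE; exact: (Pdiv.RingMonic.rmodpp mon).
- exact: card_qfpoly.
Qed.

End MainIdentity.

Section MainInduction.
Variable Om : nat -> {poly int}.
Hypothesis OmE : gl_exponents Om.

Section Step.
Variables (F : finFieldType) (I : finType) (i0 : I) (N : I -> nat).
Let N' i := if i == i0 then 1%N else N i.
Let q := #|F|.
Hypothesis N_unit : forall i, (N i)%:R != 0 :> F.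
Hypothesis IH : forall L : finFieldType, (forall i, (N' i)%:R != 0 :> L) ->
  isexp (twist Om #|L| (eta_cyc N' #|L|)) (nu (cyc L N')).

Let eta_of (f : {poly F}) (K : nat) : rat :=
  (gcd_degree f ('X^(q ^ K) - 'X))%:R * eta_cyc N' q K.

(** The hypothesis [IH] applies over the residue field, where slot [i0] has become trivial. Coming
    back by [dilate_twist] brings a factor [e] when [e] divides [K], and 0 otherwise: the
    [gcd_degree] of [phi]. *)
Lemma nu_exp_irreducible (phi : {poly F}) : irreducible_poly phi -> phi \is monic ->
  isexp (twist Om q (eta_of phi)) (nu (upd i0 (cyc F N) phi)).
Proof.
move=> irr mon; have [L [pr [sec [secK pr_ker pr_phi cardL]]]] := residue_field irr mon.
have e0 : (0 < (size phi).-1)%N by case: (size phi) irr.1 => [|[]].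
rewrite (nu_irreducible secK pr_ker mon e0 cardL).
have -> : nu (upd i0 (cyc L N) ('X - 1)) = nu (cyc L N').
  by apply: eq_nu => i; rewrite /upd /cyc /N'; case: eqP.
have NL i : (N' i)%:R != 0 :> L.
  rewrite -(rmorph_nat (pr \o polyC)) fmorph_eq0 /N'.
  by case: (i == i0); [exact: oner_neq0|exact: N_unit].
apply: eq_isexp (isexp_dilate e0 (IH NL)) => M M0.
rewrite cardL dilate_twist //; apply: eq_twist => // K K0.
rewrite /eta_of gcd_degree_irreducible // (dvdp_genpoly secK pr_ker pr_phi e0 cardL).
case: ifP => [/dvdnP[c ->]|_]; last by rewrite mul0r.
by rewrite mulnK // /eta_cyc -expnM mulnC.
Qed.

(** As [N i0] is invertible in [F], the polynomial [f] is separable and its irreducible factors are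
    pairwise coprime. They split off one by one, with logarithms and gcd degrees adding up. *)
Lemma nu_exp_dvd (f : {poly F}) : f \is monic -> f %| 'X^(N i0) - 1 ->
  isexp (twist Om q (eta_of f)) (nu (upd i0 (cyc F N) f)).
Proof.
have [k] := ubnP (size f); elim: k f => // k IHk f lt_fk mon fX.
have [f1|f1] := leqP (size f) 1.
  have {f1} -> : f = 1.
    move: mon; rewrite (size1_polyC f1) monicE lead_coefC => /eqP->; exact: polyC1.
  have -> : nu (upd i0 (cyc F N) 1) = 1.
    apply: eq_series => -[|n]; rewrite scoef1 /=.
      rewrite card_gls /gl_card big_geq // muln1 expn0 divr1.
      have A0 (A B : {ffun I -> 'M[F]_0}) : A = B.
        by apply/ffunP => i; rewrite [A i]thinmx0 [B i]thinmx0.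
      suff -> : hs 0 (upd i0 (cyc F N) 1) = [set [ffun=> 0]] by rewrite cards1.
      apply/setP => A; rewrite [RHS]inE (A0 A [ffun=> 0]) eqxx.
      by apply/hsP; split=> [i|i j]; [exact: thinmx0|rewrite !ffunE].
    suff -> : #|hs n.+1 (upd i0 (cyc F N) 1)| = 0%N by rewrite mul0r.
    apply: eq_card0 => A; apply/negP => /hsP[/(_ i0) + _].
    by rewrite upd_id hmx1 => /eqP; rewrite oner_eq0.
  apply: eq_isexp (@isexp0 _) => M M0; rewrite scoef0 /=; symmetry; apply: big1 => n _.
  have /eqp_size sz : gcdp (1 : {poly F}) ('X^(q ^ (M %/ n)) - 'X) %= 1 by exact: gcd1p.
  by rewrite /eta_of /gcd_degree sz size_poly1 mul0r mulr0 mul0r.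
have [phi [irr phi_mon] phif] := irreducible_factor f1.
have [g fE] : exists g, f = phi * g by have /dvdpP[g ->] := phif; exists g; rewrite mulrC.
have g_mon : g \is monic by move: mon; rewrite fE monicMl.
have sep : separable_poly (phi * g).
  by rewrite -fE; apply: dvdp_separable fX _; exact: separable_Xn_sub_1.
have cop : coprimep phi g by move: sep; rewrite separable_mul => /and3P[].
have g0 : g != 0 by exact: monic_neq0.
have gX : g %| 'X^(N i0) - 1 by apply: dvdp_trans fX; rewrite fE dvdp_mulIr.
have lt_gk : (size g < k)%N.
  rewrite -ltnS; apply: leq_trans lt_fk; rewrite ltnS fE size_mul ?(irredp_neq0 irr) //.
  by case: (size phi) irr.1 => [|[|s]] // _; rewrite addSn /= addSn ltnS leq_addl.
rewrite fE nu_coprime //.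
apply: eq_isexp (isexpD (nu_exp_irreducible irr phi_mon) (IHk g lt_gk g_mon gX)) => M M0.
rewrite -twistD; apply: eq_twist => // K K0.
by rewrite /eta_of gcd_degreeM // natrD mulrDl.
Qed.

Lemma nu_exp_step : isexp (twist Om q (eta_cyc N q)) (nu (cyc F N)).
Proof.
have N0 : (0 < N i0)%N.
  by rewrite lt0n; apply: contraNneq (N_unit i0) => ->; rewrite eqxx.
have mon : ('X^(N i0) - 1 : {poly F}) \is monic by exact: (monicXnsubC 1).
have -> : nu (cyc F N) = nu (upd i0 (cyc F N) ('X^(N i0) - 1)).
  by apply: eq_nu => i; rewrite /upd; case: eqP => [->|].
apply: eq_isexp (nu_exp_dvd mon (dvdpp _)) => M M0; apply: eq_twist => // K K0.
have q1 : (1 < q)%N := finNzRing_gt1 F.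
have qK0 : (0 < q ^ K)%N by rewrite expn_gt0 ltnW.
have qKE : (q ^ K = (q ^ K - 1).+1)%N by rewrite subn1 prednK.
have gE : gcd_degree ('X^(N i0) - 1 : {poly F}) ('X^(q ^ K) - 'X) = gcdn (N i0) (q ^ K - 1).
  by rewrite {1}qKE gcd_degree_Xn.
rewrite /eta_of gE -natrM /eta_cyc.
rewrite [in RHS](bigD1 i0) //= [in LHS](bigD1 i0) //= /N' eqxx gcd1n mul1n.
by congr (_ * _)%:R; apply: eq_bigr => i /negbTE->.
Qed.

End Step.

Theorem nu_exp (F : finFieldType) (I : finType) (N : I -> nat) :
  (forall i, (N i)%:R != 0 :> F) ->
  isexp (twist Om #|F| (eta_cyc N #|F|)) (nu (cyc F N)).
Proof.
(* The induction on the number of nontrivial factors is over all fields at once, since each step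
   passes to residue extensions. *)
have [k] := ubnP #|[set i | N i != 1%N]|; elim: k F N => // k IH F N lt_k N_unit.
have [s0|[i0]] := set_0Vmem [set i | N i != 1%N].
  by apply: nu_exp1 => // i; apply/eqP; move/setP/(_ i): s0; rewrite !inE => /negbFE.
rewrite inE => Ni0; apply: (nu_exp_step (i0 := i0)) => // L NL; apply: IH => //.
rewrite -ltnS; apply: leq_trans lt_k; rewrite ltnS; apply: proper_card.
apply/properP; split.
  by apply/subsetP => i; rewrite !inE; case: (i =P i0).
by exists i0; rewrite !inE // eqxx.
Qed.

End MainInduction.

(** * Homomorphisms from a product of cyclic groups *)

Section CommutingProducts.
Local Open Scope group_scope.
Variables (H : finGroupType) (I : eqType).

Lemma prodg_split (s : seq I) (u v : I -> H) : (forall i j, commute (u i) (v j)) ->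
  \prod_(i <- s) (u i * v i) = \prod_(i <- s) u i * \prod_(i <- s) v i.
Proof.
move=> uv; elim: s => [|i s IH]; first by rewrite !big_nil mulg1.
rewrite !big_cons IH -!mulgA; congr (_ * _); rewrite !mulgA; congr (_ * _).
elim: s {IH} => [|j s IH]; first by rewrite big_nil mulg1 mul1g.
by rewrite big_cons mulgA -(uv j i) -!mulgA IH.
Qed.

Lemma prodg_single (s : seq I) (u : I -> H) j : uniq s -> j \in s ->
  (forall i, i != j -> u i = 1) -> \prod_(i <- s) u i = u j.
Proof.
move=> us js u1; case/splitPr: js us => s1 s2.
rewrite cat_uniq /= => /and3P[_ + /andP[js2 _]]; rewrite negb_or => /andP[js1 _].
rewrite big_cat big_cons /= !big1_seq ?mul1g ?mulg1 // => i /andP[_ is_].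
  by apply: u1; apply: contraNneq js2 => <-.
by apply: u1; apply: contraNneq js1 => <-.
Qed.

End CommutingProducts.

Section LinkHom.
Variables (p r : nat) (k : nat -> nat).
Hypothesis p_prime : prime p.

Definition cyc_index : finType := {j : 'I_r & 'I_(k j.+1)}.
Definition cyc_order (i : cyc_index) : nat := (p ^ (tag i).+1)%N.

Lemma cyc_order_gt1 i : (1 < cyc_order i)%N.
Proof. by rewrite -(expn0 p) ltn_exp2l // prime_gt1. Qed.

Notation G := (prod_cyclic p r k).

Let gen (i : cyc_index) : G :=
  [ffun j : cyc_index => ((j == i)%:R : 'Z_(p ^ (tag j).+1))].

Let mulGE (x y : G) j : (x * y)%g j = x j + y j.
Proof. by rewrite ffunE. Qed.

Let expGE (x : G) n j : (x ^+ n)%g j = x j *+ n.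
Proof.
elim: n => [|n IH]; first by rewrite expg0 mulr0n ffunE.
by rewrite expgS mulGE IH mulrS.
Qed.

Let prodGE (s : seq cyc_index) (x : cyc_index -> G) j :
  (\prod_(i <- s) x i)%g j = \sum_(i <- s) x i j.
Proof.
elim: s => [|i s IH]; first by rewrite !big_nil ffunE.
by rewrite !big_cons mulGE IH.
Qed.

Let gen_prod (x : G) : x = (\prod_(i <- enum cyc_index) gen i ^+ (x i : nat))%g.
Proof.
apply/ffunP => j; rewrite prodGE big_enum /= (bigD1 j) //= big1 ?addr0.
  by rewrite expGE ffunE eqxx natr_Zp.
by move=> i ij; rewrite expGE ffunE eq_sym (negbTE ij) mul0rn.
Qed.

Let gen_order i : (gen i ^+ cyc_order i = 1)%g.
Proof.
apply/ffunP => j; rewrite expGE !ffunE; case: eqP => [->|_]; last by rewrite mul0rn.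
by rewrite /cyc_order pchar_Zp // cyc_order_gt1.
Qed.

Let gen_comm i j : (gen i * gen j = gen j * gen i)%g.
Proof. by apply/ffunP => l; rewrite !mulGE addrC. Qed.

(** A homomorphism is determined by the images of the generators, which may be any commuting
    matrices of the right exponents. *)
Lemma nHom_hs (F : finFieldType) n :
  nHom G (GLn F n) = #|hs n (cyc F cyc_order)|.
Proof.
pose Phi (f : {ffun G -> GLn F n}) : {ffun cyc_index -> 'M[F]_n} :=
  [ffun i => GLn_val (f (gen i))].
have valX (a : GLn F n) m : GLn_val (a ^+ m)%g = GLn_val a ^+ m.
  by elim: m => [|m IH] //; rewrite expgS exprS -IH.
have homE (f : {ffun G -> GLn F n}) : morphic [set: G] f ->
    (forall x y, f (x * y) = f x * f y)%g.
  by move=> /morphicP fM x y; apply: fM; rewrite inE.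
have homX (f : {ffun G -> GLn F n}) : morphic [set: G] f ->
    (forall x m, f (x ^+ m) = f x ^+ m)%g.
  move=> fM x; have f1 : f 1%g = 1%g.
    by apply: (mulgI (f 1%g)); rewrite -homE // !mulg1.
  by elim=> [|m IH]; rewrite ?expg0 // !expgS homE // IH.
have homP (f : {ffun G -> GLn F n}) : morphic [set: G] f ->
    (forall s (u : cyc_index -> G), f (\prod_(i <- s) u i) = \prod_(i <- s) f (u i))%g.
  move=> fM s u; elim: s => [|i s IH]; last by rewrite !big_cons homE // IH.
  by rewrite !big_nil -(expg0 1%g) homX // expg0.
rewrite /nHom -(card_in_imset (f := Phi)); last first.
  move=> f g; rewrite !inE => fM gM E; apply/ffunP => x.
  rewrite (gen_prod x) !homP //; apply: eq_bigr => i _; rewrite !homX //.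
  congr (_ ^+ _)%g; apply: val_inj.
  by have := congr1 (fun A : {ffun cyc_index -> 'M[F]_n} => A i) E; rewrite !ffunE.
apply: eq_card => A; apply/imsetP/hsP => [[f]|[Ah Ac]].
  rewrite inE => fM ->; split=> [i|i j].
    by apply/hmx_cyc; rewrite ffunE -valX -homX // gen_order -(expg0 1%g) homX.
  rewrite !ffunE -[LHS]/(GLn_val (f (gen i) * f (gen j))%g).
  by rewrite -homE // gen_comm homE.
have Au i : A i \in unitmx.
  have /hmx_cyc := Ah i; rewrite -(prednK (ltnW (cyc_order_gt1 i))) exprS.
  by move=> /mulmx1_unit[].
pose a i := MkGLn (Au i).
have aN i : (a i ^+ cyc_order i = 1)%g.
  by apply: val_inj; rewrite /= valX; apply/hmx_cyc; exact: Ah.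
have ac i j : commute (a i) (a j) by apply: val_inj; exact: Ac.
pose f : {ffun G -> GLn F n} :=
  [ffun x : G => \prod_(i <- enum cyc_index) a i ^+ (x i : nat)]%g.
exists f.
  rewrite inE; apply/morphicP => x y _ _; rewrite !ffunE -prodg_split; last first.
    by move=> i j; apply: commuteX2.
  (* Exponents add only modulo [cyc_order i], a multiple of the order of [a i]. *)
  apply: eq_bigr => i _; rewrite -expgD; apply/eqP; rewrite eq_expg_mod_order.
  rewrite mulGE /=; apply/eqP/modn_dvdm.
  by rewrite Zp_cast ?cyc_order_gt1 // order_dvdn aN.
apply/ffunP => j; rewrite !ffunE (prodg_single (j := j)) ?enum_uniq ?mem_enum //.
  rewrite ffunE eqxx.
  by rewrite [((_ : 'Z__) : nat)](_ : _ = 1%N) ?expg1 //= modn_small.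
by move=> i ij; rewrite ffunE (negbTE ij) expg0.
Qed.

End LinkHom.

(** * The minimizer and the p-adic weight *)

Section Minimizer.
Variables (p q d r : nat) (k : nat -> nat) (l : nat).
Hypothesis p_prime : prime p.
Hypothesis q_gt1 : (1 < q)%N.
Hypothesis p_ndvd_q : ~~ (p %| q)%N.
Hypothesis d_order : is_mult_order q p d.
Hypothesis r_gt0 : (0 < r)%N.
Hypothesis kr_gt0 : (0 < k r)%N.
Hypothesis l_min : is_smallest_minimizer (objective p q d r k) l.
Let p_gt1 := prime_gt1 p_prime.
Let p_gt0 := prime_gt0 p_prime.
Let lam := lambda p q d.
Let b := b_ p q d r k.
Let c := c_ r k.

(** The increment of [c] at [x]: the number of cyclic factors of order greater than [p ^ x]. *)
Definition tail (x : nat) : nat := (\sum_(1 <= j < r.+1) (x < j) * k j)%N.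

Lemma c_S x : c x.+1 = (c x + tail x)%N.
Proof.
rewrite /c /c_ /tail -big_split; apply: eq_bigr => j _ /=.
by rewrite -mulnDl; congr (_ * _)%N; case: ltnP => h; lia.
Qed.

Lemma tail_anti x y : (x <= y)%N -> (tail y <= tail x)%N.
Proof.
move=> le_xy; apply: leq_sum => j _; rewrite leq_mul2r; apply/orP; right.
by case: (ltnP y j) => // lt_yj; rewrite (leq_ltn_trans le_xy lt_yj).
Qed.

Lemma c_0 : c 0 = 0%N.
Proof. by rewrite /c /c_ big1 // => j _; rewrite min0n. Qed.

Lemma c_1 : (0 < c 1)%N.
Proof.
rewrite /c /c_ big_nat_recr //=; apply: leq_trans (leq_addl _ _).
by rewrite muln_gt0 kr_gt0 andbT leq_min r_gt0.
Qed.

(** The function [c] is concave, so all the earlier increments are at least 2 too. *)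
Lemma c_ge2 x : (2 <= tail x)%N -> (x.*2 <= c x)%N.
Proof.
elim: x => [|x IH] tx; first by rewrite c_0.
have tx' : (2 <= tail x)%N by apply: leq_trans tx (tail_anti _).
by rewrite c_S doubleS -addn2 leq_add ?IH.
Qed.

Lemma c_le1 x y : (tail x <= 1)%N -> (x <= y)%N -> (c y <= c x + (y - x))%N.
Proof.
move=> tx; elim: y => [|y IH]; first by rewrite leqn0 => /eqP->; rewrite leq_addr.
rewrite leq_eqVlt => /orP[/eqP<-|]; first by rewrite leq_addr.
rewrite ltnS => le_xy; rewrite c_S subSn // addnS -addn1 leq_add ?IH //.
exact: leq_trans (tail_anti le_xy) tx.
Qed.

Lemma c_bounded x : (c x <= \sum_(1 <= j < r.+1) j * k j)%N.
Proof. by apply: leq_sum => j _; rewrite leq_mul2r geq_minr orbT. Qed.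

(** The objective cleared of denominators, so that minimality becomes an inequality of integers. *)
Let B x : int := b x * (p%:Z - 1) - 1.

Let objE x : objective p q d r k x = (B x)%:~R / ((p%:R - 1) * p%:R ^+ x).
Proof.
have p1 : (p%:R - 1 : rat) != 0 by rewrite subr_eq0 pnatr_eq1 gtn_eqF.
have p0 : (p%:R : rat) != 0 by rewrite pnatr_eq0 gtn_eqF.
have -> : ((B x)%:~R : rat) = (b x)%:~R * (p%:R - 1) - 1.
  by rewrite /B !intrD !intrM !intrD.
rewrite /objective -/(b x).
by field; rewrite p1 expf_neq0.
Qed.

Let den_gt0 x : 0 < (p%:R - 1) * p%:R ^+ x :> rat.
Proof.
by rewrite mulr_gt0 ?exprn_gt0 ?ltr0n // subr_gt0 ltr1n.
Qed.

Let pos1 : 0 < (p%:R - 1 : rat). Proof. by rewrite subr_gt0 ltr1n. Qed.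

Let obj_le x y : objective p q d r k x <= objective p q d r k y ->
  B x * p%:Z ^+ y <= B y * p%:Z ^+ x.
Proof.
rewrite !objE ler_pdivrMr // mulrAC ler_pdivlMr //.
rewrite mulrCA mulrC [X in _ <= X]mulrCA [X in _ <= X]mulrC !ler_pM2r //.
by rewrite -(ler_int rat) !rmorphM !rmorphXn.
Qed.

Let obj_lt x y : objective p q d r k x < objective p q d r k y ->
  B x * p%:Z ^+ y < B y * p%:Z ^+ x.
Proof.
rewrite !objE ltr_pdivrMr // mulrAC ltr_pdivlMr //.
rewrite mulrCA mulrC [X in _ < X]mulrCA [X in _ < X]mulrC !ltr_pM2r //.
by rewrite -(ltr_int rat) !rmorphM !rmorphXn.
Qed.

(** Since [c] is bounded, [b j] is nonpositive and [B j] negative for large [j]. A positive [b l]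
    would give [B l >= 0], against minimality. *)
Lemma b_l_le0 : b l <= 0.
Proof.
pose j := (\sum_(1 <= j < r.+1) j * k j)%N.
have bj : b j <= 0.
  rewrite /b /b_; have := c_bounded (lam j); rewrite -/(lam j) -/(c (lam j)) -/j; lia.
have := obj_le (proj1 l_min j); rewrite leNgt => /negP H; rewrite leNgt.
apply/negP => bl; apply: H.
have p1 : (1 : int) <= p%:Z - 1 by lia.
have Bl : 0 <= B l by rewrite /B; nia.
have Bj : B j < 0 by rewrite /B; nia.
have px x : 0 < p%:Z ^+ x by rewrite exprn_gt0 // ltz_nat.
apply: lt_le_trans (_ : 0 <= _); first by rewrite pmulr_llt0.
by rewrite mulr_ge0 // ltW.
Qed.

(** From [b i <= 0] and [i < lam i] follows [c (lam i) < 2 * lam i], so by concavity [c] then grows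
    with slope at most 1 and [b] drops by at least 1 per index. But [b l' >= 0] at the index [l']
    before [l]: a negative value would contradict the strict minimality of [l]. *)
Lemma b_nonpos i : (i < l)%N -> b i <= 0 -> i.+1 = l /\ b i = 0.
Proof.
move=> lt_il bi.
have lamgt := lambda_gt p_prime q_gt1 d_order.
have tail1 : (tail (lam i) <= 1)%N.
  rewrite leqNgt; apply/negP => t2; have := c_ge2 t2; have := lamgt i.
  by move: bi; rewrite /b /b_ -/(lam i) -/(c _); lia.
have lam_le i' j' : (i' <= j')%N -> (lam i' <= lam j')%N.
  rewrite leq_eqVlt => /orP[/eqP-> //|h]; apply: ltnW.
  exact: (lambda_ltn p_prime q_gt1 d_order).
have bj j : (i <= j)%N -> b j <= b i - (j%:Z - i%:Z).
  move=> le_ij; have := c_le1 tail1 (lam_le _ _ le_ij); have := lam_le _ _ le_ij.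
  by rewrite /b /b_ -/(lam i) -/(lam j) -!/(c _); lia.
have [l' lE] : exists l', l = l'.+1 by exists l.-1; rewrite prednK // (leq_ltn_trans _ lt_il).
have bl' : 0 <= b l'.
  have [nice|] := boolP ((2 < p)%N || (2 <= lambda p q d 0)%N || (0 < l')%N).
    have lamS := lambdaS p_prime q_gt1 d_order nice.
    have bS : b l' - 2 <= b l.
      rewrite lE /b /b_ lamS -/(lam l') -!/(c _) c_S; lia.
    have := obj_lt (proj2 l_min l' _); rewrite lE => /(_ (ltnSn l')); rewrite -lE.
    rewrite lE exprS mulrA ltr_pM2r ?exprn_gt0 ?ltz_nat // -lE /B.
    have p1 : (1 : int) <= p%:Z - 1 by lia.
    move=> H; rewrite leNgt; apply/negP => bneg; nia.
  (* In the irregular case [lambda] may jump by more than 1, but there [b 0 = c 1 - 1], and [c 1] is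
     positive because [k r] is. *)
  rewrite !negb_or -!leqNgt leqn0 => /andP[/andP[p2 l1] /eqP->].
  have lam1 : lambda p q d 0 = 1%N.
    by apply/eqP; rewrite eqn_leq l1 (lambda0_gt0 p_prime q_gt1 d_order).
  by rewrite /b /b_ lam1 -/(c _); have := c_1; lia.
have := bj l'; rewrite -ltnS -lE lt_il => /(_ isT); lia.
Qed.

(* The estimate on the coefficients of the exponential of a monomial: *)
(* [b i] is the valuation of the coefficient and [t] the exponent.    *)
Lemma key_ineq i t (M := (t * p ^ i %/ p ^ l)%N) :
  b l * M%:Z - (logn p M`!)%:Z <= b i * t%:Z - (logn p t`!)%:Z.
Proof.
have p1 : (1 : int) <= p%:Z - 1 by lia.
have pX s : (p ^ s)%N%:Z = p%:Z ^+ s by rewrite -(natz (p ^ s)) natrX natz.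
have geoZ s : (p%:Z - 1) * (geo p s)%:Z = p%:Z ^+ s - 1.
  rewrite -pX -(geoE p_prime s) -addn1 PoszD PoszM addrK.
  by rewrite -subn1 -subzn.
have [le_li|lt_il] := leqP l i.
  set s := (i - l)%N; have iE : i = (l + s)%N by rewrite subnKC.
  have ME : M = (p ^ s * t + 0)%N.
    by rewrite /M iE expnD mulnCA mulKn ?expn_gt0 ?p_gt0 // mulnC addn0.
  have ps0 : (0 < p ^ s)%N by rewrite expn_gt0 p_gt0.
  rewrite ME (logn_fact_split p_prime t ps0) addn0 logn1 addn0.
  have := obj_le (proj1 l_min i); rewrite iE exprD mulrA mulrAC ler_pM2r ?exprn_gt0 ?ltz_nat // /B.
  have := geoZ s; rewrite !PoszD !PoszM -iE.
  rewrite pX.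
  move: (p%:Z ^+ s) (geo p s) => P g gE H.
  have H2 : b l * P - g%:Z <= b i.
    by rewrite -(ler_pM2r (_ : 0 < p%:Z - 1)); nia.
  have t0 : (0 : int) <= t%:Z by [].
  nia.
set s := (l - i)%N; have lE : l = (i + s)%N by rewrite subnKC // ltnW.
have ME : M = (t %/ p ^ s)%N.
  by rewrite /M lE expnD divnMA mulnK ?expn_gt0 ?p_gt0.
have lt_x : (t %% p ^ s < p ^ s)%N by rewrite ltn_mod expn_gt0 p_gt0.
have tE : t = (p ^ s * M + t %% p ^ s)%N by rewrite ME mulnC -divn_eq.
move: lt_x tE; set x := (t %% p ^ s)%N => lt_x tE.
(* The rounding remainder [x] costs nothing: either [b i >= 1], or [b i = 0] and [l = i + 1], in
   which case [x < p] and the factorial of [x] is prime to [p]. *)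
have bx : (logn p x`!)%:Z <= b i * x%:Z.
  have [b1|b0] := ltP 0 (b i).
    by have := logn_fact_le_id p_prime x; nia.
  have [il ->] := b_nonpos lt_il b0; rewrite mul0r.
  have s1 : s = 1%N by rewrite /s -il subSnn.
  rewrite logn_fact_div // divn_small ?logn1 //.
  by move: lt_x; rewrite s1 expn1.
rewrite tE (logn_fact_split p_prime M lt_x).
have := obj_lt (proj2 l_min i lt_il); rewrite lE exprD mulrA -lE mulrAC [X in _ < X]mulrAC.
rewrite [B i * _ * _]mulrAC ltr_pM2r ?exprn_gt0 ?ltz_nat // /B.
have := geoZ s; rewrite !PoszD !PoszM.
rewrite pX.
move: (p%:Z ^+ s) (geo p s) => P g gE H.
have H2 : b l + g%:Z <= b i * P.
  by rewrite -(ler_pM2r (_ : 0 < p%:Z - 1)); nia.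
have M0 : (0 : int) <= M%:Z by [].
nia.
Qed.

End Minimizer.

(** * Dwork's lemma *)

Section Padic.
Variable p : nat.
Hypothesis p_prime : prime p.
Let p_gt1 := prime_gt1 p_prime.
Let p_gt0 := prime_gt0 p_prime.
Let p0 : (p%:R : rat) != 0. Proof. by rewrite pnatr_eq0 gtn_eqF. Qed.

(* The localization of the integers at [p]; below, [vge c x] means [v_p x >= c]. *)
Definition pint (x : rat) : Prop :=
  exists (a : int) (n : nat), ~~ (p %| n)%N /\ x = a%:~R / n%:R.

Lemma ndvd_neq0 n : ~~ (p %| n)%N -> (n%:R : rat) != 0.
Proof. by move=> pn; rewrite pnatr_eq0; apply: contraNneq pn => ->. Qed.

Lemma ndvdM m n : ~~ (p %| m)%N -> ~~ (p %| n)%N -> ~~ (p %| m * n)%N.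
Proof. by move=> pm pn; rewrite Euclid_dvdM // negb_or pm. Qed.

Lemma pint_int (a : int) : pint a%:~R.
Proof.
exists a, 1%N; rewrite divr1; split=> //.
by rewrite dvdn1 gtn_eqF.
Qed.

Lemma pint_nat (n : nat) : pint n%:R. Proof. exact: (pint_int n). Qed.

Lemma pint_inv (n : nat) : ~~ (p %| n)%N -> pint n%:R^-1.
Proof. by move=> pn; exists 1, n; rewrite mul1r. Qed.

Lemma pintM x y : pint x -> pint y -> pint (x * y).
Proof.
move=> [a [m [pm ->]]] [b [n [pn ->]]]; exists (a * b), (m * n)%N; split.
  exact: ndvdM.
by rewrite intrM natrM; field; rewrite !ndvd_neq0.
Qed.

Lemma pintB x y : pint x -> pint y -> pint (x - y).
Proof.
move=> [a [m [pm ->]]] [b [n [pn ->]]]; exists (a * n%:Z - b * m%:Z), (m * n)%N; split.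
  exact: ndvdM.
rewrite natrM rmorphB !rmorphM /=.
have -> : (n%:Z%:~R : rat) = n%:R by []. have -> : (m%:Z%:~R : rat) = m%:R by [].
by field; rewrite !ndvd_neq0.
Qed.

Lemma pintX x n : pint x -> pint (x ^+ n).
Proof.
move=> px; elim: n => [|n IH]; first by rewrite expr0; exact: (pint_nat 1).
by rewrite exprS; exact: pintM.
Qed.

Definition vge (c : int) (x : rat) : Prop := pint (x / p%:R ^ c).

Lemma pint_expz (c : int) : 0 <= c -> pint (p%:R ^ c).
Proof. by case: c => // n _; rewrite -exprnP; apply/pintX/pint_nat. Qed.

Lemma vge0E x : vge 0 x <-> pint x.
Proof. by rewrite /vge expr0z divr1. Qed.

Lemma vge0 c : vge c 0.
Proof. by rewrite /vge mul0r; exact: (pint_nat 0). Qed.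

Lemma vgeB c x y : vge c x -> vge c y -> vge c (x - y).
Proof. by move=> vx vy; rewrite /vge mulrBl; exact: pintB. Qed.

Lemma vgeM c e x y : vge c x -> vge e y -> vge (c + e) (x * y).
Proof.
move=> vx vy; rewrite /vge expfzDr //.
have -> : x * y / (p%:R ^ c * p%:R ^ e) = (x / p%:R ^ c) * (y / p%:R ^ e).
  by field; rewrite !expfz_neq0.
exact: pintM.
Qed.

Lemma vge_le c e x : e <= c -> vge c x -> vge e x.
Proof.
move=> le_ec vx; rewrite /vge.
have -> : x / p%:R ^ e = (x / p%:R ^ c) * p%:R ^ (c - e).
  have -> : (p%:R : rat) ^ c = p%:R ^ (c - e) * p%:R ^ e by rewrite -expfzDr // subrK.
  by field; rewrite !expfz_neq0.
by apply: pintM => //; apply: pint_expz; rewrite subr_ge0.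
Qed.

Lemma vgeX c x n : vge c x -> vge (c * n%:Z) (x ^+ n).
Proof.
move=> vx; elim: n => [|n IH]; first by rewrite mulr0 expr0; apply/vge0E/(pint_nat 1).
by rewrite exprS -addn1 PoszD mulrDr mulr1 addrC; exact: vgeM.
Qed.

Lemma logn_split n : (0 < n)%N -> exists2 m, ~~ (p %| m)%N & n = (m * p ^ logn p n)%N.
Proof.
move=> n0; have [m pm nE] := pfactor_coprime p_prime n0; exists m => //.
by rewrite -prime_coprime.
Qed.

Lemma vge_nat n : (0 < n)%N -> vge (logn p n) n%:R.
Proof.
move=> n0; have [m pm nE] := logn_split n0; rewrite /vge -exprnP {1}nE natrM natrX.
by rewrite mulfK ?expf_neq0 //; exact: pint_nat.
Qed.

Lemma vge_natV n : (0 < n)%N -> vge (- (logn p n)%:Z) n%:R^-1.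
Proof.
move=> n0; have [m pm nE] := logn_split n0.
rewrite /vge invr_expz opprK -exprnP {1}nE natrM natrX invfM mulfVK ?expf_neq0 //.
exact: pint_inv.
Qed.

Lemma vge_logn c n : (0 < n)%N -> vge c n%:R -> c <= (logn p n)%:Z.
Proof.
case: c => [c|c _ _]; last by rewrite NegzE (le_trans (_ : _ <= 0)) // oppr_le0.
move=> n0 [a [m [pm E]]]; rewrite lez_nat -pfactor_dvdn //.
have m0 := ndvd_neq0 pm.
have E2 : (n * m)%:R = (a * (p ^ c)%:Z)%:~R :> rat.
  rewrite natrM rmorphM /= -[(p ^ c)%:Z%:~R]/((p ^ c)%:R : rat) natrX.
  have := congr1 (fun x => x * m%:R * p%:R ^+ c) E => /=.
  by rewrite divfK // -exprnP mulrAC divfK ?expf_neq0.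
have {}E2 : (n * m)%:Z = a * (p ^ c)%:Z by apply: (@intr_inj rat); rewrite -E2.
have : (p ^ c %| n * m)%N by rewrite -[(_ %| _)%N]/((p ^ c)%:Z %| (n * m)%:Z)%Z E2 dvdz_mull.
by rewrite Gauss_dvdl // coprimeXl // prime_coprime.
Qed.

(** The denominator is inverted modulo [p]. *)
Lemma pint_residue x : pint x -> exists m : nat, vge 1 (x - m%:R).
Proof.
move=> [a [n [pn ->]]]; have n0 := ndvd_neq0 pn.
have cop : coprime n p by rewrite coprime_sym prime_coprime.
have pZ : (p%:Z : int) != 0 by rewrite eqz_nat gtn_eqF.
have [u uE] : exists u : nat, (n * u = 1 %[mod p])%N.
  have n_gt0 : (0 < n)%N by case: n pn {n0 cop} => //; rewrite dvdn0.
  case: (egcdnP p n_gt0) => u v uE _; exists u; rewrite mulnC uE (eqP cop).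
  by rewrite modnMDl.
pose b := `|(a %% p)%Z|%N; exists (b * u)%N.
have bE : b%:Z = (a %% p)%Z by rewrite /b gez0_abs // modz_ge0.
rewrite /vge expr1z.
have : (p%:Z %| a - (b * u * n)%N%:Z)%Z.
  rewrite -eqz_mod_dvd -mulnA PoszM bE -modzMm modz_mod.
  have -> : ((u * n)%N %% p)%Z = (1 %% p)%Z.
    by rewrite !modz_nat mulnC uE.
  by rewrite modzMm mulr1.
case/dvdzP => h hE; have -> : a%:~R / n%:R - (b * u)%:R = h%:~R * p%:R / n%:R :> rat.
  have hQ : a%:~R - (b * u * n)%:R = h%:~R * p%:R :> rat.
    by have := congr1 (fun x : int => x%:~R : rat) hE; rewrite rmorphB intrM.
  by rewrite -hQ !natrM; field; rewrite n0.
rewrite mulrAC mulfK //; apply: pintM; [exact: pint_int|exact: pint_inv].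
Qed.

Lemma pint_fermat x : pint x -> vge 1 (x ^+ p - x).
Proof.
move=> px; have [m xm] := pint_residue px.
have -> : x ^+ p - x = (x ^+ p - m%:R ^+ p) - (- (m%:R ^+ p - m%:R) - (m%:R - x)) by ring.
have vN c y : vge c y -> vge c (- y) by move=> vy; rewrite -sub0r; apply: vgeB => //; exact: vge0.
apply: vgeB; last apply: vgeB.
- rewrite subrXX -[1]addr0; apply: vgeM => //; apply/vge0E.
  elim/big_ind: _ => [|y z py pz|i _]; first exact: (pint_nat 0).
    by rewrite -[z]opprK; apply: pintB => //; rewrite -sub0r; apply: pintB => //; exact: (pint_nat 0).
  by apply: pintM; apply: pintX => //; exact: pint_nat.
- apply: vN; have : (m ^ p = m %[mod p])%N by exact: fermat_little.
  have le_mp : (m <= m ^ p)%N.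
    by case: (posnP m) => [->//|m0]; rewrite -{1}(expn1 m) leq_pexp2l.
  move/eqP; rewrite eqn_mod_dvd // => /dvdnP[h hE]; rewrite -natrX -natrB //.
  by rewrite hE natrM /vge expr1z mulfK //; exact: pint_nat.
by rewrite -opprB; exact: vN.
Qed.

End Padic.

Section Dwork.
Variable p : nat.
Hypothesis p_prime : prime p.
Let p_gt1 := prime_gt1 p_prime.
Let p_gt0 := prime_gt0 p_prime.
Let p0 : (p%:R : rat) != 0. Proof. by rewrite pnatr_eq0 gtn_eqF. Qed.

Lemma vgeN c x : vge p c x -> vge p c (- x).
Proof. by move=> vx; rewrite -sub0r; apply: vgeB => //; exact: vge0. Qed.

Lemma vgeD c x y : vge p c x -> vge p c y -> vge p c (x + y).
Proof. by move=> vx vy; rewrite -[y]opprK; apply: vgeB => //; exact: vgeN. Qed.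

Lemma vge_sum c (I : Type) (r : seq I) (P : pred I) (F : I -> rat) :
  (forall i, P i -> vge p c (F i)) -> vge p c (\sum_(i <- r | P i) F i).
Proof. by move=> vF; elim/big_ind: _ => //; [exact: vge0|exact: vgeD]. Qed.

Definition vgep c (u : {poly rat}) : Prop := forall i, vge p c u`_i.

Lemma vgepD c u v : vgep c u -> vgep c v -> vgep c (u + v).
Proof. by move=> vu vv i; rewrite coefD; exact: vgeD. Qed.

Lemma vgepM c e u v : vgep c u -> vgep e v -> vgep (c + e) (u * v).
Proof. by move=> vu vv i; rewrite coefM; apply: vge_sum => j _; exact: vgeM. Qed.

Lemma vgep0M u v : vgep 0 u -> vgep 0 v -> vgep 0 (u * v).
Proof. exact: vgepM. Qed.

Lemma vgepC c x : vge p c x -> vgep c x%:P.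
Proof. by move=> vx i; rewrite coefC; case: eqP => // _; exact: vge0. Qed.

Lemma vgepXn n : vgep 0 'X^n.
Proof. by move=> i; rewrite coefXn; apply/vge0E/pint_nat. Qed.

Lemma vgep_exp u n : vgep 0 u -> vgep 0 (u ^+ n).
Proof.
move=> vu; elim: n => [|n IH]; first by rewrite expr0 -polyC1; apply/vgepC/vge0E/(pint_nat p_prime 1).
by rewrite exprS; exact: vgep0M.
Qed.

Lemma vgep_freshman u v : vgep 0 u -> vgep 0 v -> vgep 1 ((u + v) ^+ p - u ^+ p - v ^+ p).
Proof.
move=> vu vv i; have -> : (u + v) ^+ p - u ^+ p - v ^+ p =
    \sum_(1 <= j < p) u ^+ (p - j) * v ^+ j *+ 'C(p, j).
  rewrite exprDn -(big_mkord predT (fun j => u ^+ (p - j) * v ^+ j *+ 'C(p, j))).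
  rewrite big_nat_recr //= big_ltn //= bin0 binn subn0 subnn !expr0 mul1r mulr1 !mulr1n.
  by set s := \sum_(_ <= _ < _) _; ring.
rewrite coef_sum big_nat_cond; apply: vge_sum => j; rewrite andbT => /andP[j0 lt_jp].
rewrite coefMn -mulr_natr.
have /dvdnP[c ->] : (p %| 'C(p, j))%N by apply: prime_dvd_bin => //; rewrite j0.
have vp : vge p 1 p%:R by rewrite /vge expr1z divff //; exact: (pint_nat p_prime 1).
have vc : vge p 0 c%:R by apply/vge0E/pint_nat.
have vuv : vgep 0 (u ^+ (p - j) * v ^+ j) by apply: vgep0M; exact: vgep_exp.
by rewrite natrM mulrA; exact: (vgeM p_prime (vgeM p_prime (vuv i) vc) vp).
Qed.

(** Horner induction, from the binomial congruence for sums and Fermat's congruence for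
    coefficients. *)
Lemma vgep_frobenius u : vgep 0 u -> vgep 1 (u ^+ p - (u \Po 'X^p)).
Proof.
elim/poly_ind: u => [|u x IH] vux.
  by rewrite comp_poly0 subr0 expr0n gtn_eqF // => i; rewrite coef0; exact: vge0.
have vx : vge p 0 x by have := vux 0; rewrite coefD coefMX coefC /= add0r.
have vu : vgep 0 u by move=> i; have := vux i.+1; rewrite coefD coefMX coefC /= addr0.
rewrite comp_polyD comp_polyM comp_polyX comp_polyC.
have -> : (u * 'X + x%:P) ^+ p - ((u \Po 'X^p) * 'X^p + x%:P) =
  ((u * 'X + x%:P) ^+ p - (u * 'X) ^+ p - x%:P ^+ p) +
  ((u ^+ p - (u \Po 'X^p)) * 'X^p + (x ^+ p - x)%:P).
  rewrite exprMn rmorphB rmorphXn /=.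
  move: ((_ + _) ^+ p) (u ^+ p) ('X^p) (u \Po _) (x%:P ^+ p) => A B C D E; ring.
apply: vgepD.
  apply: vgep_freshman; last exact: vgepC.
  by rewrite -['X]expr1; apply: vgep0M => //; exact: vgepXn.
apply: vgepD; last by apply/vgepC/pint_fermat => //; apply/vge0E.
exact: (vgepM (IH vu) (vgepXn p)).
Qed.

Lemma scoef_exp (f : series rat) (u : {poly rat}) n m k :
  (forall i, (i <= n)%N -> u`_i = f i) -> (m <= n)%N -> (f ^+ k) m = (u ^+ k)`_m.
Proof.
move=> uf; elim: k m => [|k IH] m le_mn; first by rewrite !expr0 scoef1 coef1.
rewrite !exprS; apply: smul_polyE => i le_im; first by rewrite uf // (leq_trans le_im).
by rewrite IH // (leq_trans le_im).
Qed.

Lemma isexp_expn (a f : series rat) k : isexp a f -> isexp (a *+ k) (f ^+ k).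
Proof.
move=> af; elim: k => [|k IH]; first by rewrite mulr0n expr0; exact: isexp0.
by rewrite mulrS exprS; exact: isexpD.
Qed.

Lemma scoefMn (f : series rat) k n : (f *+ k) n = f n *+ k.
Proof. exact: (scoefMz f k). Qed.

(** Up to degree [n], [f] is [u + f n * x ^ n]; only the linear term of the binomial expansion sees
    the perturbation, and [u] has constant term 1. *)
Lemma exp_coef_mod (f u : series rat) n k : (0 < n)%N -> f 0 = 1 -> u 0 = 1 -> u n = 0 ->
  (forall i, (i < n)%N -> f i = u i) -> (f ^+ k) n = (u ^+ k) n + k%:R * f n.
Proof.
move=> n0 f0 u0 un fu.
have E1 m : (f ^+ m) 0 = 1 /\ forall i, (i < n)%N -> (f ^+ m) i = (u ^+ m) i.
  elim: m => [|m [IH0 IH]]; first by rewrite !expr0.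
  rewrite !exprS; split=> [|i lt_in]; first by rewrite scoefM0 f0 IH0 mulr1.
  apply: eq_scoefM => j le_ji; first by rewrite fu // (leq_ltn_trans le_ji).
  by rewrite IH // (leq_ltn_trans le_ji).
have U1 m : (u ^+ m) 0 = 1 by have [E0 E] := E1 m; rewrite -E.
elim: k => [|k IH]; first by rewrite !expr0 mul0r addr0.
rewrite !exprS !scoefM; case: n n0 un fu E1 IH => // n _ un fu E1 IH.
have ends (G : nat -> rat) : \sum_(i < n.+2) G i = G 0 + \sum_(i < n) G i.+1 + G n.+1.
  by rewrite big_ord_recl big_ord_recr addrA.
rewrite (ends (fun i => f i * (f ^+ k) (n.+1 - i)%N)) (ends (fun i => u i * (u ^+ k) (n.+1 - i)%N)).
rewrite !subn0 !subnn IH un f0 u0 (proj1 (E1 k)) U1.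
rewrite (eq_bigr (fun i : 'I_n => u i.+1 * (u ^+ k) (n.+1 - i.+1)%N)).
  by rewrite -natr1; ring.
move=> i _; have lt_i := ltn_ord i; have lt_ni : (n.+1 - i.+1 < n.+1)%N by lia.
by rewrite (proj2 (E1 k)) // fu.
Qed.

(** For [t > 0] the valuation of [p ^ t / t!] is at least 1. The filtration [S] asks for integrality
    in degree 0 and for a factor [p] in the other degrees. *)
Lemma vge_exp_p (c : series rat) : (2 < p)%N -> (forall n, pint p (c n)) ->
  forall e, isexp (c *+ p) e -> forall n, (0 < n)%N -> vge p 1 (e n).
Proof.
move=> p3 cp e ce n n0.
pose S (m : nat) x := vge p (0 < m)%:R x.
have S0 m : S m 0 by exact: vge0.
have SB m x y : S m x -> S m y -> S m (x - y) by exact: vgeB.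
have SM m k x y : S m x -> S k y -> S (m + k)%N (x * y).
  move=> Sx Sy; apply: vge_le (vgeM p_prime Sx Sy) => //.
  by rewrite addn_gt0; case: (0 < m)%N; case: (0 < k)%N.
have S1 : S 0 1 by apply/vge0E/(pint_nat p_prime 1).
have mon m : (0 < m)%N -> exp_in S (smon (c m *+ p) m).
  move=> m0; exists (Series (fun k => if (m %| k)%N then (c m *+ p) ^+ (k %/ m) / (k %/ m)`!%:R else 0)).
    exact: (isexp_monomial (@natS_unit _)).
  move=> k; rewrite /S /=; case: ifP => [/dvdnP[t ->]|_]; last exact: vge0.
  rewrite mulnK //; case: (posnP t) => [->|t0].
    by rewrite mul0n expr0 fact0 divr1; apply/vge0E/(pint_nat p_prime 1).
  rewrite muln_gt0 t0 m0 /=.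
  have v1 : vge p 1 (c m *+ p).
    by rewrite -mulr_natr /vge expr1z mulfK.
  have := vgeM p_prime (vgeX p_prime t v1) (vge_natV p_prime (fact_gt0 t)).
  apply: vge_le => //; have := logn_fact_lt p_prime p3 t0; lia.
have Ssum : exp_in S (\sum_(1 <= m < n.+1) smon (c m *+ p) m).
  rewrite big_nat_cond.
  by apply: (exp_in_sum S0 SB SM S1) => m; rewrite andbT => /andP[m0 _]; exact: mon.
have [g gE Sg] := Ssum; have := Sg n; rewrite /S n0.
rewrite -(isexp_eq_le (@natS_unit _) ce gE) // => j /andP[j0 le_jn].
rewrite scoef_sum /= (bigD1_seq j) ?mem_index_iota ?j0 ?iota_uniq //= eqxx big1 ?addr0.
  by rewrite scoefMn.
by move=> m /negPf mj; rewrite eq_sym mj.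
Qed.

(* Dwork's criterion: the hypothesis says that [f ^+ p] is [f] evaluated at [x ^ p] *)
(* times the exponential of [p c], which is congruent to 1 modulo [p].              *)
Lemma dwork (a c f : series rat) : (2 < p)%N -> isexp a f ->
  (forall K, pint p (c K)) -> (forall K, (0 < K)%N -> p%:R * a K = dilate p a K + p%:R * c K) ->
  forall n, pint p (f n).
Proof.
move=> p3 af cp rel; have [e ce] := exp_exists (@natS_unit _) (c *+ p).
have fpE : f ^+ p = dilate p f * e.
  apply: (isexp_uniq (@natS_unit _) (isexp_expn p af)).
  apply: (eq_isexp _ (isexpD (isexp_dilate p_gt0 af) ce)).
  by move=> K K0; have := rel K K0; rewrite !mulr_natl scoefD !scoefMn.
have e0 : e 0 = 1 by case: ce.
have f0 : f 0 = 1 by case: af.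
elim/ltn_ind => n IH; case: (posnP n) => [->|n0]; first by rewrite f0; exact: (pint_nat p_prime 1).
(* The truncation [u] is integral by induction. In degree [n], [f ^+ p] exceeds [u ^+ p] by
   [p * f n], and both are congruent modulo [p] to the coefficient of [u] at [x ^ p]; hence [p]
   divides [p * f n] among [p]-integral numbers. *)
pose u := \poly_(i < n) f i.
have uE i : u`_i = if (i < n)%N then f i else 0 by rewrite coef_poly.
have vu : vgep 0 u.
  by move=> i; rewrite uE; case: ifP => [/IH|_]; [move=> ?; apply/vge0E|exact: vge0].
have E1 : (f ^+ p) n = (u ^+ p)`_n + p%:R * f n.
  rewrite (@exp_coef_mod f (Series (fun i => u`_i))) //= ?uE ?n0 ?ltnn //; last first.
    by move=> i lt_in; rewrite uE lt_in.
  by congr (_ + _); exact: (@scoef_exp (Series (fun i => u`_i)) u n).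
have E2 : vge p 1 ((f ^+ p) n - (u \Po 'X^p)`_n).
  rewrite fpE scoefM big_ord_recr /= subnn e0 mulr1 -addrA; apply: vgeD.
    apply: vge_sum => i _; have lt_in := ltn_ord i.
    have ei : vge p 1 (e (n - i)%N) by apply: vge_exp_p ce _ _; rewrite ?subn_gt0.
    have fi : vge p 0 (dilate p f i).
      rewrite /=; case: ifP => _; last exact: vge0.
      by apply/vge0E/IH/(leq_ltn_trans (leq_div _ _)).
    exact: (vgeM p_prime fi ei).
  rewrite coef_comp_poly_Xn //=; case: ifP => _; last by rewrite subrr; exact: vge0.
  by rewrite uE ltn_Pdiv // subrr; exact: vge0.
have := vgep_frobenius vu n; rewrite coefB => E3.
have : vge p 1 (p%:R * f n).
  have -> : p%:R * f n = ((f ^+ p) n - (u \Po 'X^p)`_n) - ((u ^+ p)`_n - (u \Po 'X^p)`_n).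
    by rewrite E1; ring.
  exact: vgeB.
by rewrite /vge expr1z mulrC mulrA mulVf ?mul1r.
Qed.

End Dwork.

(** * The p-adic bound *)

Section CoprimeDegrees.
Variables (p q d : nat).
Hypothesis p_prime : prime p.
Hypothesis q_gt1 : (1 < q)%N.
Hypothesis p_ndvd_q : ~~ (p %| q)%N.
Hypothesis d_order : is_mult_order q p d.
Let p_gt1 := prime_gt1 p_prime.
Let p_gt0 := prime_gt0 p_prime.
Let p0 : (p%:R : rat) != 0. Proof. by rewrite pnatr_eq0 gtn_eqF. Qed.

Lemma expq_gt0 K : (0 < q ^ K)%N. Proof. by rewrite expn_gt0 ltnW. Qed.

Lemma natr_expq_sub1 K : ((q ^ K - 1)%N%:R : rat) = q%:R ^+ K - 1.
Proof. by rewrite natrB ?expq_gt0 // natrX. Qed.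

Lemma subn1_expq_gt0 K : (0 < K)%N -> (0 < q ^ K - 1)%N.
Proof. by move=> K0; rewrite subn_gt0 -{1}(expn0 q) ltn_exp2l. Qed.

(* The logarithm in the degrees [K] where [q ^ K - 1] is prime to [p]. *)
Definition coprime_part : series rat :=
  Series (fun K => if (d %| K)%N then 0 else (K%:R * (q%:R ^+ K - 1))^-1).

(** For [d = 1] the series is empty; otherwise [d < p] forces [p > 2] and [dwork] applies. At
    [K = p * J] the numerator to be divided by [p * J] is [q ^ J * (q ^ (J * p.-1) - 1)]. Since [d]
    divides [p.-1], [lambda_gt] gives it valuation greater than that of [J]. *)
Lemma coprime_part_int f : isexp coprime_part f -> forall n, pint p (f n).
Proof.
move=> fE; have [d1|d_neq1] := eqVneq d 1%N.
  have [f0 fn] : f 0 = 1 /\ forall n, (0 < n)%N -> f n = 0.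
    have E : isexp coprime_part (1 : series rat).
      by apply: (eq_isexp _ (@isexp0 rat)) => j _; rewrite /= d1 dvd1n.
    by rewrite (isexp_uniq (@natS_unit _) fE E); split=> // n n0; rewrite scoef1 gtn_eqF.
  by case=> [|n]; rewrite ?f0 ?fn //; [exact: (pint_nat p_prime 1)|exact: (pint_nat p_prime 0)].
have [d0 _ _] := d_order.
have lt_dp := order_lt p_prime q_gt1 p_ndvd_q d_order.
have p3 : (2 < p)%N by apply: leq_ltn_trans lt_dp; case: (d) d0 d_neq1 => [|[]].
have cop := order_coprime p_prime q_gt1 p_ndvd_q d_order.
have unit K : ~~ (d %| K)%N -> ~~ (p %| q ^ K - 1)%N.
  by rewrite (expn_sub1_dvd q_gt1 d_order).
pose c := Series (fun K => coprime_part K - dilate p coprime_part K / p%:R).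
apply: (@dwork p p_prime coprime_part c f p3 fE) => [K|K K0]; last first.
  by rewrite /= ; field.
rewrite [c K]/=; case: (boolP (p %| K)%N) => [/dvdnP[J ->]|pK]; last first.
  rewrite mul0r subr0; case: ifP => [_|/negbT dK]; first exact: (pint_nat p_prime 0).
  by rewrite -natr_expq_sub1 -natrM; apply: pint_inv; rewrite ndvdM ?pK ?unit.
rewrite mulnK // mulnC Gauss_dvdr //; case: ifP => [_|/negbT dJ].
  by rewrite mul0r subrr; exact: (pint_nat p_prime 0).
have J0 : (0 < J)%N by case: (J) dJ; rewrite ?dvdn0.
have qJ := subn1_expq_gt0 J0; have qpJ : (0 < q ^ (p * J) - 1)%N by apply: subn1_expq_gt0; rewrite muln_gt0 p_gt0.
have dpJ : ~~ (d %| p * J)%N by rewrite Gauss_dvdr.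
have dP : (d %| J * p.-1)%N by rewrite dvdn_mull // (order_dvd_pred p_prime q_gt1 p_ndvd_q d_order).
have JP0 : (0 < J * p.-1)%N by rewrite muln_gt0 J0 -ltnS prednK.
have -> : ((p * J)%N%:R * (q%:R ^+ (p * J) - 1))^-1 - (J%:R * (q%:R ^+ J - 1))^-1 / p%:R =
   0 - ((q ^ J)%N%:R * (q ^ (J * p.-1) - 1)%N%:R) * (p * J)%N%:R^-1 *
   ((q ^ (p * J) - 1)%N%:R^-1 * (q ^ J - 1)%N%:R^-1) :> rat.
  have -> : ((q ^ J)%N%:R * (q ^ (J * p.-1) - 1)%N%:R) = (q%:R ^+ (p * J) - 1) - (q%:R ^+ J - 1) :> rat.
    rewrite natr_expq_sub1 mulrBr natrX -exprD -mulnS prednK // mulr1 (mulnC J); ring.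
  move: qJ qpJ J0; rewrite -!(ltr0n rat) -!natr_expq_sub1 natrM.
  move=> /lt0r_neq0 h1 /lt0r_neq0 h2 /lt0r_neq0 h3; field.
  by rewrite h1 h2 h3.
apply: pintB => //; first exact: (pint_nat p_prime 0).
apply: pintM => //; last by apply: pintM => //; apply: pint_inv; exact: unit.
have v1 : vge p (logn p J).+1 ((q ^ J)%N%:R * (q ^ (J * p.-1) - 1)%N%:R).
  rewrite -natrM; have N0 : (0 < q ^ J * (q ^ (J * p.-1) - 1))%N.
    by rewrite muln_gt0 expq_gt0 subn1_expq_gt0.
  apply: vge_le (vge_nat p_prime N0) => //; rewrite lez_nat lognM ?expq_gt0 ?subn1_expq_gt0 //.
  rewrite (logn_expn_sub1 p_prime q_gt1 p_ndvd_q d_order) // dP.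
  apply: leq_trans (leq_addl _ _); apply: leq_ltn_trans (lambda_gt p_prime q_gt1 d_order _).
  by rewrite lognM // ?leq_addr // -ltnS prednK.
have pJ0 : (0 < p * J)%N by rewrite muln_gt0 p_gt0.
have := vgeM p_prime v1 (vge_natV p_prime pJ0).
by rewrite lognM // (pfactorK 1 p_prime) add1n subrr => /vge0E.
Qed.

End CoprimeDegrees.

Section Weight.
Variables (p q d r : nat) (k : nat -> nat) (l : nat).
Hypothesis p_prime : prime p.
Hypothesis q_gt1 : (1 < q)%N.
Hypothesis p_ndvd_q : ~~ (p %| q)%N.
Hypothesis d_order : is_mult_order q p d.
Hypothesis r_gt0 : (0 < r)%N.
Hypothesis kr_gt0 : (0 < k r)%N.
Hypothesis l_min : is_smallest_minimizer (objective p q d r k) l.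
Let p_gt0 := prime_gt0 p_prime.
Let b := b_ p q d r k.
Let b_l : b l <= 0. Proof. exact: (b_l_le0 p_prime q_gt1 p_ndvd_q r_gt0 kr_gt0 l_min). Qed.

(** The valuation of [z ^ M / M!] when [z] has valuation [b l]. *)
Definition wt (M : nat) : int := b l * M%:Z - (logn p M`!)%:Z.

Lemma wt_anti M N : (M <= N)%N -> wt N <= wt M.
Proof.
move=> le_MN; apply: lerB; first by rewrite ler_wnM2l // lez_nat.
by rewrite lez_nat leq_logn_fact.
Qed.

Lemma wtD M N : wt (M + N)%N <= wt M + wt N.
Proof. by have := logn_factD p M N; rewrite /wt PoszD mulrDr; lia. Qed.

Lemma wt0 : wt 0 = 0. Proof. by rewrite /wt mulr0 logn1 subrr. Qed.

Definition wdeg (n : nat) : int := wt (n %/ (d * p ^ l)).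

Let d_gt0 : (0 < d)%N. Proof. by case: d_order. Qed.
Let D_gt0 : (0 < d * p ^ l)%N. Proof. by rewrite muln_gt0 d_gt0 expn_gt0 p_gt0. Qed.

Lemma wdeg_anti m n : (m <= n)%N -> wdeg n <= wdeg m.
Proof. by move=> le_mn; apply/wt_anti/leq_div2r. Qed.

Lemma wdegD m n : wdeg (m + n) <= wdeg m + wdeg n.
Proof. by apply: le_trans (wtD _ _); apply/wt_anti; rewrite divnD // leq_addr. Qed.

Lemma wdeg0 : wdeg 0 = 0. Proof. by rewrite /wdeg div0n wt0. Qed.

Lemma wdeg_le0 n : wdeg n <= 0. Proof. by rewrite -wdeg0 wdeg_anti. Qed.

Definition bounded (n : nat) (x : rat) : Prop := vge p (wdeg n) x.

Lemma bounded0 n : bounded n 0. Proof. exact: vge0. Qed.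

Lemma boundedB n x y : bounded n x -> bounded n y -> bounded n (x - y).
Proof. exact: vgeB. Qed.

Lemma boundedM m n x y : bounded m x -> bounded n y -> bounded (m + n) (x * y).
Proof. by move=> bx bY; apply: vge_le (vgeM p_prime bx bY) => //; exact: wdegD. Qed.

Lemma bounded_pint n x : pint p x -> bounded n x.
Proof. by move=> px; apply: (@vge_le p p_prime 0); [exact: wdeg_le0|apply/vge0E]. Qed.

Lemma bounded1 : bounded 0 1.
Proof. by apply: bounded_pint; exact: (pint_nat p_prime 1). Qed.

Let N1 : forall n, (n.+1%:R : rat) \is a GRing.unit := @natS_unit _.

Lemma exp_bounded_dilate e a : (0 < e)%N -> exp_in bounded a -> exp_in bounded (dilate e a).
Proof.
move=> e0 [f af bf]; exists (dilate e f); first exact: isexp_dilate.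
move=> n /=; case: ifP => _; last exact: bounded0.
by apply: vge_le (bf _) => //; rewrite wdeg_anti // leq_div.
Qed.

Lemma exp_bounded_sscale c a : pint p c -> exp_in bounded a -> exp_in bounded (sscale c a).
Proof.
move=> pc [f af bf]; exists (sscale c f); first exact: isexp_sscale.
move=> n /=; rewrite /bounded -[wdeg n]add0r; apply: (vgeM p_prime _ (bf n)).
by apply/vge0E; exact: (pintX p_prime).
Qed.

(** With [i = logn p K], [K] is a multiple of [d * p ^ i]. The term of degree [t * K] is
    [x ^ t / t!], to which [key_ineq] applies; [wt_anti] absorbs the extra factor of [K]. *)
Lemma exp_bounded_monomial x K : (0 < K)%N -> (d %| K)%N -> vge p (b (logn p K)) x ->
  exp_in bounded (smon x K).
Proof.
move=> K0 /dvdnP[m KE] vx; eexists; first exact: (isexp_monomial N1 x K0).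
move=> n /=; case: ifP => [/dvdnP[t ->]|_]; last exact: bounded0.
rewrite mulnK //; have := vgeM p_prime (vgeX p_prime t vx) (vge_natV p_prime (fact_gt0 t)).
apply: vge_le => //.
apply: le_trans (key_ineq p_prime q_gt1 p_ndvd_q d_order r_gt0 kr_gt0 l_min (logn p K) t).
apply: wt_anti.
have [u KmE] : exists u, m = (u * p ^ logn p K)%N.
  have m0 : (0 < m)%N by move: K0; rewrite KE muln_gt0 => /andP[].
  exists (m %/ p ^ logn p K)%N; rewrite divnK //.
  rewrite pfactor_dvdn // KE lognM // (logn_coprime (m := d)) ?addn0 //.
  by rewrite coprime_sym (order_coprime p_prime q_gt1 p_ndvd_q d_order).
have u0 : (0 < u)%N by move: K0; rewrite KE KmE !muln_gt0; case: (u).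
have tKE : (t * K = d * (u * (t * p ^ logn p K)))%N by rewrite {1}KE {1}KmE; lia.
by rewrite tKE divnMl // leq_div2r // leq_pmull.
Qed.

Variable eta : nat -> rat.
Hypothesis eta1 : forall K, (0 < K)%N -> ~~ (d %| K)%N -> eta K = 1.
Hypothesis eta_dvd : forall K, (0 < K)%N -> (d %| K)%N ->
  vge p (c_ r k (lambda p q d (logn p K))) (eta K).

(** Up to degree [n], the twist is an integer combination of copies of one logarithm [A] under the
    substitutions of [q ^- i * x ^ j] for [x]. All these operations keep the exponential within the
    filtration [bounded]. *)
Lemma twist_bounded (Om : nat -> {poly int}) f :
  isexp (twist Om q eta) f -> forall n, bounded n (f n).
Proof.
move=> fE n; pose a K := eta K / (K%:R * (q%:R ^+ K - 1)).
pose A := coprime_part q d + \sum_(1 <= K < n.+1 | (d %| K)%N) smon (a K) K.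
have AE K : (0 < K <= n)%N -> A K = a K.
  move=> /andP[K0 le_Kn]; rewrite scoefD scoef_sum /=; case: ifP => dK.
    rewrite add0r big_mkcond (bigD1_seq K) ?mem_index_iota ?K0 ?iota_uniq //= dK eqxx.
    by rewrite big1 ?addr0 // => j jK; rewrite eq_sym (negPf jK) if_same.
  rewrite big1 ?addr0 /a ?eta1 ?dK ?mul1r // => j dj; case: eqP dj => // <-.
  by rewrite dK.
have SA : exp_in bounded A.
  apply: (exp_inD bounded0 boundedB boundedM).
    have [g gE] := exp_exists N1 (coprime_part q d); exists g => // m.
    by apply/bounded_pint/(coprime_part_int p_prime q_gt1 p_ndvd_q d_order gE).
  rewrite big_nat_cond; apply: (exp_in_sum bounded0 boundedB boundedM bounded1).
  move=> K /andP[/andP[K0 _] dK]; apply: exp_bounded_monomial => //.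
  have qK := subn1_expq_gt0 q_gt1 K0.
  have N0 : (0 < K * (q ^ K - 1))%N by rewrite muln_gt0 K0.
  have := vgeM p_prime (eta_dvd K0 dK) (vge_natV p_prime N0).
  rewrite lognM // (logn_expn_sub1 p_prime q_gt1 p_ndvd_q d_order) // dK natrM natr_expq_sub1 //.
  by apply: vge_le => //; rewrite /b /b_; lia.
pose g j := \sum_(i < size (Om j)) sscale (q%:R ^- i) A *~ (Om j)`_i.
have Sg j : exp_in bounded (g j).
  apply: (exp_in_sum bounded0 boundedB boundedM bounded1) => i _.
  apply: (exp_inMz N1 bounded0 boundedB boundedM bounded1).
  apply: exp_bounded_sscale => //; rewrite -exprVn; apply: (pintX p_prime).
  exact: pint_inv.
have [h hE Sh] : exp_in bounded (\sum_(1 <= j < n.+1) dilate j (g j)).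
  rewrite big_nat_cond; apply: (exp_in_sum bounded0 boundedB boundedM bounded1) => j.
  by rewrite andbT => /andP[j0 _]; exact: exp_bounded_dilate.
rewrite (isexp_eq_le N1 fE hE) // => M /andP[M0 le_Mn].
rewrite scoef_sum_dilate //=; apply: eq_big => j.
  by rewrite ltnS (leq_trans _ le_Mn) ?andbT // -ltnS.
move=> jM; rewrite scoef_sum /=.
have j0 : (0 < j)%N by case: (posnP j) jM => [->|//]; rewrite dvd0n => /eqP ME; move: M0; rewrite ME.
have Mj0 : (0 < M %/ j)%N by rewrite divn_gt0 // dvdn_leq.
rewrite horner_coef size_map_inj_poly //; last exact: intr_inj.
rewrite -mulrA mulr_suml; apply: eq_bigr => i _.
have -> : (sscale (q%:R ^- i) A *~ (Om j)`_i) (M %/ j)%N = (q%:R ^- i) ^+ (M %/ j) * a (M %/ j)%N *~ (Om j)`_i.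
  by rewrite scoefMz -AE // Mj0 (leq_trans (leq_div _ _)).
rewrite coef_map /= /a.
by rewrite -[RHS]mulrzl -!mulrA -!exprVn -!exprM mulnC.
Qed.

End Weight.

(** * Valuations of the twist and of the group orders, and the conclusion *)

Lemma logn_prod p (I : Type) (s : seq I) (P : pred I) (G : I -> nat) :
  (forall i, P i -> (0 < G i)%N) ->
  logn p (\prod_(i <- s | P i) G i) = (\sum_(i <- s | P i) logn p (G i))%N.
Proof.
move=> G0; suff [] : logn p (\prod_(i <- s | P i) G i) = (\sum_(i <- s | P i) logn p (G i))%N /\
  (0 < \prod_(i <- s | P i) G i)%N by [].
elim/big_ind2: _ => [|x y m t [Ex x0] [Et t0]|i Pi]; rewrite ?logn1 //; last by split=> //; exact: G0.
by rewrite lognM // Ex Et muln_gt0 x0 t0.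
Qed.

Lemma sum_dvdn_nat d (G : nat -> nat) n : (0 < d)%N ->
  (\sum_(1 <= j < n.+1 | d %| j) G j = \sum_(1 <= t < (n %/ d).+1) G (t * d))%N.
Proof.
move=> d0; elim: n => [|n IH]; first by rewrite div0n !big_geq.
rewrite big_mkcond big_nat_recr //= -big_mkcond IH divnS //.
case: ifP => [/dvdnP[[|t] E]|_]; rewrite ?addn0 //.
have En : (n %/ d)%N = t.
  have := divnS n d0; rewrite E dvdn_mull // mulnK // add1n => - [].
  by [].
by rewrite add1n [RHS]big_nat_recr //= En E.
Qed.

Lemma logn_fact_iter p m l : prime p ->
  logn p m`! = (\sum_(1 <= i < l.+1) m %/ p ^ i + logn p (m %/ p ^ l)`!)%N.
Proof.
move=> p_prime; elim: l => [|l IH]; first by rewrite big_geq // expn0 divn1.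
by rewrite big_nat_recr //= IH (logn_fact_div p_prime (m %/ p ^ l)) -divnMA -expnSr addnA.
Qed.

Section Cyclic.
Variables (p q d r : nat) (k : nat -> nat).
Hypothesis p_prime : prime p.
Hypothesis q_gt1 : (1 < q)%N.
Hypothesis p_ndvd_q : ~~ (p %| q)%N.
Hypothesis d_order : is_mult_order q p d.

Let cyc_order_gt0 (i : cyc_index r k) : (0 < cyc_order p i)%N.
Proof. exact: ltnW (cyc_order_gt1 p_prime i). Qed.

Lemma logn_eta_cyc K : (0 < K)%N ->
  logn p (\prod_(i : cyc_index r k) gcdn (cyc_order p i) (q ^ K - 1)) =
  c_ r k (logn p (q ^ K - 1)).
Proof.
move=> K0; rewrite logn_prod => [|i _]; last by rewrite gcdn_gt0 cyc_order_gt0.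
transitivity (\sum_(i : cyc_index r k) minn (logn p (q ^ K - 1)) (tag i).+1)%N.
  apply: eq_bigr => i _; rewrite logn_gcd ?subn1_expq_gt0 //.
  by rewrite /cyc_order pfactorK // minnC.
rewrite -(sig_big_dep xpredT (fun _ => xpredT) (fun (j : 'I_r) _ => minn (logn p (q ^ K - 1)) j.+1)).
rewrite /c_ big_add1 big_mkord; apply: eq_bigr => j _.
by rewrite sum_nat_const card_ord mulnC.
Qed.

Lemma eta_cyc_dvd K : (0 < K)%N -> (d %| K)%N ->
  vge p (c_ r k (lambda p q d (logn p K))) (eta_cyc (@cyc_order p r k) q K).
Proof.
move=> K0 dK; have := logn_expn_sub1 p_prime q_gt1 p_ndvd_q d_order K0; rewrite dK => <-.
rewrite -logn_eta_cyc //; apply: vge_nat => //.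
by apply: prodn_gt0 => i; rewrite gcdn_gt0 cyc_order_gt0.
Qed.

Lemma eta_cyc_ndvd K : (0 < K)%N -> ~~ (d %| K)%N -> eta_cyc (@cyc_order p r k) q K = 1.
Proof.
move=> K0 dK; rewrite /eta_cyc big1 // => i _; apply/eqP.
by rewrite -/(coprime _ _) coprimeXl // prime_coprime // (expn_sub1_dvd q_gt1 d_order).
Qed.

(** Powers of [q] are prime to [p], and only the factors [q ^ (t * d) - 1] count, where [t * d] has
    the valuation of [t]. *)
Lemma logn_gl_card n :
  logn p (gl_card q n) = (\sum_(1 <= t < (n %/ d).+1) lambda p q d (logn p t))%N.
Proof.
have [d0 _ _] := d_order; have q0 := ltnW q_gt1.
have pos i : (0 < i)%N -> (0 < q ^ i - 1)%N by exact: subn1_expq_gt0.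
rewrite /gl_card big_nat_cond lognM ?expn_gt0 ?q0 //; last first.
  by rewrite prodn_cond_gt0 // => i /andP[/andP[i0 _] _]; exact: pos.
rewrite logn_coprime ?coprimeXr ?prime_coprime // add0n logn_prod; last first.
  by move=> i /andP[/andP[i0 _] _]; exact: pos.
transitivity (\sum_(1 <= j < n.+1 | (d %| j)%N) lambda p q d (logn p j))%N.
  rewrite -big_nat_cond [RHS]big_mkcond !big_nat; apply: eq_bigr => i /andP[i0 _].
  exact: logn_expn_sub1.
rewrite sum_dvdn_nat // !big_nat; apply: eq_bigr => t /andP[t0 _].
rewrite lognM // (logn_coprime (m := d)) ?addn0 //.
by rewrite coprime_sym (order_coprime p_prime q_gt1 p_ndvd_q d_order).
Qed.

Lemma logn_gl_card_regular n : (2 < p)%N || (1 < lambda p q d 0)%N ->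
  logn p (gl_card q n) = (lambda p q d 0 * (n %/ d) + logn p (n %/ d)`!)%N.
Proof.
move=> reg; have lamE i : lambda p q d i = (lambda p q d 0 + i)%N.
  elim: i => [|i IH]; first by rewrite addn0.
  by rewrite (lambdaS p_prime q_gt1 d_order) ?addnS ?IH //; case/orP: reg => ->; rewrite ?orbT.
rewrite logn_gl_card (eq_bigr _ (fun t _ => lamE (logn p t))) big_split /= -logn_fact_prod.
by rewrite sum_nat_const_nat subn1 mulnC.
Qed.

(** Here [d = 1]. Every [t] up to [n] contributes 1, and an even [t = 2 * s] a further
    [lambda 1 + logn 2 s - 1]; the last unit is moved to the left to avoid truncated subtraction. *)
Lemma logn_gl_card_two n : p = 2%N -> lambda p q d 0 = 1%N ->
  (logn p (gl_card q n) + n %/ 2 = n + lambda p q d 1 * (n %/ 2) + logn p (n %/ 2)`!)%N.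
Proof.
move=> p2 lam0; have [d0 _ _] := d_order.
have d1 : d = 1%N.
  by have := order_lt p_prime q_gt1 p_ndvd_q d_order; rewrite p2; case: (d) d0 => [|[]].
have lamE i : lambda p q d i.+1 = (lambda p q d 1 + i)%N.
  elim: i => [|i IH]; first by rewrite addn0.
  by rewrite (lambdaS p_prime q_gt1 d_order) ?addnS ?IH // orbT.
have p2E : logn p 2 = 1%N by rewrite p2.
have lam_split t : (0 < t)%N -> lambda p q d (logn p t) =
    (1 + if 2 %| t then (lambda p q d (logn p t)).-1 else 0)%N.
  move=> t0; case: ifP => t2.
    by rewrite add1n prednK // (leq_ltn_trans _ (lambda_gt p_prime q_gt1 d_order _)).
  by rewrite lognE {3}p2 t2 !andbF lam0.
rewrite logn_gl_card {1}d1 divn1 big_nat.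
rewrite (eq_bigr _ (fun t ht => lam_split t (proj1 (andP ht)))) -big_nat big_split /=.
rewrite sum_nat_const_nat subn1 muln1 -big_mkcond sum_dvdn_nat //= -!addnA; congr (n + _)%N.
have -> : (\sum_(1 <= t < (n %/ 2).+1) (lambda p q d (logn p (t * 2))).-1 =
  \sum_(1 <= t < (n %/ 2).+1) (lambda p q d 1 + logn p t).-1)%N.
  rewrite !big_nat; apply: eq_bigr => t /andP[t0 _].
  by rewrite lognM // [logn p 2]p2E addn1 lamE.
rewrite logn_fact_prod; elim: (n %/ 2)%N => [|m IH]; first by rewrite !big_geq // muln0.
have := lambda_ltS p_prime q_gt1 d_order 0.
by rewrite [in LHS]big_nat_recr //= [in RHS]big_nat_recr //= mulnS; move: IH; lia.
Qed.

End Cyclic.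

Lemma logn_nHom_ge (p q d r : nat) (k : nat -> nat) (F : finFieldType) (l : nat) :
  prime p -> #|F| = q -> ~~ (p %| q)%N -> is_mult_order q p d -> (0 < r)%N -> (0 < k r)%N ->
  is_smallest_minimizer (objective p q d r k) l -> forall n,
  wdeg p q d r k l n + (logn p (gl_card q n))%:Z <=
    (logn p (nHom (prod_cyclic p r k) (GLn F n)))%:Z.
Proof.
move=> p_prime F_q p_ndvd_q d_order r_gt0 kr_gt0 l_min n.
have q_gt1 : (1 < q)%N by rewrite -F_q finNzRing_gt1.
(* If [p] vanished in [F], the additive order of 1 would be [p] and would divide [q]. *)
have ordF (i : cyc_index r k) : (cyc_order p i)%:R != 0 :> F.
  rewrite natrX expf_neq0 //; apply: contra p_ndvd_q; rewrite -order_dvdn => op.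
  have /(prime_nt_dvdP p_prime)/(_ op) <- : #[1%R : F]%g != 1%N by rewrite order_eq1 oner_neq0.
  by rewrite -F_q -cardsT order_dvdG ?inE.
have [Om OmE] := exp_gl_card.
have := nu_exp OmE ordF; rewrite F_q => nuE.
have := twist_bounded p_prime q_gt1 p_ndvd_q d_order r_gt0 kr_gt0 l_min
  (eta_cyc_ndvd r k p_prime q_gt1 d_order) (eta_cyc_dvd r k p_prime q_gt1 p_ndvd_q d_order) nuE n.
rewrite /bounded /= -nHom_hs // card_gls F_q => vn.
have gl0 : (gl_card q n)%:R != 0 :> rat by rewrite pnatr_eq0 -lt0n gl_card_gt0.
apply: vge_logn => //.
  (* The trivial homomorphism shows that the count is positive, as [vge_logn] requires. *)
  apply/card_gt0P; exists [ffun _ => 1%g]; rewrite inE; apply/morphicP => x y _ _.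
  by rewrite !ffunE mulg1.
have := vgeM p_prime vn (vge_nat p_prime (gl_card_gt0 n q_gt1)).
by rewrite divfK.
Qed.

Theorem theorem2p13 (p q d r : nat) (k : nat -> nat) (F : finFieldType)
    (l : nat)
    (p_prime : prime p)
    (F_q : #|F| = q)
    (p_ndvd_q : ~~ (p %| q)%N)
    (d_order : is_mult_order q p d)
    (r_gt0 : (0 < r)%N)
    (kr_gt0 : (0 < k r)%N)
    (l_min : is_smallest_minimizer (objective p q d r k) l)
    (n : nat) :
  ((3 <= p)%N || (2 <= lambda p q d 0)%N ->
    b_ p q d r k l * (n %/ (d * p ^ l))%N%:Z
      + \sum_(0 <= i < l.+1) (n %/ (d * p ^ i))%N%:Z
      + ((lambda p q d 0)%:Z - 1) * (n %/ d)%N%:Z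
    <= (logn p (nHom (prod_cyclic p r k) (GLn F n)))%:Z)
  /\
  (p = 2%N -> lambda p q d 0 = 1%N ->
    b_ p q d r k l * (n %/ 2 ^ l)%N%:Z
      + \sum_(0 <= i < l.+1) (n %/ 2 ^ i)%N%:Z
      + ((lambda p q d 1)%:Z - 2) * (n %/ 2)%N%:Z
    <= (logn p (nHom (prod_cyclic p r k) (GLn F n)))%:Z).
Proof.
have q_gt1 : (1 < q)%N by rewrite -F_q finNzRing_gt1.
have bound := logn_nHom_ge p_prime F_q p_ndvd_q d_order r_gt0 kr_gt0 l_min n.
(* After [l] steps of Legendre's recursion, the remaining factorial cancels against the one in
   [wdeg]. *)
have factE := logn_fact_iter (n %/ d) l p_prime.
have sumE : \sum_(0 <= i < l.+1) (n %/ (d * p ^ i))%N%:Z =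
    (n %/ d)%N%:Z + (\sum_(1 <= i < l.+1) n %/ d %/ p ^ i)%N%:Z.
  rewrite [LHS]big_ltn // expn0 muln1 (big_morph Posz PoszD (erefl _)); congr (_ + _).
  by apply: eq_bigr => i _; rewrite divnMA.
rewrite /wdeg /wt !divnMA in bound; split=> [reg|p2 lam0].
  rewrite divnMA sumE; have := logn_gl_card_regular p_prime q_gt1 p_ndvd_q d_order n reg.
  lia.
have := logn_gl_card_two p_prime q_gt1 p_ndvd_q d_order n p2 lam0.
have d1 : d = 1%N.
  have [d0 _ _] := d_order; have := order_lt p_prime q_gt1 p_ndvd_q d_order.
  by rewrite p2; case: (d) d0 => [|[]].
have -> : \sum_(0 <= i < l.+1) (n %/ 2 ^ i)%N%:Z = \sum_(0 <= i < l.+1) (n %/ (d * p ^ i))%N%:Z.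
  by apply: eq_bigr => i _; rewrite d1 p2 mul1n.
(* One more step of the recursion replaces the factorial of [n %/ 2] by that of [n]; together with
   the unit moved in [logn_gl_card_two] it produces the constant 2. *)
rewrite sumE; have := logn_fact_div p_prime n.
subst p d; rewrite !divn1 in factE bound *; move: factE bound; lia.
Qed.
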